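(* Let $k\in\{1,2\}$ and let $\mu$ be a Radon measure on $\mathbb{R}^k$ (with the Euclidean metric). If the module $\Upsilon(\mathbb{R}^k,\mu)$ of derivations has rank $k$, then $\mu$ is absolutely continuous with respect to Lebesgue measure $m_k$. Moreover, every $\delta\in\Upsilon(\mathbb{R}^k,\mu)$ is a linear combination of the differential operators $\partial/\partial x_1,\dots,\partial/\partial x_k$ with coefficients in $L^\infty(\mathbb{R}^k,\mu)$, i.e. there are $\lambda_1,\dots,\lambda_k\in L^\infty(\mathbb{R}^k,\mu)$ with $\delta f=\sum_{i=1}^k\lambda_i\,\partial f/\partial x_i$ $\mu$-a.e. for every bounded Lipschitz $f$.
   Context: For a metric space $(X,\rho)$, $\mathrm{Lip}_b(X)$ denotes the bounded Lipschitz functions $f:X\to\mathbb{R}$, normed by $\|f\|_{\mathrm{Lip}}=\max(\sup|f|,L(f))$ where $L(f)$ is the Lipschitz constant. For a Borel measure $\mu$ on $X$, a derivation is a linear map $\delta:\mathrm{Lip}_b(X)\to L^\infty(X,\mu)$ such that (i) $\delta(fg)=f\,\delta g+g\,\delta f$ for all $f,g$; (ii) whenever $(f_\alpha)$ is a net in $\mathrm{Lip}_b(X)$ with $\sup_\alpha\|f_\alpha\|_{\mathrm{Lip}}<\infty$ converging pointwise to $f$ (equivalently, a bounded net converging weak-* in $\mathrm{Lip}_b(X)$, viewed as a dual Banach space), then $\delta f_\alpha\to\delta f$ weak-* in $L^\infty(X,\mu)$. $\Upsilon(X,\mu)$ denotes the set of derivations; it is an $L^\infty(X,\mu)$-module via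 $(\lambda\delta)f=\lambda\cdot\delta f$. A finite set $\{\delta_i\}_{i=1}^N$ is linearly independent if $\sum_i\lambda_i\delta_i=0$ with $\lambda_i\in L^\infty(X,\mu)$ forces every $\lambda_i=0$; the rank of $\Upsilon(X,\mu)$ is the largest cardinality of a linearly independent set. Partial derivatives of Lipschitz functions exist $m_k$-a.e. by Rademacher's theorem. *)

(* Defs.v *)
From HB Require Import structures.
From mathcomp Require Import all_boot all_order all_algebra.
From mathcomp Require Import all_classical all_reals all_analysis.
Set Implicit Arguments. Unset Strict Implicit. Unset Printing Implicit Defensive.
Import Order.TTheory GRing.Theory Num.Theory.
Import numFieldNormedType.Exports.
Local Open Scope classical_set_scope.
Local Open Scope ring_scope.

Section Derivations.
Context {R : realType} {d : measure_display} {X : measurableType d}.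
Variable dist : X -> X -> R.

(* f is bounded and Lipschitz with  ||f||_Lip = max(sup|f|, L(f)) <= C *)
Definition lip_bounded_by (C : R) (f : X -> R) :=
  (forall x, `|f x| <= C) /\ (forall x y, `|f x - f y| <= C * dist x y).

Definition lipb (f : X -> R) := exists C, lip_bounded_by C f.

Variable mu : {measure set X -> \bar R}.

Definition Linf (g : X -> R) :=
  measurable_fun setT g /\ exists C : R, {ae mu, forall x, `|g x| <= C}.

Definition L1 (g : X -> R) := mu.-integrable setT (EFin \o g).

(* Derivations  Lip_b(X) -> L^oo(X,mu); values of delta outside Lip_b(X)
   are irrelevant, equalities in L^oo are mu-a.e. equalities.  Nets are
   represented by proper filters on an arbitrary index type; weak-*
   convergence in L^oo = convergence of the pairing with every L^1 function. *)
Definition derivation (delta : (X -> R) -> X -> R) :=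
  [/\ (forall f, lipb f -> Linf (delta f)),
      (forall (a b : R) f g, lipb f -> lipb g ->
         {ae mu, forall x, delta (fun y => a * f y + b * g y) x
                           = a * delta f x + b * delta g x}),
      (forall f g, lipb f -> lipb g ->
         {ae mu, forall x, delta (fun y => f y * g y) x
                           = f x * delta g x + g x * delta f x}) &
      (forall (I : Type) (F : set_system I), ProperFilter F ->
         forall (fa : I -> X -> R) (f : X -> R) (C : R),
         (forall i, lip_bounded_by C (fa i)) ->
         (forall x, fa i x @[i --> F] --> f x) ->
         forall g, L1 g ->
         Rintegral mu setT (fun x => g x * delta (fa i) x) @[i --> F] -->
         Rintegral mu setT (fun x => g x * delta f x))].

Definition lin_indep (n : nat) (delta : 'I_n -> (X -> R) -> X -> R) :=
  forall lam : 'I_n -> X -> R, (forall i, Linf (lam i)) ->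
  (forall f, lipb f -> {ae mu, forall x, \sum_(i < n) lam i x * delta i f x = 0}) ->
  forall i, {ae mu, forall x, lam i x = 0}.

Definition derivation_rank_eq (k : nat) :=
  (exists delta : 'I_k -> (X -> R) -> X -> R,
      (forall i, derivation (delta i)) /\ lin_indep delta) /\
  (forall (n : nat) (delta : 'I_n -> (X -> R) -> X -> R), (k < n)%N ->
      (forall i, derivation (delta i)) -> ~ lin_indep delta).

(* Radon measure on R^k: a Borel measure finite on bounded sets
   (equivalently, on compact sets); in R^k such measures are Radon. *)
Definition radon := forall (x : X) (r : R), (mu [set y | (dist x y < r)%R] < +oo)%E.

End Derivations.

Definition dist1 {R : realType} (x y : R) : R := `|x - y|.
Definition dist2 {R : realType} (x y : R * R) : R :=
  Num.sqrt ((x.1 - y.1) ^+ 2 + (x.2 - y.2) ^+ 2).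

Definition lebesgue2 {R : realType} : set (R * R) -> \bar R :=
  (@lebesgue_measure R \x @lebesgue_measure R)%E.

Definition partial1 {R : realType} (i : 'I_1) (f : R -> R) (x : R) : R :=
  derive1 f x.
Definition partial2 {R : realType} (i : 'I_2) (f : R * R -> R) (x : R * R) : R :=
  if val i == 0%N then derive1 (fun t => f (t, x.2)) x.1
  else derive1 (fun t => f (x.1, t)) x.2.

(* Main.v *)
Require Import Defs.
From HB Require Import structures.
From mathcomp Require Import all_boot all_order all_algebra.
From mathcomp Require Import all_classical all_reals all_analysis.
From mathcomp Require Import measurable_realfun.
From mathcomp Require Import ring lra zify.
Set Implicit Arguments. Unset Strict Implicit. Unset Printing Implicit Defensive.
Import Order.TTheory GRing.Theory Num.Theory.
Import numFieldNormedType.Exports.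
Local Open Scope classical_set_scope.
Local Open Scope ring_scope.

(* Weak continuity and the Leibniz rule make a derivation D local: D f = D g a.e. on
   {f = g}. Interpolating f along one coordinate on a fine grid gives functions that are
   affine in that coordinate on each cell, whence D f = sum_i D(x_i) df/dx_i as soon as
   the partial derivatives exist a.e. The coordinates x_i are unbounded, so the rate
   D(x_i) is read off from sin x_i and cos x_i. Independence makes the determinant of the
   rates non-zero a.e., and combinations of the given derivations then have a positive
   rate along one axis and rate 0 along the others.

   Absolute continuity: up to a set of small mu-measure, a Lebesgue null set is covered by
   K squares of a fine grid of small total area. The order "|dj| <= di" splits these
   squares greedily into O(sqrt K) chains and antichains, that is, into strips around
   1-Lipschitz graphs over one of the two axes, of small total width. Collapsing the
   strips in the direction transverse to them yields uniformly Lipschitz functions close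
   to a coordinate whose derivative vanishes on the strips and is at most the rate
   elsewhere; weak continuity forces the integral of the rate over the strips to be
   small. On the line the strips are intervals. *)

(** Rademacher's theorem speaks of Lebesgue-almost every point, so the formula for D cannot serve to
    prove absolute continuity. That half rests on an inequality instead: the slopes of the
    interpolants are bounded by the Lipschitz constant of f along the axis, hence so is D f, up to
    the factor |D(x_i)|. An interpolant in x has coefficients that depend on y, and the Leibniz rule
    turns it into a multiple of D(x) only if D kills functions of y. This is why the plane needs
    derivations with a single non-zero rate. A general D is recovered from them because a derivation
    whose two rates vanish is zero. The count sqrt K is what makes the covering useful: K squares of
    side 1/n have area K/n^2, and O(sqrt K) strips of width O(1/n) have total width O(sqrt K / n),
    the square root of the area up to a constant. One strip per square would only give K/n, which
    need not be small. Collapsing a strip displaces values by its width, whatever its length, and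
    the Lipschitz constants do not grow with the number of strips, as weak continuity demands. *)

(** * Algebra and truncation of bounded Lipschitz functions *)

Section LipschitzAlgebra.
Context {R : realType} {d : measure_display} {X : measurableType d}.
Variable dist : X -> X -> R.
Hypothesis dist_ge0 : forall x y, 0 <= dist x y.

Lemma lip_bounded_by_ge0 (C : R) f (x : X) : lip_bounded_by dist C f -> 0 <= C.
Proof. by move=> [/(_ x) bf _]; apply: le_trans bf. Qed.

Lemma lipb_cst (c : R) : lipb dist (fun=> c).
Proof.
exists `|c|; split=> [//|x y]; rewrite subrr normr0.
exact: mulr_ge0.
Qed.

Lemma lip_bounded_byD (C C' a b : R) f g :
  lip_bounded_by dist C f -> lip_bounded_by dist C' g ->
  lip_bounded_by dist (`|a| * C + `|b| * C') (fun x => a * f x + b * g x).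
Proof.
move=> [bf lf] [bg lg]; split=> [x|x y].
  rewrite (le_trans (ler_normD _ _))// !normrM.
  by apply: lerD; rewrite ler_wpM2l.
have -> : a * f x + b * g x - (a * f y + b * g y) =
  a * (f x - f y) + b * (g x - g y) by ring.
rewrite (le_trans (ler_normD _ _))// !normrM mulrDl -!mulrA.
by apply: lerD; rewrite ler_wpM2l.
Qed.

Lemma lip_bounded_byM (C C' : R) f g :
  lip_bounded_by dist C f -> lip_bounded_by dist C' g ->
  lip_bounded_by dist (C * C' + C * C') (fun x => f x * g x).
Proof.
move=> hf hg.
have [[bf lf] [bg lg]] := (hf, hg).
split=> [x|x y].
  have C0 := lip_bounded_by_ge0 x hf; have C'0 := lip_bounded_by_ge0 x hg.
  rewrite normrM (le_trans (ler_pM _ _ (bf x) (bg x)))// lerDl.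
  exact: mulr_ge0.
have C0 := lip_bounded_by_ge0 x hf; have C'0 := lip_bounded_by_ge0 x hg.
have -> : f x * g x - f y * g y = f x * (g x - g y) + g y * (f x - f y) by ring.
rewrite (le_trans (ler_normD _ _))// !normrM mulrDl.
apply: lerD; first by rewrite -mulrA; apply: ler_pM.
by rewrite mulrAC [leRHS]mulrC; apply: ler_pM.
Qed.

Lemma lipb_lin (a b : R) f g : lipb dist f -> lipb dist g ->
  lipb dist (fun x => a * f x + b * g x).
Proof. by move=> [C hf] [C' hg]; eexists; exact: lip_bounded_byD hf hg. Qed.

Lemma lipb_mul f g : lipb dist f -> lipb dist g ->
  lipb dist (fun x => f x * g x).
Proof. by move=> [C hf] [C' hg]; eexists; exact: lip_bounded_byM hf hg. Qed.

Lemma lipb_sub f g : lipb dist f -> lipb dist g ->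
  lipb dist (fun x => f x - g x).
Proof.
move=> hf hg; have := lipb_lin 1 (-1) hf hg; congr lipb.
by apply/funext => x; rewrite mul1r mulN1r.
Qed.

Lemma normr_max_sub (a b a' b' : R) :
  `|Num.max a b - Num.max a' b'| <= Num.max `|a - a'| `|b - b'|.
Proof.
case: (leP a b) => ?; case: (leP a' b') => ?;
  case: (leP `|a - a'| `|b - b'|) => ?; rewrite ler_norml; apply/andP; split;
  move: (ler_norm (a - a')) (ler_norm (a' - a)) (ler_norm (b - b'))
    (ler_norm (b' - b)); rewrite ?(distrC a') ?(distrC b') => *; lra.
Qed.

Lemma normr_min_sub (a b a' b' : R) :
  `|Num.min a b - Num.min a' b'| <= Num.max `|a - a'| `|b - b'|.
Proof.
case: (leP a b) => ?; case: (leP a' b') => ?;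
  case: (leP `|a - a'| `|b - b'|) => ?; rewrite ler_norml; apply/andP; split;
  move: (ler_norm (a - a')) (ler_norm (a' - a)) (ler_norm (b - b'))
    (ler_norm (b' - b)); rewrite ?(distrC a') ?(distrC b') => *; lra.
Qed.

(** Truncation at level [e]. A large level turns an unbounded coordinate into a bounded Lipschitz
    function that agrees with it on a slab; a small level isolates the zero set of a function. *)
Definition clamp (e t : R) := Num.max (- e) (Num.min t e).

Lemma clamp_lip (e s t : R) : `|clamp e s - clamp e t| <= `|s - t|.
Proof.
rewrite /clamp (le_trans (normr_max_sub _ _ _ _))// subrr normr0.
rewrite ge_max normr_ge0/= (le_trans (normr_min_sub _ _ _ _))//.
by rewrite subrr normr0 ge_max lexx normr_ge0.
Qed.

Lemma clamp_norm (e t : R) : 0 <= e -> `|clamp e t| <= e.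
Proof.
move=> e0; rewrite /clamp; case: (leP t e) => ?; case: (leP (- e) _) => ?;
  rewrite ler_norml; apply/andP; split; lra.
Qed.

Lemma clamp_id (e t : R) : `|t| <= e -> clamp e t = t.
Proof.
by rewrite ler_norml => /andP[? ?]; rewrite /clamp min_l// max_r.
Qed.

Lemma clamp0 (e : R) : 0 <= e -> clamp e 0 = 0.
Proof. by move=> e0; rewrite clamp_id// normr0. Qed.

Lemma lip_bounded_by_clamp (C e : R) f : 0 <= e ->
  lip_bounded_by dist C f -> lip_bounded_by dist C (fun x => clamp e (f x)).
Proof.
move=> e0 [bf lf]; split=> [x|x y]; last exact: le_trans (clamp_lip _ _ _) _.
have := clamp_lip e (f x) 0; rewrite clamp0// !subr0 => /le_trans; apply; exact: bf.
Qed.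

Lemma lipb_clamp (C e : R) f : 0 <= e ->
  (forall x y, `|f x - f y| <= C * dist x y) ->
  lipb dist (fun x => clamp e (f x)).
Proof.
move=> e0 lf; exists (Num.max C e); split=> [x|x y].
  by rewrite le_max clamp_norm// orbT.
rewrite (le_trans (clamp_lip _ _ _))// (le_trans (lf _ _))//.
by rewrite ler_wpM2r// le_max lexx.
Qed.

End LipschitzAlgebra.

(** * Essentially bounded functions and comparison of their integrals *)

Section EssentiallyBounded.
Context {R : realType} {d : measure_display} {X : measurableType d}.
Variable mu : {measure set X -> \bar R}.
Implicit Types (A B : set X) (f g h : X -> R).

Lemma Linf_cst (c : R) : Linf mu (fun=> c).
Proof. by split; [exact: measurable_cst|exists `|c|; exact: aeW]. Qed.

Lemma LinfD f g : Linf mu f -> Linf mu g -> Linf mu (fun x => f x + g x).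
Proof.
move=> [mf [C hf]] [mg [C' hg]]; split; first exact: measurable_funD.
exists (C + C'); apply: filterS2 hf hg => x fx gx.
by rewrite (le_trans (ler_normD _ _))// lerD.
Qed.

Lemma LinfM f g : Linf mu f -> Linf mu g -> Linf mu (fun x => f x * g x).
Proof.
move=> [mf [C hf]] [mg [C' hg]]; split; first exact: measurable_funM.
exists (C * C'); apply: filterS2 hf hg => x fx gx.
by rewrite normrM ler_pM.
Qed.

Lemma LinfN f : Linf mu f -> Linf mu (fun x => - f x).
Proof.
move=> hf; have := LinfM (Linf_cst (-1)) hf; congr Linf.
by apply/funext => x; rewrite mulN1r.
Qed.

Lemma LinfB f g : Linf mu f -> Linf mu g -> Linf mu (fun x => f x - g x).
Proof. by move=> hf /LinfN; exact: LinfD. Qed.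

Lemma Linf_norm f : Linf mu f -> Linf mu (fun x => `|f x|).
Proof.
move=> [mf [C hf]]; split; first exact: measurableT_comp.
by exists C; apply: filterS hf => x; rewrite normr_id.
Qed.

Lemma Linf_indic A : measurable A -> Linf mu (\1_A : X -> R).
Proof.
move=> mA; split; first exact: measurable_indic.
exists 1; apply: aeW => x; rewrite indicE; case: (_ \in _) => /=.
  by rewrite normr1.
by rewrite normr0.
Qed.

Lemma Linf_integrable B f : measurable B -> (mu B < +oo)%E -> Linf mu f ->
  mu.-integrable B (EFin \o f).
Proof.
move=> mB muB [mf [C hf]]; apply/integrableP; split.
  by apply/measurable_EFinP; exact: measurable_funTS.
apply: (@le_lt_trans _ _ (\int[mu]_(x in B) (`|C|%:E))%E).
  apply: ae_ge0_le_integral => //.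
  - by apply/measurableT_comp => //; apply/measurable_EFinP; exact: measurable_funTS.
  - by apply: filterS hf => x hx _; rewrite lee_fin (le_trans hx)// ler_norm.
rewrite integral_cst//; apply: lte_mul_pinfty => //.
Qed.

Lemma Linf_L1 B f : measurable B -> (mu B < +oo)%E -> Linf mu f ->
  L1 mu (f \_ B).
Proof.
move=> mB muB hf; rewrite /L1 -restrict_EFin.
by rewrite -integrable_mkcond//; exact: Linf_integrable.
Qed.

Lemma ae_le_Rintegral B f g : measurable B ->
  mu.-integrable B (EFin \o f) -> mu.-integrable B (EFin \o g) ->
  {ae mu, forall x, B x -> f x <= g x} ->
  \int[mu]_(x in B) f x <= \int[mu]_(x in B) g x.
Proof.
move=> mB hf hg fg.
have [mf mg] := (measurable_int _ hf, measurable_int _ hg).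
(* The minimum of [f] and [g] equals [f] almost everywhere and lies below [g] everywhere, so
   pointwise monotonicity of the integral applies to it. *)
have mm : measurable_fun B (EFin \o (fun x => Num.min (f x) (g x))).
  apply/measurable_EFinP; apply: measurable_minr; exact/measurable_EFinP.
have fE : ae_eq mu B (EFin \o f) (EFin \o (fun x => Num.min (f x) (g x))).
  by apply: filterS fg => x /[apply] fgx /=; rewrite min_l.
have hm : mu.-integrable B (EFin \o (fun x => Num.min (f x) (g x))).
  apply/integrableP; split=> //; have /integrableP[_] := hf.
  congr (_ < _)%E; apply: ae_eq_integral => //; [exact: measurableT_comp..|].
  exact: ae_eq_abse.
rewrite {1}/Rintegral (ae_eq_integral _ _ mB mf mm fE)//.
by apply: le_Rintegral => // x _; rewrite ge_min lexx orbT.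
Qed.

Lemma ae_eq_Rintegral B f g : measurable B ->
  mu.-integrable B (EFin \o f) -> mu.-integrable B (EFin \o g) ->
  {ae mu, forall x, B x -> f x = g x} ->
  \int[mu]_(x in B) f x = \int[mu]_(x in B) g x.
Proof.
by move=> mB hf hg fg; apply/eqP; rewrite eq_le; apply/andP; split;
  apply: ae_le_Rintegral => //; apply: filterS fg => x /[apply] ->.
Qed.

Lemma Rintegral_gt0_null B f : measurable B ->
  mu.-integrable B (EFin \o f) -> (forall x, B x -> 0 < f x) ->
  \int[mu]_(x in B) f x <= 0 -> mu B = 0%E.
Proof.
move=> mB hf f0 int0.
have mf := measurable_int _ hf.
have : ae_eq mu B (EFin \o f) (cst 0%E).
  apply/ae_eq_integral_abs => //.
  have E : (\int[mu]_(x in B) `|(EFin \o f) x| = \int[mu]_(x in B) (f x)%:E)%E.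
    by apply: eq_integral => x /[!inE] Bx /=; rewrite ger0_norm// ltW// f0.
  rewrite E; apply/eqP; rewrite eq_le.
  rewrite integral_ge0 ?andbT; last by move=> x Bx; rewrite lee_fin ltW// f0.
  by rewrite -[leLHS]fineK ?lee_fin//; exact: integrable_fin_num.
move=> [N [mN N0 BN]]; apply/eqP; rewrite -measure_le0 -N0 le_measure ?inE//.
by move=> x Bx; apply: BN => /= /(_ Bx)[] fx0; have := f0 _ Bx; rewrite fx0 ltxx.
Qed.

(** The set where [g < f] is cut into pieces of finite measure; on each of them the integral of the
    positive function [f - g] would be at most 0. This turns weak-* information, tested on
    indicators, back into inequalities almost everywhere. *)
Lemma ae_le_of_Rintegral A f g : sigma_finite setT mu -> measurable A ->
  Linf mu f -> Linf mu g ->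
  (forall B, measurable B -> (mu B < +oo)%E -> B `<=` A ->
     \int[mu]_(x in B) f x <= \int[mu]_(x in B) g x) ->
  {ae mu, forall x, A x -> f x <= g x}.
Proof.
move=> [F FT mF] mA hf hg le_int.
pose N n := A `&` F n `&` [set x | g x < f x].
have mN n : measurable (N n).
  apply: measurableI; first by apply: measurableI => //; have [] := mF n.
  rewrite [X in measurable X](_ : _ = [set x | (g x < f x)%R] `&` setT); last first.
    by rewrite setIT.
  rewrite setIC; apply: measurable_fun_ltr => //; [by case: hg|by case: hf].
have N0 n : mu (N n) = 0%E.
  have muN : (mu (N n) < +oo)%E.
    have [mFn muFn] := mF n; apply: le_lt_trans muFn.
    by apply: le_measure; rewrite ?inE// => x [[]].
  apply: (@Rintegral_gt0_null _ (fun x => f x - g x)) => //.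
  - exact/Linf_integrable/LinfB.
  - by move=> x [_ /=]; rewrite subr_gt0.
  rewrite RintegralB//; [|exact: Linf_integrable..].
  by rewrite subr_le0; apply: le_int => // x [[]].
have Ng : mu.-negligible (\bigcup_n N n).
  apply: negligible_bigcup => n.
  by exists (N n); split.
apply: negligibleS Ng => x /= /not_implyP[Ax /negP]; rewrite -ltNge => gf.
have : setT x by []; rewrite FT => -[n _ Fx]; exists n => //; split=> //.
Qed.

Lemma Linf_dominated_cvg B (e_ : nat -> X -> R) (e : X -> R) (K : R) :
  measurable B -> (mu B < +oo)%E ->
  (forall n, measurable_fun setT (e_ n)) -> measurable_fun setT e ->
  (forall n, {ae mu, forall x, `|e_ n x| <= K}) ->
  {ae mu, forall x, B x -> e_ n x @[n --> \oo] --> e x} ->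
  \int[mu]_(x in B) e_ n x @[n --> \oo] --> \int[mu]_(x in B) e x.
Proof.
move=> mB muB me_ me eK cvg_e.
have hK : mu.-integrable B (EFin \o fun=> K).
  by apply: Linf_integrable => //; exact: Linf_cst.
have [] := @dominated_convergence _ _ _ mu B mB (fun n => EFin \o e_ n)
  (EFin \o e) (EFin \o fun=> K).
- by move=> n; apply/measurable_EFinP; exact: measurable_funTS.
- by apply/measurable_EFinP; exact: measurable_funTS.
- by apply: filterS cvg_e => x /[apply] ex; apply: cvg_EFin => //; exact: nearW.
- exact: hK.
- by apply: filterS (ae_foralln eK) => x xK n _; rewrite lee_fin.
move=> ie _ cv; have fin : (\int[mu]_(x in B) (EFin \o e) x)%E \is a fin_num.
  exact: integrable_fin_num.
by apply/fine_cvg; rewrite fineK.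
Qed.

End EssentiallyBounded.

(** * Weak-* limits, locality and combinations of derivations *)

Section Locality.
Context {R : realType} {d : measure_display} {X : measurableType d}.
Variables (dist : X -> X -> R) (mu : {measure set X -> \bar R}).
Hypothesis dist_ge0 : forall x y, 0 <= dist x y.
Hypothesis mu_sfinite : sigma_finite setT mu.
Implicit Types (A B : set X) (f g h : X -> R).

Lemma derivation_Rintegral_cvg D (f_ : nat -> X -> R) f (C : R) B :
  derivation dist mu D -> (forall n, lip_bounded_by dist C (f_ n)) ->
  (forall x, f_ n x @[n --> \oo] --> f x) ->
  measurable B -> (mu B < +oo)%E ->
  \int[mu]_(x in B) D (f_ n) x @[n --> \oo] --> \int[mu]_(x in B) D f x.
Proof.
move=> [_ _ _ wD] lf cf mB muB.
pose g : X -> R := (fun=> 1 : R) \_ B.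
have hg : L1 mu g by apply: Linf_L1 => //; exact: Linf_cst.
have E h : \int[mu]_x (g x * D h x) = \int[mu]_(x in B) D h x.
  rewrite [RHS]Rintegral_mkcond; congr fine; apply: eq_integral => x _.
  by rewrite /g !patchE; case: ifP => _; rewrite ?mul1r ?mul0r.
have := wD nat \oo eventually_filter f_ f C lf cf _ hg.
by rewrite E; under eq_fun do rewrite E.
Qed.

Lemma lip_bounded_by_cvg (I : Type) (F : set_system I) (f_ : I -> X -> R) f
    (C : R) : ProperFilter F -> (forall i, lip_bounded_by dist C (f_ i)) ->
  (forall x, f_ i x @[i --> F] --> f x) -> lip_bounded_by dist C f.
Proof.
move=> FF lf cf; split=> [x|x y].
  have cn : `|f_ n x| @[n --> F] --> `|f x| by apply: cvg_norm; exact: cf.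
  rewrite -(cvg_lim _ cn)//; apply: limr_le; first by apply/cvg_ex; exists `|f x|.
  by apply: nearW => n; have [] := lf n.
have cn : `|f_ n x - f_ n y| @[n --> F] --> `|f x - f y|.
  by apply: cvg_norm; apply: cvgB; exact: cf.
rewrite -(cvg_lim _ cn)//; apply: limr_le.
  by apply/cvg_ex; exists `|f x - f y|.
by apply: nearW => n; have [] := lf n.
Qed.

(** The bounds [e_ n] may vary with [n]: integrated over a set of finite measure inside [A], the
    left side converges by weak-* continuity and the right side by dominated convergence. Testing on
    all such sets gives the limit inequality. *)
Lemma derivation_limit_le D (f_ e_ : nat -> X -> R) f e (C K : R) A :
  derivation dist mu D -> (forall n, lip_bounded_by dist C (f_ n)) ->
  (forall x, f_ n x @[n --> \oo] --> f x) ->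
  measurable A ->
  (forall n, measurable_fun setT (e_ n)) -> Linf mu e ->
  (forall n, {ae mu, forall x, `|e_ n x| <= K}) ->
  {ae mu, forall x, A x -> e_ n x @[n --> \oo] --> e x} ->
  (forall n, {ae mu, forall x, A x -> D (f_ n) x <= e_ n x}) ->
  {ae mu, forall x, A x -> D f x <= e x}.
Proof.
move=> hD lf cf mA me_ he eK cvg_e le_e.
have [DL _ _ _] := hD.
have lf_n n : lipb dist (f_ n) by exists C.
have lf0 : lipb dist f by exists C; exact: lip_bounded_by_cvg lf cf.
apply: ae_le_of_Rintegral => //; first exact: DL.
move=> B mB muB BA.
have cD := derivation_Rintegral_cvg hD lf cf mB muB.
have ce : \int[mu]_(x in B) e_ n x @[n --> \oo] --> \int[mu]_(x in B) e x.
  apply: Linf_dominated_cvg eK _ => //; first by case: he.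
  by apply: filterS cvg_e => x + /BA; apply.
rewrite -(cvg_lim _ cD)// -(cvg_lim _ ce)//; apply: ler_lim.
- by apply/cvg_ex; eexists; exact: cD.
- by apply/cvg_ex; eexists; exact: ce.
- apply: nearW => n; apply: ae_le_Rintegral => //.
  + by apply: Linf_integrable => //; exact: DL.
  + by apply: Linf_integrable => //; split=> //; exists K.
  + by apply: filterS (le_e n) => x + /BA; apply.
Qed.

Lemma derivationN D : derivation dist mu D ->
  derivation dist mu (fun f x => - D f x).
Proof.
move=> [DL Dlin DM Dw]; split.
- by move=> f /DL; exact: LinfN.
- move=> a b f g hf hg; apply: filterS (Dlin a b f g hf hg) => x ->; ring.
- move=> f g hf hg; apply: filterS (DM f g hf hg) => x ->; ring.
- move=> I F FF fa f C lfa cfa g hg.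
  have hN : L1 mu (fun x => - g x).
    by rewrite /L1; apply: integrableN hg.
  have := Dw I F FF fa f C lfa cfa _ hN.
  have E h : \int[mu]_x (- g x * D h x) = \int[mu]_x (g x * - D h x).
    by congr fine; apply: eq_integral => x _; rewrite mulNr mulrN.
  by rewrite E; under eq_fun do rewrite E.
Qed.

Lemma derivation_limit_eq D (f_ e_ : nat -> X -> R) f e (C K : R) A :
  derivation dist mu D -> (forall n, lip_bounded_by dist C (f_ n)) ->
  (forall x, f_ n x @[n --> \oo] --> f x) ->
  measurable A ->
  (forall n, measurable_fun setT (e_ n)) -> Linf mu e ->
  (forall n, {ae mu, forall x, `|e_ n x| <= K}) ->
  {ae mu, forall x, A x -> e_ n x @[n --> \oo] --> e x} ->
  (forall n, {ae mu, forall x, A x -> D (f_ n) x = e_ n x}) ->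
  {ae mu, forall x, A x -> D f x = e x}.
Proof.
move=> hD lf cf mA me_ he eK cvg_e eq_e.
have le1 : {ae mu, forall x, A x -> D f x <= e x}.
  apply: (derivation_limit_le hD lf cf mA me_ he eK cvg_e) => n.
  by apply: filterS (eq_e n) => x /[apply] ->.
have le2 : {ae mu, forall x, A x -> - D f x <= - e x}.
  apply: (@derivation_limit_le _ f_ (fun n x => - e_ n x) f _ C K _
    (derivationN hD)) => //.
  - by move=> n; exact: measurable_funN.
  - exact: LinfN.
  - by move=> n; apply: filterS (eK n) => x; rewrite normrN.
  - by apply: filterS cvg_e => x /[apply]; exact: cvgN.
  - by move=> n; apply: filterS (eq_e n) => x /[apply] ->.
apply: filterS2 le1 le2 => x h1 h2 Ax.
by apply/eqP; rewrite eq_le h1// -lerN2 h2.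
Qed.

Lemma derivation_limit_stationary D (f_ : nat -> X -> R) f e (C : R) A :
  derivation dist mu D -> (forall n, lip_bounded_by dist C (f_ n)) ->
  (forall x, f_ n x @[n --> \oo] --> f x) -> measurable A -> Linf mu e ->
  (forall n, {ae mu, forall x, A x -> D (f_ n) x = e x}) ->
  {ae mu, forall x, A x -> D f x = e x}.
Proof.
move=> hD lf cf mA [me [K eK]] eq_e.
apply: (@derivation_limit_eq D f_ (fun=> e) f e C K) => //.
- by split=> //; exists K.
- by apply: aeW => x _; exact: cvg_cst.
Qed.

Lemma derivation_cst D (c : R) : derivation dist mu D ->
  {ae mu, forall x, D (fun=> c) x = 0}.
Proof.
move=> [_ Dlin DM _]; have l1 := lipb_cst dist_ge0 1.
(* The Leibniz rule for 1 = 1 * 1 reads D 1 = 2 D 1, and linearity gives D c = c D 1. *)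
apply: filterS2 (DM _ _ l1 l1) (Dlin c 0 _ _ l1 l1) => x.
have -> : (fun _ : X => 1 * 1 : R) = (fun=> 1) by apply/funext => y; rewrite mulr1.
have -> : (fun _ : X => c * 1 + 0 * 1 : R) = (fun=> c).
  by apply/funext => y; rewrite mulr1 mul0r addr0.
move=> h ->; have -> : D (fun=> 1) x = 0 by lra.
ring.
Qed.

Lemma derivation_sub D f g : derivation dist mu D ->
  lipb dist f -> lipb dist g ->
  {ae mu, forall x, D (fun y => f y - g y) x = D f x - D g x}.
Proof.
move=> [_ Dlin _ _] lf lg.
have := Dlin 1 (-1) _ _ lf lg; apply: filterS => x.
have -> : (fun y => 1 * f y + -1 * g y) = (fun y => f y - g y).
  by apply/funext => y; rewrite mul1r mulN1r.
by move=> ->; ring.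
Qed.

(* With h_e the truncation of h at level e, the functions max(0, e - |h|) and
   h - h_e have product 0; the Leibniz rule on {h = 0} then gives e D(h - h_e) = 0,
   and h_e tends to 0 as e does. *)
Lemma derivation_zero_set D h A : derivation dist mu D -> lipb dist h ->
  measurable A -> (forall x, A x -> h x = 0) ->
  {ae mu, forall x, A x -> D h x = 0}.
Proof.
move=> hD [C lh] mA hA.
have [DL Dlin DM Dw] := hD.
have lbh : lipb dist h by exists C.
pose e_ (n : nat) : R := n.+1%:R^-1.
have e0 n : 0 < e_ n by rewrite invr_gt0.
pose u n x := clamp (e_ n) (h x).
have lu n : lip_bounded_by dist C (u n) by apply: lip_bounded_by_clamp; rewrite // ltW.
have lbu n : lipb dist (u n) by exists C.
have Du n : {ae mu, forall x, A x -> D (u n) x = D h x}.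
  pose v x := h x - u n x.
  pose p x := e_ n - clamp (e_ n) `|h x|.
  have lv : lipb dist v by exact: lipb_sub.
  have lp : lipb dist p.
    apply: lipb_sub; first exact: lipb_cst.
    apply: (@lipb_clamp _ _ _ _ dist_ge0 C); first exact: ltW.
    by move=> x y; have [_ /(_ x y)] := lh; apply: le_trans; exact: ler_dist_dist.
  have pv x : p x * v x = 0.
    have [hx|hx] := leP `|h x| (e_ n).
      by rewrite /v /u (clamp_id hx) subrr mulr0.
    rewrite /p /clamp (min_r (ltW hx)) max_r ?subrr ?mul0r//.
    by rewrite (le_trans _ (ltW (e0 n)))// oppr_le0 ltW.
  have Dpv : {ae mu, forall x, D (fun y => p y * v y) x = 0}.
    rewrite (_ : (fun y => p y * v y) = fun=> 0); last exact/funext.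
    exact: derivation_cst.
  have Dv := derivation_sub hD lbh (lbu n).
  apply: filterS3 (DM _ _ lp lv) Dpv Dv => x -> + Dvx Ax.
  have hx := hA _ Ax.
  have -> : p x = e_ n by rewrite /p hx normr0 clamp0 ?subr0// ltW.
  have -> : v x = 0 by rewrite /v /u hx clamp0 ?subr0// ltW.
  rewrite mul0r addr0 => /eqP; rewrite mulf_eq0 (gt_eqF (e0 n))/= => /eqP.
  by rewrite Dvx => /eqP; rewrite subr_eq0 => /eqP ->.
have cu x : u n x @[n --> \oo] --> (0 : R).
  apply/cvgr0Pnorm_le => e eps0.
  have ce : e_ n @[n --> \oo] --> (0 : R) by exact: cvg_harmonic.
  move/cvgr0Pnorm_le : ce => /(_ e eps0); apply: filterS => n; apply: le_trans.
  by rewrite (le_trans (clamp_norm _ _)) ?ler_norm// ltW.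
have D0 := derivation_limit_stationary hD lu cu mA (DL _ lbh) Du.
by apply: filterS2 D0 (derivation_cst 0 hD) => x + Dx Ax => /(_ Ax) <-.
Qed.

Lemma derivation_local D f g A : derivation dist mu D ->
  lipb dist f -> lipb dist g -> measurable A -> (forall x, A x -> f x = g x) ->
  {ae mu, forall x, A x -> D f x = D g x}.
Proof.
move=> hD lf lg mA fg.
have h : {ae mu, forall x, A x -> D (fun y => f y - g y) x = 0}.
  apply: derivation_zero_set => //; first exact: lipb_sub.
  by move=> x Ax; rewrite fg// subrr.
apply: filterS2 h (derivation_sub hD lf lg) => x + Dx Ax.
by rewrite Dx => /(_ Ax) /eqP; rewrite subr_eq0 => /eqP.
Qed.

(** For weak-* continuity the coefficient is moved to the test function: pairing [g] with [a D1 f]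
    is pairing [g a], still in L^1, with [D1 f]. *)
Lemma derivation_comb D1 D2 a b :
  derivation dist mu D1 -> derivation dist mu D2 -> Linf mu a -> Linf mu b ->
  derivation dist mu (fun f x => a x * D1 f x + b x * D2 f x).
Proof.
move=> [L1_ lin1 M1 w1] [L2_ lin2 M2 w2] ha hb; split.
- by move=> f hf; apply: LinfD; apply: LinfM => //; [exact: L1_|exact: L2_].
- move=> s t f g hf hg; apply: filterS2 (lin1 s t f g hf hg) (lin2 s t f g hf hg).
  by move=> x -> ->; ring.
- move=> f g hf hg; apply: filterS2 (M1 f g hf hg) (M2 f g hf hg).
  by move=> x -> ->; ring.
move=> I F FF fa f C lfa cfa g hg.
have L1M u w : Linf mu u -> L1 mu w -> L1 mu (fun x => w x * u x).
  move=> [mu_ [K hu]] hw; have := hw => /integrableP[mw intw].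
  apply/integrableP; split.
    apply/measurable_EFinP; apply: measurable_funM => //.
    exact/measurable_EFinP.
  apply: (@le_lt_trans _ _ (\int[mu]_x (`|K|%:E * `|(EFin \o w) x|))%E).
    apply: ae_ge0_le_integral => //.
    - apply/measurableT_comp => //; apply/measurable_EFinP.
      apply: measurable_funM => //; exact/measurable_EFinP.
    - apply: measurable_funeM; exact: measurableT_comp.
    - apply: filterS hu => x hux _ /=; rewrite lee_fin normrM mulrC.
      by apply: ler_wpM2r => //; rewrite (le_trans hux)// ler_norm.
  rewrite ge0_integralZl//; first exact: lte_mul_pinfty.
  exact: measurableT_comp.
have E h : lipb dist h -> \int[mu]_x (g x * (a x * D1 h x + b x * D2 h x)) =
    \int[mu]_x ((g x * a x) * D1 h x) + \int[mu]_x ((g x * b x) * D2 h x).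
  move=> lh; rewrite -RintegralD//.
  - by congr fine; apply: eq_integral => x _; rewrite mulrDr !mulrA.
  - exact/L1M/L1M/hg/ha/L1_.
  - exact/L1M/L1M/hg/hb/L2_.
have lfa' i : lipb dist (fa i) by exists C.
have lf : lipb dist f.
  by exists C; exact: lip_bounded_by_cvg lfa cfa.
rewrite E//; under eq_fun do rewrite E//.
apply: cvgD.
- exact: w1 lfa cfa _ (L1M _ _ ha hg).
- exact: w2 lfa cfa _ (L1M _ _ hb hg).
Qed.

End Locality.

(** * Piecewise affine interpolation on the grid of mesh 1/(n+1) *)

Section Interpolation.
Context {R : realType}.
Implicit Types (phi : R -> R) (s t : R) (n : nat).

Definition grid_lo n t : R := (Num.floor (t * n.+1%:R))%:~R / n.+1%:R.
Definition grid_hi n t : R := (Num.floor (t * n.+1%:R) + 1)%:~R / n.+1%:R.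
Definition grid_slope n phi t := (phi (grid_hi n t) - phi (grid_lo n t)) * n.+1%:R.
Definition interp n phi t := phi (grid_lo n t) + (t - grid_lo n t) * grid_slope n phi t.

Lemma grid_lo_le n t : grid_lo n t <= t.
Proof. by rewrite /grid_lo ler_pdivrMr// floor_le. Qed.

Lemma grid_hi_gt n t : t < grid_hi n t.
Proof. by rewrite /grid_hi ltr_pdivlMr// floorD1_gt. Qed.

Lemma grid_hiE n t : grid_hi n t = grid_lo n t + n.+1%:R^-1.
Proof. by rewrite /grid_hi intrD mulrDl mul1r. Qed.

Lemma grid_sub n t : (grid_hi n t - grid_lo n t) * n.+1%:R = 1.
Proof. by rewrite grid_hiE addrAC subrr add0r mulVf. Qed.

Lemma grid_eq_or_sep n s t : s <= t ->
  grid_lo n s = grid_lo n t \/ grid_hi n s <= grid_lo n t.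
Proof.
move=> st; have : Num.floor (s * n.+1%:R) <= Num.floor (t * n.+1%:R).
  by rewrite le_floor// ler_wpM2r.
rewrite le_eqVlt => /orP[/eqP e|e]; [left|right].
  by rewrite /grid_lo e.
by rewrite ler_pM2r ?invr_gt0// ler_int lezD1.
Qed.

Lemma grid_slope_norm n phi (C : R) t :
  (forall a b, `|phi a - phi b| <= C * `|a - b|) -> `|grid_slope n phi t| <= C.
Proof.
move=> lphi; rewrite normrM (ger0_norm (ler0n _ n.+1)).
have /(ler_wpM2r (ler0n R n.+1)) := lphi (grid_hi n t) (grid_lo n t).
move/le_trans; apply; rewrite -mulrA [X in _ * (X * _)]ger0_norm; last first.
  by rewrite subr_ge0 (le_trans (grid_lo_le n t))// ltW// grid_hi_gt.
by rewrite grid_sub mulr1.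
Qed.

Lemma interp_lo n phi (C : R) t : (forall a b, `|phi a - phi b| <= C * `|a - b|) ->
  `|interp n phi t - phi (grid_lo n t)| <= C * (t - grid_lo n t).
Proof.
move=> lphi; rewrite /interp addrAC subrr add0r normrM mulrC.
rewrite (ger0_norm (_ : 0 <= t - _)) ?subr_ge0 ?grid_lo_le//.
by rewrite ler_wpM2r ?subr_ge0 ?grid_lo_le// grid_slope_norm.
Qed.

Lemma interp_hi n phi (C : R) t : (forall a b, `|phi a - phi b| <= C * `|a - b|) ->
  `|interp n phi t - phi (grid_hi n t)| <= C * (grid_hi n t - t).
Proof.
move=> lphi.
have -> : interp n phi t - phi (grid_hi n t) =
    (t - grid_hi n t) * grid_slope n phi t.
  have h : phi (grid_hi n t) - phi (grid_lo n t) =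
      (grid_hi n t - grid_lo n t) * grid_slope n phi t.
    by rewrite /grid_slope mulrCA grid_sub mulr1.
  rewrite /interp -[phi (grid_hi n t)](subrK (phi (grid_lo n t))) h; ring.
rewrite normrM mulrC distrC (ger0_norm (_ : 0 <= grid_hi n t - t)).
  by rewrite ler_wpM2r ?subr_ge0 ?(ltW (grid_hi_gt n t))// grid_slope_norm.
by rewrite subr_ge0 ltW// grid_hi_gt.
Qed.

(** The constant is not enlarged. Inside a cell the slope is at most [C]. Otherwise the path from
    [s] to [t] is cut at [grid_hi n s] and [grid_lo n t], where the interpolant agrees with [phi],
    and the three lengths add up to [t - s]. *)
Lemma interp_lip_le n phi (C : R) s t :
  (forall a b, `|phi a - phi b| <= C * `|a - b|) -> s <= t ->
  `|interp n phi t - interp n phi s| <= C * (t - s).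
Proof.
move=> lphi st; have [e|sep] := grid_eq_or_sep n st.
  have hi : grid_hi n s = grid_hi n t by rewrite !grid_hiE e.
  have -> : interp n phi t - interp n phi s = (t - s) * grid_slope n phi t.
    by rewrite /interp /grid_slope e hi; ring.
  rewrite normrM mulrC (ger0_norm (_ : 0 <= t - s)) ?subr_ge0//.
  by rewrite ler_wpM2r ?subr_ge0// grid_slope_norm.
have h1 := interp_lo n t lphi; have h2 := interp_hi n s lphi.
have h3 := lphi (grid_lo n t) (grid_hi n s).
have h3' : `|grid_lo n t - grid_hi n s| = grid_lo n t - grid_hi n s.
  by rewrite ger0_norm// subr_ge0.
rewrite h3' in h3.
have -> : interp n phi t - interp n phi s = (interp n phi t - phi (grid_lo n t)) +
  (phi (grid_lo n t) - phi (grid_hi n s)) - (interp n phi s - phi (grid_hi n s)).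
  ring.
rewrite (le_trans (ler_normB _ _))//.
have := ler_normD (interp n phi t - phi (grid_lo n t))
  (phi (grid_lo n t) - phi (grid_hi n s)).
move: h1 h2 h3; rewrite !mulrBr; lra.
Qed.

Lemma interp_lip n phi (C : R) :
  (forall a b, `|phi a - phi b| <= C * `|a - b|) ->
  forall s t, `|interp n phi s - interp n phi t| <= C * `|s - t|.
Proof.
move=> lphi s t; have [st|/ltW st] := leP s t.
  rewrite (distrC (interp n phi s)) (distrC s) (ger0_norm (_ : 0 <= t - s)) ?subr_ge0//.
  exact: interp_lip_le.
by rewrite (ger0_norm (_ : 0 <= s - t)) ?subr_ge0//; exact: interp_lip_le.
Qed.

(** The weight [w] is chosen before [psi]: interpolants of two functions at the same [t] use the
    same weights, so their difference is controlled by the differences of the functions at the grid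
    points. *)
Lemma interp_conv n t : exists2 w : R, 0 <= w <= 1 &
  forall psi, interp n psi t = (1 - w) * psi (grid_lo n t) + w * psi (grid_hi n t).
Proof.
exists ((t - grid_lo n t) * n.+1%:R); last first.
  by move=> psi; rewrite /interp /grid_slope; ring.
rewrite mulr_ge0 ?subr_ge0 ?grid_lo_le//= -[leRHS](grid_sub n t) ler_wpM2r//.
by rewrite lerB// ltW// grid_hi_gt.
Qed.

Lemma interp_dist n phi (C : R) t : (forall a b, `|phi a - phi b| <= C * `|a - b|) ->
  `|interp n phi t - phi t| <= (C + C) * n.+1%:R^-1.
Proof.
move=> lphi; have C0 : 0 <= C.
  have := lphi 1 0; rewrite subr0 normr1 mulr1; exact: le_trans.
have lt : t - grid_lo n t <= n.+1%:R^-1.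
  by rewrite lerBlDl -grid_hiE ltW// grid_hi_gt.
have h1 := interp_lo n t lphi; have := lphi t (grid_lo n t).
rewrite (ger0_norm (_ : 0 <= t - grid_lo n t)) ?subr_ge0 ?grid_lo_le// => h2.
have := ler_wpM2l C0 lt; move: (n.+1%:R^-1) => N; rewrite mulrDl.
have -> : interp n phi t - phi t = (interp n phi t - phi (grid_lo n t)) -
  (phi t - phi (grid_lo n t)) by ring.
have := ler_normB (interp n phi t - phi (grid_lo n t)) (phi t - phi (grid_lo n t)).
lra.
Qed.

(** The point [t] lies between the two grid points, so the errors of the linear approximation at
    both, each at most [e] times the distance to [t], add up to at most [e] times the mesh. *)
Lemma grid_slope_cvg phi t : derivable phi t 1 ->
  grid_slope n phi t @[n --> \oo] --> derive1 phi t.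
Proof.
move=> dphi; apply/cvgrPdist_le => e e0.
have cphi : h^-1 *: (phi (h + t) - phi t) @[h --> 0^'] --> derive1 phi t.
  move: dphi; rewrite /derivable /derive1.
  by under eq_fun do rewrite /= /GRing.scale /= mulr1.
move/cvgrPdist_le : cphi => /(_ e e0)[/= r r0 cphi].
have near_t u : `|u - t| < r ->
    `|phi u - phi t - derive1 phi t * (u - t)| <= e * `|u - t|.
  have [->|ut] := eqVneq u t; first by rewrite !subrr mulr0 subr0 normr0 mulr0.
  move=> utr; have ut0 : u - t != 0 by rewrite subr_eq0.
  have := cphi (u - t); rewrite /= sub0r normrN => /(_ utr ut0).
  rewrite subrK /GRing.scale/= => h.
  have -> : phi u - phi t - derive1 phi t * (u - t) =
    - (derive1 phi t - (u - t)^-1 * (phi u - phi t)) * (u - t).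
    by field.
  by rewrite normrM normrN ler_wpM2r.
have /cvgr0Pnorm_lt/(_ r r0) : harmonic n @[n --> \oo] --> (0 : R) by exact: cvg_harmonic.
apply: filterS => n; rewrite /harmonic/= ger0_norm// => nr.
have lo := grid_lo_le n t; have hi := ltW (grid_hi_gt n t).
have hE := grid_hiE n t; move: nr hE; set N := (n.+1%:R^-1) => nr hE.
have l1 : `|grid_lo n t - t| = t - grid_lo n t.
  by rewrite distrC ger0_norm// subr_ge0.
have l2 : `|grid_hi n t - t| = grid_hi n t - t by rewrite ger0_norm// subr_ge0.
have h1 : `|grid_lo n t - t| < r.
  by rewrite l1; have := grid_hi_gt n t; lra.
have h2 : `|grid_hi n t - t| < r by rewrite l2; lra.
have := near_t _ h1; have := near_t _ h2; rewrite l1 l2 => {}h2 {}h1.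
have -> : derive1 phi t - grid_slope n phi t =
  ((phi (grid_lo n t) - phi t - derive1 phi t * (grid_lo n t - t)) -
   (phi (grid_hi n t) - phi t - derive1 phi t * (grid_hi n t - t))) * n.+1%:R.
  rewrite -[derive1 phi t in LHS]mulr1 -[X in _ * X - _ = _](grid_sub n t).
  by rewrite /grid_slope; ring.
rewrite normrM (ger0_norm (ler0n _ n.+1)) -[leRHS]mulr1 -[X in _ <= _ * X](grid_sub n t) mulrA.
rewrite ler_wpM2r// (le_trans (ler_normB _ _))// mulrBr.
move: h1 h2; rewrite !mulrBr; lra.
Qed.

Lemma bounded_derive_lip (f df : R -> R) (C : R) :
  (forall x : R, is_derive x 1 f (df x)) -> (forall x, `|df x| <= C) ->
  forall a b, `|f a - f b| <= C * `|a - b|.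
Proof.
move=> fdf dfC.
have cf : continuous f.
  move=> x; apply: differentiable_continuous; apply/derivable1_diffP.
  by have := fdf x; case.
have hle a b : a <= b -> `|f b - f a| <= C * (b - a).
  move=> ab; have [c _ ->] : exists2 c, c \in `[a, b] & f b - f a = df c * (b - a).
    by apply: MVT_segment => //; exact: continuous_subspaceT.
  by rewrite normrM (ger0_norm (_ : 0 <= b - a)) ?subr_ge0// ler_wpM2r// subr_ge0.
move=> a b; have [ab|/ltW ab] := leP a b.
  by rewrite distrC (distrC a) (ger0_norm (_ : 0 <= b - a)) ?subr_ge0// hle.
by rewrite (ger0_norm (_ : 0 <= a - b)) ?subr_ge0// hle.
Qed.

Lemma sin_lip (a b : R) : `|sin a - sin b| <= 1 * `|a - b|.
Proof.
exact: (@bounded_derive_lip sin cos 1 (fun x => is_derive_sin x) (@cos_max R)).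
Qed.

Lemma cos_lip (a b : R) : `|cos a - cos b| <= 1 * `|a - b|.
Proof.
apply: (@bounded_derive_lip cos (fun x => - sin x) 1 (fun x => is_derive_cos x)).
by move=> x; rewrite normrN sin_max.
Qed.

End Interpolation.

(** * The rate of a derivation along a coordinate and the chain rule *)

Section Coordinates.
Context {R : realType} {d : measure_display} {X : measurableType d}.
Variables (dist : X -> X -> R) (mu : {measure set X -> \bar R}).
Hypothesis dist_ge0 : forall x y, 0 <= dist x y.
Hypothesis lip_measurable : forall (f : X -> R) (C : R),
  (forall x y, `|f x - f y| <= C * dist x y) -> measurable_fun setT f.
Hypothesis mu_sfinite : sigma_finite setT mu.
Implicit Types (A B : set X) (f g h : X -> R).

(* [mv p c] is the point obtained from [p] by replacing its [pi]-coordinate by [c]. *)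
Record coordinate (pi : X -> R) (mv : X -> R -> X) : Prop := {
  coord_lip : forall p q, `|pi p - pi q| <= 1 * dist p q;
  coord_id : forall p, mv p (pi p) = p;
  coord_mv : forall p c, pi (mv p c) = c;
  coord_mvmv : forall p c c', mv (mv p c) c' = mv p c';
  coord_lipl : forall p q c, dist (mv p c) (mv q c) <= dist p q;
  coord_lipr : forall p a b, dist (mv p a) (mv p b) <= `|a - b| }.

(** The function [fun p => f (mv p c)] is [f] frozen at [pi = c]; it depends on the transverse
    variables only. The condition says that, as far as [f] is concerned, [D] differentiates along
    [pi] alone. *)
Definition kills_transverse (D : (X -> R) -> X -> R) (mv : X -> R -> X) f :=
  forall c, {ae mu, forall x, D (fun p => f (mv p c)) x = 0}.

(** This plays the part of [D pi]: by D(sin pi) = cos pi D pi, D(cos pi) = - sin pi D pi and cos^2 +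
    sin^2 = 1. Being one global formula, it is in L^oo at once, with no gluing of truncated
    coordinates. *)
Definition rate (D : (X -> R) -> X -> R) (pi : X -> R) (p : X) : R :=
  cos (pi p) * D (sin \o pi) p - sin (pi p) * D (cos \o pi) p.

Lemma ae_forall_countable (I : countType) (P : I -> X -> Prop) :
  (forall i, {ae mu, forall x, P i x}) -> {ae mu, forall x, forall i, P i x}.
Proof.
move=> aeP; pose Q n x := forall i, unpickle n = Some i -> P i x.
have /ae_foralln : forall n, {ae mu, forall x, Q n x}.
  move=> n; rewrite /Q; case: (unpickle n) => [i|]; last by apply: aeW.
  by apply: filterS (aeP i) => x Px _ [<-].
by apply: filterS => x Qx i; apply: (Qx (pickle i)); rewrite pickleK.
Qed.

Lemma measurable_fun_glue (k : X -> int) (F : int -> X -> R) :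
  (forall i, measurable [set x | k x = i]) ->
  (forall i, measurable_fun setT (F i)) -> measurable_fun setT (fun x => F (k x) x).
Proof.
move=> mk mF _ Y mY; rewrite setTI.
rewrite (_ : _ @^-1` Y = \bigcup_i ([set x | k x = i] `&` (F i @^-1` Y))).
  apply: countable_bigcupT_measurable => // i; apply: measurableI => //.
  by rewrite -[X in measurable X]setTI; exact: mF.
by apply/seteqP; split=> [x Yx|x [i _ [/= ->]]//]; exists (k x).
Qed.

Section OneCoordinate.
Variables (pi : X -> R) (mv : X -> R -> X).
Hypothesis hpi : coordinate pi mv.

Lemma coord_measurable : measurable_fun setT pi.
Proof. exact: lip_measurable (coord_lip hpi). Qed.

Definition interp_along n f p := interp n (fun c => f (mv p c)) (pi p).
Definition slope_along n f p := grid_slope n (fun c => f (mv p c)) (pi p).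

Lemma lip_mv (C : R) f p : lip_bounded_by dist C f ->
  forall a b, `|f (mv p a) - f (mv p b)| <= C * `|a - b|.
Proof.
move=> lf a b; have [_ /(_ (mv p a) (mv p b)) h] := lf.
by rewrite (le_trans h)// ler_wpM2l ?(lip_bounded_by_ge0 p lf)// (coord_lipr hpi).
Qed.

Lemma lip_bounded_by_mv (C : R) f c : lip_bounded_by dist C f ->
  lip_bounded_by dist C (fun p => f (mv p c)).
Proof.
move=> lf; have [bf lf2] := lf; split=> [x//|x y].
by rewrite (le_trans (lf2 _ _))// ler_wpM2l ?(lip_bounded_by_ge0 x lf)// (coord_lipl hpi).
Qed.

(** One [C] pays for the displacement along [pi] and one for the transverse displacement, where the
    common weights of [interp_conv] are used. What matters is that the bound does not depend on
    [n]. *)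
Lemma lip_bounded_by_interp n (C : R) f : lip_bounded_by dist C f ->
  lip_bounded_by dist (C + C) (interp_along n f).
Proof.
move=> lf; have [bf lf2] := lf; split=> [p|p q].
  have C0 := lip_bounded_by_ge0 p lf.
  have [w /andP[w0 w1] E] := interp_conv n (pi p).
  rewrite /interp_along E (le_trans (ler_normD _ _))// !normrM.
  rewrite (ger0_norm w0) (ger0_norm (_ : 0 <= 1 - w)) ?subr_ge0//.
  by apply: lerD; rewrite -[leRHS]mul1r ler_pM// ?subr_ge0// lerBlDr lerDl.
have C0 := lip_bounded_by_ge0 p lf.
have -> : interp_along n f p - interp_along n f q =
  (interp_along n f p - interp n (fun c => f (mv p c)) (pi q)) +
  (interp n (fun c => f (mv p c)) (pi q) - interp_along n f q) by ring.
rewrite (le_trans (ler_normD _ _))// mulrDl; apply: lerD.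
  rewrite (le_trans (interp_lip n (lip_mv p lf) _ _))// ler_wpM2l//.
  by rewrite -[leRHS]mul1r; exact: (coord_lip hpi).
have [w /andP[w0 w1] E] := interp_conv n (pi q).
have h c : `|f (mv p c) - f (mv q c)| <= C * dist p q.
  by rewrite (le_trans (lf2 _ _))// ler_wpM2l// (coord_lipl hpi).
rewrite /interp_along !E.
set a := grid_lo _ _; set b := grid_hi _ _.
have -> : (1 - w) * f (mv p a) + w * f (mv p b) -
    ((1 - w) * f (mv q a) + w * f (mv q b)) =
  (1 - w) * (f (mv p a) - f (mv q a)) + w * (f (mv p b) - f (mv q b)) by ring.
rewrite (le_trans (ler_normD _ _))// !normrM.
rewrite (ger0_norm w0) (ger0_norm (_ : 0 <= 1 - w)) ?subr_ge0//.
have h1 : 0 <= 1 - w by rewrite subr_ge0.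
apply: (@le_trans _ _ ((1 - w) * (C * dist p q) + w * (C * dist p q))).
  by apply: lerD; apply: ler_wpM2l.
by rewrite -mulrDl subrK mul1r.
Qed.

Lemma interp_along_cvg (C : R) f p : lip_bounded_by dist C f ->
  interp_along n f p @[n --> \oo] --> f p.
Proof.
move=> lf; apply/cvgrPdist_le => e e0.
have C0 := lip_bounded_by_ge0 p lf.
have ce : (C + C) * harmonic n @[n --> \oo] --> (C + C) * (0 : R).
  by apply: cvgMr; exact: cvg_harmonic.
rewrite mulr0 in ce.
move/cvgr0Pnorm_le : ce => /(_ e e0); apply: filterS => n; apply: le_trans.
have := interp_dist n (pi p) (lip_mv p lf).
rewrite (coord_id hpi) distrC => /le_trans; apply; exact: ler_norm.
Qed.

Lemma slope_along_norm n (C : R) f p : lip_bounded_by dist C f ->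
  `|slope_along n f p| <= C.
Proof. by move=> lf; apply: grid_slope_norm; exact: lip_mv. Qed.

Definition cell_index n p : int := Num.floor (pi p * n.+1%:R).

Lemma measurable_cell n (k : int) : measurable [set p | cell_index n p = k].
Proof.
rewrite (_ : [set p | _] =
    pi @^-1` [set` `[k%:~R / n.+1%:R, (k + 1)%:~R / n.+1%:R[ ]).
  by rewrite -[X in measurable X]setTI; apply: coord_measurable.
apply/seteqP; split=> p /=; rewrite in_itv/= ler_pdivrMr// ltr_pdivlMr//.
  by move=> <-; rewrite floor_le/= floorD1_gt.
by move=> h; exact: floor_def.
Qed.

Lemma measurable_slope_along n f : lipb dist f ->
  measurable_fun setT (slope_along n f).
Proof.
move=> [C lf].
pose F (k : int) p : R := (f (mv p ((k + 1)%:~R / n.+1%:R)) -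
  f (mv p (k%:~R / n.+1%:R))) * n.+1%:R.
apply: (@measurable_fun_glue (cell_index n) F); first exact: measurable_cell.
move=> k; apply: measurable_funM => //; apply: measurable_funB.
- by have [_] := lip_bounded_by_mv ((k + 1)%:~R / n.+1%:R) lf; exact: lip_measurable.
- by have [_] := lip_bounded_by_mv (k%:~R / n.+1%:R) lf; exact: lip_measurable.
Qed.

Section OneDerivation.
Variable D : (X -> R) -> X -> R.
Hypothesis hD : derivation dist mu D.

Lemma lipb_clamp_coord (M : R) : 0 <= M -> lipb dist (fun p => clamp M (pi p)).
Proof. by move=> M0; apply: (@lipb_clamp _ _ _ _ dist_ge0 1) => //; case: hpi. Qed.

Lemma measurable_slab (M : R) : measurable [set p | `|pi p| <= M].
Proof.
rewrite (_ : [set p | _] = pi @^-1` [set` `[- M, M] ]).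
  by rewrite -[X in measurable X]setTI; apply: coord_measurable.
by apply/seteqP; split=> p /=; rewrite in_itv/= ler_norml.
Qed.

(** On one cell, with left end a, the interpolant is f(a) + (pi - a) S, where f(a) and the slope S
    are transverse and hence killed. Leibniz leaves S D(pi), and locality transfers this to the
    interpolant; on the slab [pi] may be replaced by its truncation. *)
Lemma derivation_interp_slab n f (M : R) : 0 <= M -> lipb dist f ->
  kills_transverse D mv f ->
  {ae mu, forall p, `|pi p| <= M ->
    D (interp_along n f) p = slope_along n f p * D (fun q => clamp M (pi q)) p}.
Proof.
move=> M0 [C lf] killf; have [_ Dlin DM _] := hD.
pose A (k : int) := [set p | `|pi p| <= M] `&` [set p | cell_index n p = k].
have mA k : measurable (A k).
  by apply: measurableI; [exact: measurable_slab|exact: measurable_cell].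
suff : forall k, {ae mu, forall p, A k p -> D (interp_along n f) p =
    slope_along n f p * D (fun q => clamp M (pi q)) p}.
  move=> /ae_forall_countable; apply: filterS => p h pM.
  by apply: (h (cell_index n p)).
move=> k.
pose a : R := k%:~R / n.+1%:R; pose b : R := (k + 1)%:~R / n.+1%:R.
have lmv c : lipb dist (fun p => f (mv p c)) by exists C; exact: lip_bounded_by_mv.
(* [S] is the slope, [U] is pi - a and [G] the affine function of the cell. The factors 1 and the
   constant function 1 are spelled out to match the linearity clause of [derivation]. *)
pose T q := clamp M (pi q).
pose S p := n.+1%:R * f (mv p b) + (- n.+1%:R) * f (mv p a).
pose U p := 1 * T p + (- a) * (fun=> 1 : R) p.
pose G p := 1 * f (mv p a) + 1 * (U p * S p).
have lT : lipb dist T by exact: lipb_clamp_coord.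
have lS : lipb dist S by exact: lipb_lin.
have lU : lipb dist U by apply: lipb_lin => //; exact: lipb_cst.
have lG : lipb dist G by apply: lipb_lin => //; exact: lipb_mul.
have E1 : {ae mu, forall p, A k p -> D (interp_along n f) p = D G p}.
  apply: derivation_local => //; first by exists (C + C); exact: lip_bounded_by_interp.
  move=> p [/= pM pk]; rewrite /interp_along /interp /grid_slope /grid_lo /grid_hi.
  rewrite -/(cell_index n p) pk -/a -/b /G /U /T (clamp_id pM) /S.
  ring.
have h1 := killf a; have h2 := killf b.
have h3 := derivation_cst dist_ge0 1 hD.
have eS := Dlin _ (- n.+1%:R) _ _ (lmv b) (lmv a).
have {}eS : {ae mu, forall p, D S p = 0}.
  by apply: filterS3 (eS n.+1%:R) h1 h2 => p -> -> ->; rewrite !mulr0 addr0.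
have eU : {ae mu, forall p, D U p = D T p}.
  apply: filterS2 (Dlin 1 (- a) _ _ lT (lipb_cst dist_ge0 1)) h3 => p -> ->.
  by rewrite mulr0 addr0 mul1r.
have eUS : {ae mu, forall p, D (fun p => U p * S p) p = S p * D T p}.
  by apply: filterS3 (DM _ _ lU lS) eS eU => p -> -> ->; rewrite mulr0 add0r.
have eG := Dlin 1 1 _ _ (lmv a) (lipb_mul lU lS).
have {}eG : {ae mu, forall p, D G p = S p * D T p}.
  by apply: filterS3 eG h1 eUS => p -> -> ->; rewrite mulr0 add0r mul1r.
apply: filterS2 E1 eG => p e1 e2 Ap; rewrite (e1 Ap) e2.
move: Ap => [/= pM pk]; congr (_ * _).
rewrite /slope_along /grid_slope /grid_lo /grid_hi.
by rewrite -/(cell_index n p) pk -/a -/b /S; ring.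
Qed.

Lemma lip_bounded_by_trig (g : R -> R) : (forall x, `|g x| <= 1) ->
  (forall a b, `|g a - g b| <= 1 * `|a - b|) -> lip_bounded_by dist 1 (g \o pi).
Proof.
move=> g1 lg; split=> [x//|x y]; first exact: g1.
by rewrite (le_trans (lg _ _))// mul1r; exact: (coord_lip hpi).
Qed.

Lemma lip_sin_coord : lip_bounded_by dist 1 (sin \o pi).
Proof. by apply: lip_bounded_by_trig; [exact: sin_max|exact: sin_lip]. Qed.

Lemma lip_cos_coord : lip_bounded_by dist 1 (cos \o pi).
Proof. by apply: lip_bounded_by_trig; [exact: cos_max|exact: cos_lip]. Qed.

Lemma measurable_cont_coord (g : R -> R) : continuous g ->
  measurable_fun setT (g \o pi).
Proof.
move=> cg; apply: measurableT_comp; first exact: continuous_measurable_fun.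
exact: coord_measurable.
Qed.

Lemma derivation_trig_slab (g dg : R -> R) (M : R) : 0 <= M ->
  (forall x : R, is_derive x 1 g (dg x)) -> continuous dg ->
  (forall x, `|g x| <= 1) -> (forall x, `|dg x| <= 1) ->
  {ae mu, forall p, `|pi p| <= M ->
    D (g \o pi) p = dg (pi p) * D (fun q => clamp M (pi q)) p}.
Proof.
move=> M0 gdg cdg g1 dg1; have [DL _ _ _] := hD.
have lg : lip_bounded_by dist 1 (g \o pi).
  by apply: lip_bounded_by_trig => //; exact: bounded_derive_lip gdg dg1.
have lbg : lipb dist (g \o pi) by exists 1.
have [mT [K hK]] := DL _ (lipb_clamp_coord M0).
apply: (@derivation_limit_eq _ _ _ dist mu mu_sfinite D (fun n => interp_along n (g \o pi))
  (fun n p => slope_along n (g \o pi) p * D (fun q => clamp M (pi q)) p)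
  (g \o pi) (fun p => dg (pi p) * D (fun q => clamp M (pi q)) p)
  (1 + 1) K [set p | `|pi p| <= M] hD).
- by move=> n; exact: lip_bounded_by_interp.
- by move=> p; exact: interp_along_cvg lg.
- exact: measurable_slab.
- by move=> n; apply: measurable_funM => //; exact: measurable_slope_along.
- split; first by apply: measurable_funM => //; exact: measurable_cont_coord.
  exists K; apply: filterS hK => p hp; rewrite normrM -[leRHS]mul1r.
  by apply: ler_pM.
- move=> n; apply: filterS hK => p hp; rewrite normrM -[leRHS]mul1r.
  by apply: ler_pM => //; exact: slope_along_norm.
- apply: aeW => p _; apply: cvgMl.
  have -> : dg (pi p) = derive1 g (pi p) by rewrite derive1E; have := gdg (pi p); case.
  rewrite /slope_along (_ : (fun c => _) = g).
    by apply: grid_slope_cvg; have := gdg (pi p); case.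
  by apply/funext => c /=; rewrite (coord_mv hpi).
- move=> n; apply: derivation_interp_slab => // c.
  rewrite (_ : (fun p => (g \o pi) (mv p c)) = fun=> g c).
    exact: derivation_cst.
  by apply/funext => p /=; rewrite (coord_mv hpi).
Qed.

Lemma rate_clamp (M : R) : 0 <= M ->
  {ae mu, forall p, `|pi p| <= M -> D (fun q => clamp M (pi q)) p = rate D pi p}.
Proof.
move=> M0.
have hs := @derivation_trig_slab sin cos M M0 (fun x => is_derive_sin x)
  (@continuous_cos R) (@sin_max R) (@cos_max R).
have hc := @derivation_trig_slab cos (fun x => - sin x) M M0 (fun x => is_derive_cos x).
have {}hc := hc (fun x => cvgN (@continuous_sin R x)) (@cos_max R).
have {}hc : {ae mu, forall p, `|pi p| <= M ->
    D (cos \o pi) p = - sin (pi p) * D (fun q => clamp M (pi q)) p}.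
  by apply: hc => x; rewrite normrN sin_max.
apply: filterS2 hs hc => p es ec pM; rewrite /rate es// ec//.
rewrite -[LHS]mul1r -(cos2Dsin2 (pi p)); ring.
Qed.

Lemma Linf_rate : Linf mu (rate D pi).
Proof.
have [DL _ _ _] := hD.
have Ls : Linf mu (sin \o pi).
  split; first by apply: measurable_cont_coord; exact: continuous_sin.
  by exists 1; apply: aeW => x; exact: sin_max.
have Lc : Linf mu (cos \o pi).
  split; first by apply: measurable_cont_coord; exact: continuous_cos.
  by exists 1; apply: aeW => x; exact: cos_max.
have lbs : lipb dist (sin \o pi) by exists 1; exact: lip_sin_coord.
have lbc : lipb dist (cos \o pi) by exists 1; exact: lip_cos_coord.
exact: LinfB (LinfM Lc (DL _ lbs)) (LinfM Ls (DL _ lbc)).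
Qed.

Lemma derivation_interp n f : lipb dist f -> kills_transverse D mv f ->
  {ae mu, forall p, D (interp_along n f) p = slope_along n f p * rate D pi p}.
Proof.
move=> lf killf.
have h (m : nat) : {ae mu, forall p, `|pi p| <= m%:R ->
    D (interp_along n f) p = slope_along n f p * rate D pi p}.
  have m0 : (0 : R) <= m%:R by [].
  apply: filterS2 (derivation_interp_slab n m0 lf killf) (rate_clamp m0) => p e1 e2 pm.
  by rewrite e1// e2.
move/ae_foralln : h; apply: filterS => p h.
by apply: (h (Num.truncn `|pi p|).+1); rewrite ltW// truncnS_gt.
Qed.

(** Every interpolant has slopes of size at most [L], so the bound passes to the limit even where
    the slopes do not converge. The constant [L] only concerns increments along the fibres and may
    be smaller than the Lipschitz constant of [f]. *)
Lemma derivation_le_rate f (L : R) : lipb dist f -> kills_transverse D mv f ->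
  0 <= L ->
  (forall p a b, `|f (mv p a) - f (mv p b)| <= L * `|a - b|) ->
  {ae mu, forall p, D f p <= L * `|rate D pi p|}.
Proof.
move=> [C lf] killf L0 fL.
have LR := LinfM (Linf_cst mu L) (Linf_norm Linf_rate).
have [mR [K hK]] := LR.
suff : {ae mu, forall p, setT p -> D f p <= L * `|rate D pi p|}.
  by apply: filterS => p; exact.
apply: (@derivation_limit_le _ _ _ dist mu mu_sfinite D (fun n => interp_along n f)
  (fun n p => L * `|rate D pi p|) f (fun p => L * `|rate D pi p|) (C + C) K setT hD) => //.
- by move=> n; exact: lip_bounded_by_interp.
- by move=> p; exact: interp_along_cvg lf.
- by apply: aeW => p _; exact: cvg_cst.
- have lf' : lipb dist f by exists C.
  move=> n; apply: filterS (derivation_interp n lf' killf) => p -> _.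
  rewrite (le_trans (ler_norm _))// normrM ler_wpM2r//.
  by apply: grid_slope_norm; exact: fL.
Qed.

Lemma derivation_chain f : lipb dist f -> kills_transverse D mv f ->
  {ae mu, forall p, derivable (fun t => f (mv p t)) (pi p) 1} ->
  {ae mu, forall p, D f p = rate D pi p * derive1 (fun t => f (mv p t)) (pi p)}.
Proof.
move=> [C lf] killf df; have lf' : lipb dist f by exists C.
have [mR [K hK]] := Linf_rate.
(* The upper limit of the slopes is measurable everywhere and equals the derivative wherever the
   latter exists, which avoids discussing the measurability of [derive1]. *)
pose s p := limn_sup (fun n => slope_along n f p).
have ms : measurable_fun setT s.
  apply: measurable_fun_limn_sup.
  - move=> p _; exists C => _ [n _ <-].
    by rewrite (le_trans (ler_norm _))// slope_along_norm.
  - move=> p _; exists (- C) => _ [n _ <-].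
    by have := slope_along_norm n p lf; rewrite ler_norml => /andP[].
  - by move=> n; exact: measurable_slope_along.
have sE : {ae mu, forall p, slope_along n f p @[n --> \oo] --> s p /\
    s p = derive1 (fun t => f (mv p t)) (pi p)}.
  apply: filterS df => p dfp; have cs := grid_slope_cvg dfp.
  have e : s p = derive1 (fun t => f (mv p t)) (pi p).
    by have [_] := cvg_limn_inf_sup cs.
  by rewrite e; split.
have bs : {ae mu, forall p, `|s p| <= C}.
  apply: filterS sE => p [cs _].
  have cn : `|slope_along n f p| @[n --> \oo] --> `|s p| by apply: cvg_norm.
  rewrite -(cvg_lim _ cn)//; apply: limr_le; first by apply/cvg_ex; exists `|s p|.
  by apply: nearW => n; exact: slope_along_norm.
have : {ae mu, forall p, setT p -> D f p = rate D pi p * s p}.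
  apply: (@derivation_limit_eq _ _ _ dist mu mu_sfinite D (fun n => interp_along n f)
    (fun n p => rate D pi p * slope_along n f p) f
    (fun p => rate D pi p * s p) (C + C) (K * C) setT hD) => //.
  - by move=> n; exact: lip_bounded_by_interp.
  - by move=> p; exact: interp_along_cvg lf.
  - by move=> n; apply: measurable_funM => //; exact: measurable_slope_along.
  - by apply: LinfM; [exact: Linf_rate|split=> //; exists C].
  - move=> n; apply: filterS hK => p hp; rewrite normrM.
    by apply: ler_pM => //; exact: slope_along_norm.
  - by apply: filterS sE => p [cs _] _; apply: cvgMr.
  - by move=> n; apply: filterS (derivation_interp n lf' killf) => p -> _; rewrite mulrC.
by apply: filterS2 sE => p [_ <-]; exact.
Qed.

End OneDerivation.

Lemma derivation_rate0 D f : derivation dist mu D ->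
  {ae mu, forall p, rate D pi p = 0} -> lipb dist f -> kills_transverse D mv f ->
  {ae mu, forall p, D f p = 0}.
Proof.
move=> hD r0 [C lf] kf; have lf' : lipb dist f by exists C.
have hND := derivationN hD.
have kNf : kills_transverse (fun f x => - D f x) mv f.
  by move=> c; apply: filterS (kf c) => x ->; rewrite oppr0.
have h0 : 0 <= `|C| by [].
have h1 : forall p a b, `|f (mv p a) - f (mv p b)| <= `|C| * `|a - b|.
  by move=> p a b; rewrite (le_trans (lip_mv p lf _ _))// ler_wpM2r// ler_norm.
have le1 := derivation_le_rate hD lf' kf h0 h1.
have le2 := derivation_le_rate hND lf' kNf h0 h1.
apply: filterS3 le1 le2 r0 => p + + r0.
rewrite (_ : rate (fun f x => - D f x) pi p = - rate D pi p); last first.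
  by rewrite /rate; ring.
rewrite r0 oppr0 normr0 mulr0 oppr_le0 => *.
by apply/eqP; rewrite eq_le; apply/andP.
Qed.

End OneCoordinate.
End Coordinates.

(** * Collapsing strips, and smallness of the rate on thin families of strips *)

Section Collapse.
Context {R : realType} {d : measure_display} {X : measurableType d}.
Variables (dist : X -> X -> R) (mu : {measure set X -> \bar R}).
Hypothesis dist_ge0 : forall x y, 0 <= dist x y.
Hypothesis lip_measurable : forall (f : X -> R) (C : R),
  (forall x y, `|f x - f y| <= C * dist x y) -> measurable_fun setT f.
Hypothesis mu_sfinite : sigma_finite setT mu.
Variables (pi : X -> R) (mv : X -> R -> X).
Hypothesis hpi : coordinate dist pi mv.

Definition transverse_lip (L : R) (g : X -> R) :=
  (forall p c, g (mv p c) = g p) /\ (forall p q, `|g p - g q| <= L * dist p q).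

(* Contracts the interval [b, b + w] to b, moving the half-line above it down by w. *)
Definition squeeze (w b y : R) := Num.max (Num.min y b) (y - w).

(** A maximum on the right, not a sum: this is what keeps the Lipschitz constant fixed when squeezes
    are iterated. *)
Lemma squeeze_lip w b y b' y' :
  `|squeeze w b y - squeeze w b' y'| <= Num.max `|b - b'| `|y - y'|.
Proof.
rewrite /squeeze (le_trans (normr_max_sub _ _ _ _))// ge_max.
rewrite maxC (le_trans (normr_min_sub _ _ _ _))//=.
by rewrite (_ : y - w - (y' - w) = y - y') ?le_max ?lexx//; ring.
Qed.

Lemma squeeze_homo w b y y' : y <= y' -> squeeze w b y <= squeeze w b y'.
Proof.
move=> yy'; rewrite /squeeze; case: (leP y b) => h1; case: (leP y' b) => h2;
  rewrite ge_max !le_max; apply/andP; split; apply/orP; lra.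
Qed.

Lemma squeeze_bounds w b y : 0 <= w -> y - w <= squeeze w b y <= y.
Proof.
by move=> w0; rewrite /squeeze le_max lexx orbT/= ge_max ge_min lexx/= gerBl.
Qed.

Lemma squeeze_id w b y : b <= y <= b + w -> squeeze w b y = b.
Proof.
by move=> /andP[h1 h2]; rewrite /squeeze min_r// max_l// lerBlDr.
Qed.

(** Earlier squeezes have displaced strip [s], so it is squeezed to the current height of its lower
    graph, [collapse w g s (mv p (g s p))], rather than to [g s p]. *)
Fixpoint collapse (w : R) (g : nat -> X -> R) (r : nat) (p : X) : R :=
  if r is s.+1 then squeeze w (collapse w g s (mv p (g s p))) (collapse w g s p)
  else pi p.

Definition strips (w : R) (g : nat -> X -> R) (r : nat) :=
  [set p | exists2 i, (i < r)%N & g i p <= pi p <= g i p + w].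

Section OneCollapse.
Variables (w L : R) (g : nat -> X -> R).
Hypotheses (w0 : 0 <= w) (L1 : 1 <= L).
Hypothesis gL : forall i, transverse_lip L (g i).
Local Notation F := (collapse w g).

Let L0 : 0 <= L. Proof. exact: le_trans L1. Qed.

Lemma transverse_lip_base i p q :
  `|g i p - g i q| <= L * dist (mv p 0) (mv q 0).
Proof. by have [<- <-] := ((gL i).1 p 0, (gL i).1 q 0); apply: (gL i).2. Qed.

(** The new squeezing level is the previous collapse on the graph of [g r], whose height varies by
    at most L times the transverse distance. Both arguments of the maximum thus reproduce
    themselves, and the bound is independent of [r]. *)
Lemma collapse_lip r p q :
  `|F r p - F r q| <= Num.max (L * dist (mv p 0) (mv q 0)) `|pi p - pi q|.
Proof.
elim: r p q => [|r IH] p q /=; first by rewrite le_max lexx orbT.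
rewrite (le_trans (squeeze_lip _ _ _ _ _))// ge_max IH andbT.
rewrite (le_trans (IH _ _))// !(coord_mvmv hpi) !(coord_mv hpi) ge_max.
by rewrite !le_max lexx/= transverse_lip_base.
Qed.

Lemma dist_base p q : dist (mv p 0) (mv q 0) <= dist p q.
Proof. exact: coord_lipl hpi p q 0. Qed.

Lemma collapse_lip_dist r p q : `|F r p - F r q| <= L * dist p q.
Proof.
rewrite (le_trans (collapse_lip _ _ _))// ge_max ler_wpM2l//; last exact: dist_base.
rewrite (le_trans (coord_lip hpi p q))//.
by rewrite ler_wpM2r.
Qed.

Lemma collapse_fiber r p a b : `|F r (mv p a) - F r (mv p b)| <= `|a - b|.
Proof.
rewrite (le_trans (collapse_lip _ _ _))// !(coord_mvmv hpi) !(coord_mv hpi).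
rewrite (_ : dist _ _ = 0) ?mulr0 ?ge_max ?lexx ?andbT//.
apply/eqP; rewrite eq_le dist_ge0 andbT.
by have := coord_lipr hpi p 0 0; rewrite subrr normr0.
Qed.

Lemma collapse_homo r p a b : a <= b -> F r (mv p a) <= F r (mv p b).
Proof.
elim: r a b => [|r IH] a b ab /=; first by rewrite !(coord_mv hpi).
by rewrite !(coord_mvmv hpi) !(gL r).1; apply: squeeze_homo; exact: IH.
Qed.

Lemma collapse_bounds r p : pi p - w * r%:R <= F r p <= pi p.
Proof.
elim: r p => [|r IH] p /=; first by rewrite mulr0 subr0 lexx.
have /andP[h1 h2] := squeeze_bounds (F r (mv p (g r p))) (F r p) w0.
have /andP[h3 h4] := IH p.
rewrite (le_trans h2 h4) andbT (le_trans _ h1)//.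
by rewrite -natr1 mulrDr mulr1; lra.
Qed.

(** On each fibre [collapse w g i] is nondecreasing and 1-Lipschitz, so it maps strip [i] into an
    interval of length [w] above the image of the graph, and the next squeeze sends that interval to
    one point. Later squeezes have levels depending on the fibre only and keep the values equal. *)
Lemma collapse_strip r i p : (i < r)%N -> g i p <= pi p <= g i p + w ->
  F r p = F r (mv p (g i p)).
Proof.
move=> + /andP[h1 h2]; elim: r => [//|r IH] /=.
rewrite ltnS leq_eqVlt => /orP[/eqP ir|ir]; last first.
  by rewrite IH// !(coord_mvmv hpi) !(gL _).1.
rewrite !(coord_mvmv hpi) !(gL _).1 -ir.
have e : F i p = F i (mv p (pi p)) by rewrite (coord_id hpi).
rewrite [RHS]squeeze_id; last by rewrite lexx/= lerDl.
apply: squeeze_id; apply/andP; split; first by rewrite e collapse_homo.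
rewrite e -lerBlDl (le_trans (ler_norm _))// (le_trans (collapse_fiber _ _ _ _))//.
by rewrite ger0_norm ?subr_ge0// lerBlDl.
Qed.

Lemma measurable_transverse i : measurable_fun setT (g i).
Proof. by have [_] := gL i; exact: lip_measurable. Qed.

Lemma measurable_strip i : measurable [set p | g i p <= pi p <= g i p + w].
Proof.
have mpi := coord_measurable lip_measurable hpi.
rewrite (_ : [set p | _] = (fun p => pi p - g i p) @^-1` [set` `[0, w] ]).
  rewrite -[X in measurable X]setTI.
  by apply: (measurable_funB mpi (measurable_transverse i)).
by apply/seteqP; split=> p /=; rewrite in_itv/= subr_ge0 lerBlDl.
Qed.

Lemma measurable_strips r : measurable (strips w g r).
Proof.
rewrite (_ : strips w g r =
    \bigcup_(i in [set i | (i < r)%N]) [set p | g i p <= pi p <= g i p + w]).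
  by apply: bigcup_measurable => i _; exact: measurable_strip.
by apply/seteqP; split=> p [i ir h]; exists i.
Qed.

Variable D : (X -> R) -> X -> R.
Hypothesis hD : derivation dist mu D.
Hypothesis killD : forall f, lipb dist f -> kills_transverse mu D mv f.

(** On strip [i] the collapse agrees with its value on the graph, [H], which is a transverse
    function and hence killed by [D]; locality does the rest. *)
Lemma derivation_collapse (M : R) r : 0 <= M ->
  {ae mu, forall p, strips w g r p -> D (fun q => clamp M (F r q)) p = 0}.
Proof.
move=> M0.
suff : forall i : nat, {ae mu, forall p, (i < r)%N -> g i p <= pi p <= g i p + w ->
    D (fun q => clamp M (F r q)) p = 0}.
  by move=> /ae_foralln; apply: filterS => p h [i ir gp]; exact: h gp.
move=> i; have [ir|ir] := ltnP i r; last first.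
  exact: aeW.
pose H q := clamp M (F r (mv q (g i q))).
have lH : lipb dist H.
  apply: (@lipb_clamp _ _ _ _ dist_ge0 L) => // p q.
  rewrite (le_trans (collapse_lip _ _ _))// !(coord_mvmv hpi) !(coord_mv hpi) ge_max.
  rewrite ler_wpM2l ?dist_base//= (le_trans (transverse_lip_base _ _ _))//.
  by rewrite ler_wpM2l ?dist_base.
have DH : {ae mu, forall p, D H p = 0}.
  have := killD lH 0; apply: filterS => p <-; congr D.
  by apply/funext => q; rewrite /H (gL i).1 (coord_mvmv hpi).
have lF : lipb dist (fun q => clamp M (F r q)).
  by apply: (@lipb_clamp _ _ _ _ dist_ge0 L) => // p q; exact: collapse_lip_dist.
have := @derivation_local _ _ _ dist mu dist_ge0 mu_sfinite D _ H _ hD lF lH (measurable_strip i).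
move=> h; have {}h : {ae mu, forall p, g i p <= pi p <= g i p + w ->
    D (fun q => clamp M (F r q)) p = D H p}.
  by apply: h => p hp; rewrite /H -collapse_strip.
by apply: filterS2 h DH => p e1 e2 _ gp; rewrite e1.
Qed.

End OneCollapse.

(** The width [eta] depends neither on the number nor on the shape of the strips. Otherwise there
    are families of total width at most 1/(k+1) whose strips carry more than [eps]. The truncated
    collapses F_k converge to the truncated coordinate with bounded constants, while D F_k vanishes
    on the strips and is at most the rate elsewhere. In the limit the integral of the rate over [N]
    would be at most itself minus [eps]. *)
Lemma rate_strips_small D N (M L : R) :
  derivation dist mu D ->
  (forall f, lipb dist f -> kills_transverse mu D mv f) ->
  {ae mu, forall p, 0 <= rate D pi p} ->
  measurable N -> (mu N < +oo)%E -> (forall p, N p -> `|pi p| <= M) -> 1 <= L ->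
  forall eps : R, 0 < eps -> exists2 eta : R, 0 < eta &
    forall (w : R) g r, 0 <= w -> (forall i, transverse_lip L (g i)) -> w * r%:R <= eta ->
    \int[mu]_(p in N) (rate D pi p * \1_(strips w g r) p) <= eps.
Proof.
move=> hD kD r0 mN muN NM L1 eps eps0.
have [M0|M0] := ltP M 0.
  exists 1 => // w g r _ _ _.
  rewrite (_ : N = set0) ?Rintegral_set0 ?ltW//.
  apply/seteqP; split=> // p /NM; rewrite leNgt => /negP; apply.
  exact: lt_le_trans (normr_ge0 _).
apply: contrapT => no.
have seq_ex (k : nat) : {x : R * (nat -> X -> R) * nat | [/\ 0 <= x.1.1,
    forall i, transverse_lip L (x.1.2 i), x.1.1 * x.2%:R <= harmonic k &
    eps < \int[mu]_(p in N) (rate D pi p * \1_(strips x.1.1 x.1.2 x.2) p)]}.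
  apply: cid; apply: contrapT => nx; apply: no; exists (harmonic k).
    by rewrite /harmonic/= invr_gt0.
  move=> w g r w0 gL wr; rewrite leNgt; apply/negP => h; apply: nx.
  by exists (w, g, r).
have LR := Linf_rate lip_measurable hpi hD.
pose x k := sval (seq_ex k).
pose w k := (x k).1.1; pose g k := (x k).1.2; pose r k := (x k).2.
have w0 k : 0 <= w k by have [h _ _ _] := svalP (seq_ex k); exact: h.
have gL k i : transverse_lip L (g k i) by have [_ h _ _] := svalP (seq_ex k); exact: h.
have wr k : w k * (r k)%:R <= harmonic k by have [_ _ h _] := svalP (seq_ex k); exact: h.
have big k : eps < \int[mu]_(p in N) (rate D pi p * \1_(strips (w k) (g k) (r k)) p).
  by have [_ _ _ h] := svalP (seq_ex k); exact: h.
pose F k q := clamp M (collapse (w k) (g k) (r k) q).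
have L0 : 0 <= L by exact: le_trans L1.
have lF k : lip_bounded_by dist (Num.max L M) (F k).
  split=> [p|p q]; first by rewrite le_max clamp_norm// orbT.
  rewrite (le_trans (clamp_lip _ _ _))//.
  rewrite (le_trans (collapse_lip_dist _ L1 (gL k) _ _ _))//.
  by rewrite ler_wpM2r// le_max lexx.
have cF p : F k p @[k --> \oo] --> clamp M (pi p).
  apply/cvgrPdist_le => e e0.
  have : harmonic k @[k --> \oo] --> (0 : R) by exact: cvg_harmonic.
  move/cvgr0Pnorm_le/(_ e e0); apply: filterS => k; apply: le_trans.
  rewrite (le_trans (clamp_lip _ _ _))// (le_trans _ (ler_norm _))//.
  rewrite (le_trans _ (wr k))//.
  have /andP[h1 h2] := collapse_bounds (g k) (w0 k) (r k) p.
  by rewrite ger0_norm ?subr_ge0// lerBlDl -lerBlDr.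
have cD := derivation_Rintegral_cvg hD lF cF mN muN.
have lT : lipb dist (fun q => clamp M (pi q)).
  exact: (lipb_clamp_coord dist_ge0 hpi M0).
have [DL _ _ _] := hD.
have I1 : \int[mu]_(p in N) D (fun q => clamp M (pi q)) p =
    \int[mu]_(p in N) rate D pi p.
  apply: ae_eq_Rintegral => //.
  - by apply: Linf_integrable => //; exact: DL.
  - exact: Linf_integrable.
  - have := rate_clamp dist_ge0 lip_measurable mu_sfinite hpi hD M0.
    by apply: filterS => p h Np; apply: h; exact: NM.
have lbF k : lipb dist (F k) by exists (Num.max L M).
have mS k : measurable (strips (w k) (g k) (r k)) by exact: measurable_strips.
have I2 k : \int[mu]_(p in N) D (F k) p <= \int[mu]_(p in N) rate D pi p - eps.
  have LS : Linf mu (fun p => rate D pi p * \1_(strips (w k) (g k) (r k)) p).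
    by apply: LinfM => //; exact: Linf_indic.
  apply: (@le_trans _ _ (\int[mu]_(p in N) rate D pi p -
    \int[mu]_(p in N) (rate D pi p * \1_(strips (w k) (g k) (r k)) p))); last first.
    by rewrite lerB// ltW// big.
  rewrite -RintegralB//; [|exact: Linf_integrable..].
  apply: ae_le_Rintegral => //.
  - by apply: Linf_integrable => //; exact: DL.
  - by apply: Linf_integrable => //; exact: LinfB.
  - have fib p a b : `|F k (mv p a) - F k (mv p b)| <= 1 * `|a - b|.
      rewrite mul1r (le_trans (clamp_lip _ _ _))//.
      exact: (collapse_fiber _ (gL k)).
    have h1 := derivation_le_rate dist_ge0 lip_measurable mu_sfinite hpi hD
      (lbF k) (kD _ (lbF k)) ler01 fib.
    have h2 := derivation_collapse (w0 k) L1 (gL k) hD kD (r k) M0.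
    apply: filterS3 h1 h2 r0 => p h1 h2 rp _.
    rewrite indicE; have [pS|pS] := boolP (p \in _).
      by rewrite mulr1 subrr h2//; rewrite inE in pS.
    by rewrite mulr0 subr0 (le_trans h1)// mul1r ger0_norm.
have : \int[mu]_(p in N) rate D pi p <= \int[mu]_(p in N) rate D pi p - eps.
  rewrite -[leLHS]I1 -(cvg_lim _ cD)//; apply: limr_le.
    by apply/cvg_ex; eexists; exact: cD.
  exact: nearW.
by rewrite lerBrDr gerDl leNgt eps0.
Qed.

End Collapse.

(** * Approximation of Borel sets by unions of grid cells *)

Section GridApproximation.
Context {R : realType}.

Section Algebra.
Context {d : measure_display} {T : measurableType d}.
Variable nu : {measure set T -> \bar R}.
Hypothesis nu_fin : (nu setT < +oo)%E.
Variable G : set (set T).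
Hypotheses (G_measurable : G `<=` measurable) (G0 : G set0)
  (GC : forall A, G A -> G (~` A)) (GU : forall A B, G A -> G B -> G (A `|` B))
  (G_gen : measurable `<=` <<s G >>).

Let sdiff (A B : set T) := (A `\` B) `|` (B `\` A).

Let approximable (A : set T) := measurable A /\
  forall eps : R, 0 < eps -> exists2 E, G E & (nu (sdiff A E) <= eps%:E)%E.

Let msdiff A B : measurable A -> measurable B -> measurable (sdiff A B).
Proof. by move=> mA mB; apply: measurableU; exact: measurableD. Qed.

Let approximableG A : G A -> approximable A.
Proof.
move=> GA; split=> [|eps e0]; first exact: G_measurable.
by exists A => //; rewrite /sdiff setDv setU0 measure0 lee_fin ltW.
Qed.

Let approximableC A : approximable A -> approximable (~` A).
Proof.
move=> [mA aA]; split=> [|eps e0]; first exact: measurableC.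
have [E GE h] := aA eps e0; exists (~` E); first exact: GC.
apply: le_trans h; rewrite le_eqVlt; apply/orP; left; apply/eqP; congr (nu _).
by rewrite /sdiff !setDE !setCK setUC [E `&` _]setIC [A `&` _]setIC.
Qed.

Let approximableU A B : approximable A -> approximable B -> approximable (A `|` B).
Proof.
move=> [mA aA] [mB aB]; split=> [|eps e0]; first exact: measurableU.
have e2 : 0 < eps / 2 by rewrite divr_gt0.
have [E GE hE] := aA _ e2; have [F GF hF] := aB _ e2.
exists (E `|` F); first exact: GU.
have mE := G_measurable GE; have mF := G_measurable GF.
apply: (@le_trans _ _ (nu (sdiff A E `|` sdiff B F))).
  apply: le_measure; rewrite ?inE.
  - by apply: msdiff; exact: measurableU.
  - by apply: measurableU; exact: msdiff.
  - move=> x; rewrite /sdiff /=; tauto.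
rewrite (le_trans (measureU2 _ _ _))//; try exact: msdiff.
by rewrite [eps]splitr EFinD leeD.
Qed.

Let approximable_bigcup (F : nat -> set T) :
  (forall n, approximable (F n)) -> approximable (\bigcup_n F n).
Proof.
move=> aF; have mF n : measurable (F n) by case: (aF n).
have mU : measurable (\bigcup_n F n) by exact: bigcup_measurable.
split=> [//|eps e0]; have e2 : 0 < eps / 2 by rewrite divr_gt0.
pose B n := \big[setU/set0]_(i < n) F i.
have aB n : approximable (B n).
  elim: n => [|n IH]; first by rewrite /B big_ord0; exact: approximableG.
  by rewrite /B big_ord_recr; exact: approximableU.
have mB n : measurable (B n) by case: (aB n).
(* For the finite measure [nu] the part of the union missed by the first n sets tends to 0; half of
   [eps] goes to this part, half to approximating the finite union. *)
have c : (nu \o (fun n => (\bigcup_n F n) `\` B n)) n @[n --> \oo] -->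
    nu (\bigcap_n ((\bigcup_n F n) `\` B n)).
  apply: nonincreasing_cvg_mu.
  - by apply: le_lt_trans nu_fin; apply: le_measure; rewrite ?inE//; exact: measurableD.
  - by move=> n; exact: measurableD.
  - by apply: bigcap_measurable => // n _; exact: measurableD.
  - move=> n m nm; apply/subsetPset => x [Ux nBx]; split=> // Bx; apply: nBx.
    by move: Bx; rewrite /B -!bigcup_mkord => -[i /= im Fx]; exists i => //=; exact: leq_trans nm.
rewrite (_ : \bigcap_n _ = set0) ?measure0 in c; last first.
  apply/seteqP; split=> // x h; have [[n _ Fx] _] := h 0%N I.
  have [_] := h n.+1 I; apply; rewrite /B -bigcup_mkord.
  by exists n => //=.
have /fine_cvgP[fin /cvgr0Pnorm_le/(_ _ e2) small] := c.
have [n [nfin nsmall]] : exists n, nu ((\bigcup_n F n) `\` B n) \is a fin_num /\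
    `|fine (nu ((\bigcup_n F n) `\` B n))| <= eps / 2.
  have [N _ h] : \forall n \near \oo, nu ((\bigcup_n F n) `\` B n) \is a fin_num /\
      `|fine (nu ((\bigcup_n F n) `\` B n))| <= eps / 2.
    by near=> n; split; near: n.
  by exists N; apply: h => /=.
have [E GE hE] := (aB n).2 _ e2; exists E => //.
have mE := G_measurable GE.
apply: (@le_trans _ _ (nu (((\bigcup_n F n) `\` B n) `|` sdiff (B n) E))).
  apply: le_measure; rewrite ?inE.
  - exact: msdiff.
  - by apply: measurableU; [exact: measurableD|exact: msdiff].
  - have BU : B n `<=` \bigcup_n F n.
      by rewrite /B -bigcup_mkord => x [i _ Fx]; exists i.
    move=> x [[Ux nEx]|[Ex nUx]].
      by have [Bx|nBx] := pselect (B n x); [right; left|left].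
    by right; right; split=> // /BU.
rewrite (le_trans (measureU2 _ _ _))//; [exact: measurableD|exact: msdiff|].
rewrite [eps]splitr EFinD leeD//.
by rewrite -[leLHS](fineK nfin) lee_fin (le_trans (ler_norm _)).
Unshelve. all: by end_near. Qed.

(** The sets approximable by members of [G] in symmetric difference form a sigma-algebra that
    contains [G]. *)
Lemma algebra_approximation A (eps : R) : measurable A -> 0 < eps ->
  exists2 E, G E & (nu (A `\` E) <= eps%:E)%E /\ (nu (E `\` A) <= eps%:E)%E.
Proof.
move=> mA e0; have : approximable A.
  have := G_gen mA; apply: smallest_sub; last exact: approximableG.
  split; first exact: approximableG.
  - by move=> B /approximableC; rewrite setTD.
  - exact: approximable_bigcup.
move=> [_ /(_ eps e0)[E GE h]]; exists E => //.
have mE := G_measurable GE.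
by split; apply: le_trans h; apply: le_measure; rewrite ?inE;
  [exact: measurableD|exact: msdiff|left|exact: measurableD|exact: msdiff|right].
Qed.

End Algebra.

Definition same_cell (n : nat) (x y : R) :=
  Num.floor (x * n%:R) = Num.floor (y * n%:R).

(** Grids are compared through products of their indices: the grid of index n m refines both that of
    index n and that of index m, so two unions of cells have a common grid. *)
Lemma same_cell_mul n m x y : (0 < m)%N -> same_cell (n * m) x y -> same_cell n x y.
Proof.
move=> m0; rewrite /same_cell => e.
have key (k : int) (z : R) :
    (k <= Num.floor (z * n%:R)) = (k * m%:Z <= Num.floor (z * (n * m)%:R)).
  by rewrite !floor_ge_int natrM mulrA intrM ler_pM2r// ltr0n.
by apply/eqP; rewrite eq_le; apply/andP; split;
  [rewrite key -e -key|rewrite key e -key].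
Qed.

Section Refinement.
Context {d : measure_display} {T : measurableType d}.
Variable rel : nat -> T -> T -> Prop.
Hypothesis rel_sym : forall n x y, rel n x y -> rel n y x.
Hypothesis rel_mul : forall n m x y, (0 < m)%N -> rel (n * m) x y -> rel n x y.

(** Measurable unions of grid cells. The index is existential, as the sets of all meshes together
    are needed to form an algebra that generates the Borel sets; it is positive because index 0
    would put all points in one cell. *)
Definition saturated (E : set T) := measurable E /\
  exists2 n, (0 < n)%N & forall x y, rel n x y -> E x -> E y.

Lemma saturatedC E : saturated E -> saturated (~` E).
Proof.
move=> [mE [n n0 h]]; split; first exact: measurableC.
by exists n => // x y /rel_sym xy nEx Ey; apply: nEx; exact: h Ey.
Qed.

Lemma saturatedU E F : saturated E -> saturated F -> saturated (E `|` F).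
Proof.
move=> [mE [n n0 hE]] [mF [m m0 hF]]; split; first exact: measurableU.
exists (n * m)%N; first by rewrite muln_gt0 n0.
move=> x y xy [Ex|Fx]; [left; apply: hE Ex|right; apply: hF Fx].
  exact: rel_mul xy.
by apply: (@rel_mul _ n); rewrite // mulnC.
Qed.

Lemma saturated0 : saturated set0.
Proof. by split=> //; exists 1%N. Qed.

End Refinement.

Definition same_cell2 n (p q : R * R) := same_cell n p.1 q.1 /\ same_cell n p.2 q.2.

(** Each set on the right is a union of cells of one grid, so half-lines, which are not, still lie
    in the generated sigma-algebra. *)
Lemma itv_floor_bigcap (a : R) : `[a, +oo[%classic =
  \bigcap_n [set x : R | Num.floor (a * n.+1%:R) <= Num.floor (x * n.+1%:R)].
Proof.
apply/seteqP; split=> x /=; rewrite in_itv/= andbT.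
  by move=> ax n _ /=; apply: le_floor; rewrite ler_wpM2r.
move=> h; rewrite leNgt; apply/negP => xa.
have ax0 : 0 < a - x by rewrite subr_gt0.
have [N _ hN] : \forall n \near \oo, `|@harmonic R n| < a - x.
  have : harmonic n @[n --> \oo] --> (0 : R) by exact: cvg_harmonic.
  by move/cvgr0Pnorm_lt; apply.
have := hN N (leqnn N); rewrite /harmonic/= ger0_norm// => hN'.
have := h N I => /=; rewrite -(ler_int R) => h1.
have := floor_le (x * N.+1%:R); have := floorD1_gt (a * N.+1%:R); rewrite intrD mulr1z => h2 h3.
have : a * N.+1%:R - x * N.+1%:R < 1.
  move: h1 h2 h3; set u := a * _; set v := x * _; lra.
rewrite -mulrBl -ltr_pdivlMr// div1r; move: hN'; set u := _^-1; lra.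
Qed.

Lemma measurable_floor_ge (c : int) n :
  measurable [set x : R | c <= Num.floor (x * n.+1%:R)].
Proof.
rewrite (_ : [set x | _] = `[c%:~R / n.+1%:R, +oo[%classic); first exact: measurable_itv.
by apply/seteqP; split=> x /=; rewrite in_itv/= andbT floor_ge_int ler_pdivrMr.
Qed.

(** Coordinates stay measurable for the sigma-algebra generated by unions of cells; hence so does
    the identity, which means that all Borel sets are generated. *)
Lemma saturated_fibre d (T : measurableType d) (f : T -> R) rel :
  measurable_fun setT f ->
  (forall n x y, rel n x y -> same_cell n (f x) (f y)) ->
  measurable_fun setT (f : g_sigma_algebraType (saturated rel) -> R).
Proof.
move=> mf hrel; apply: (measurability _ (RGenCInfty.measurableE R)).
move=> _ [_ [a ->] <-]; rewrite setTI itv_floor_bigcap preimage_bigcap.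
apply: bigcap_measurable => // n _; apply: sub_sigma_algebra; split.
  by rewrite -[X in measurable X]setTI; apply: mf => //; exact: measurable_floor_ge.
by exists n.+1 => // x y /hrel; rewrite /same_cell /= => ->.
Qed.

Lemma measurable_saturated1 : measurable `<=` <<s saturated same_cell >>.
Proof.
move=> A mA; have := @saturated_fibre _ R id same_cell (fun mD => measurable_id mD).
by move=> /(_ (fun _ _ _ => id)) h; have := h measurableT A mA; rewrite setTI.
Qed.

Lemma measurable_saturated2 :
  (@measurable _ (R * R)%type) `<=` <<s saturated same_cell2 >>.
Proof.
move=> A mA.
have h1 := @saturated_fibre _ _ fst same_cell2 measurable_fst (fun _ _ _ => @proj1 _ _).
have h2 := @saturated_fibre _ _ snd same_cell2 measurable_snd (fun _ _ _ => @proj2 _ _).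
have := measurable_fun_pair h1 h2 => h; have := h measurableT A mA.
by rewrite setTI (_ : _ @^-1` A = A)//; apply/seteqP; split=> -[].
Qed.

Section TwoMeasures.
Context {d : measure_display} {T : measurableType d}.
Variable rel : nat -> T -> T -> Prop.
Hypothesis rel_sym : forall n x y, rel n x y -> rel n y x.
Hypothesis rel_mul : forall n m x y, (0 < m)%N -> rel (n * m) x y -> rel n x y.
Hypothesis rel_gen : measurable `<=` <<s saturated rel >>.

(** The set [N] is approximated for the sum of the two measures restricted to [Q], so a single [E]
    serves both: it misses little of [N] for [mu], and what it adds to [N] is small for [nu], where
    [N] itself is null. *)
Lemma grid_approximation (mu nu : {measure set T -> \bar R}) (Q N : set T) (eps : R) :
  measurable Q -> (mu Q < +oo)%E -> (nu Q < +oo)%E ->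
  measurable N -> nu N = 0%E -> 0 < eps ->
  exists2 E, saturated rel E &
    (mu ((N `\` E) `&` Q) <= eps%:E)%E /\ (nu (E `&` Q) <= eps%:E)%E.
Proof.
move=> mQ muQ nuQ mN N0 e0.
pose sigma : {measure set T -> \bar R} := measure_add (mrestr mu mQ) (mrestr nu mQ).
have sE A : sigma A = (mu (A `&` Q) + nu (A `&` Q))%E.
  exact: (@measure_addE _ _ _ (mrestr mu mQ) (mrestr nu mQ) A).
have [||||||E sE' [h1 h2]] :=
  @algebra_approximation _ _ sigma _ (saturated rel) _ _ _ _ _ N eps mN e0.
- by rewrite sE setTI lte_add_pinfty.
- by move=> A [].
- exact: saturated0.
- by move=> A; exact: saturatedC.
- by move=> A B; exact: saturatedU.
- exact: rel_gen.
exists E => //; split.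
  by apply: le_trans h1; rewrite sE leeDl.
have mE : measurable E by case: sE'.
apply: (@le_trans _ _ (nu ((E `\` N) `&` Q `|` N))).
  apply: le_measure; rewrite ?inE; first exact: measurableI.
    by apply: measurableU => //; apply: measurableI => //; exact: measurableD.
  by move=> x [Ex Qx]; have [Nx|Nx] := pselect (N x); [right|left].
apply: (@le_trans _ _ (nu ((E `\` N) `&` Q) + nu N)%E).
  by apply: measureU2 => //; apply: measurableI => //; exact: measurableD.
by rewrite N0 adde0; apply: le_trans h2; rewrite sE leeDr.
Qed.

End TwoMeasures.
End GridApproximation.

(** * Covering a finite ordered set by chains and antichains *)

Section ChainCover.
Context {T : eqType}.
Variable lt : rel T.
Hypotheses (lt_irr : irreflexive lt) (lt_tr : transitive lt).
Implicit Types (K c : seq T) (x y : T).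

Lemma sorted_comparable c x y : sorted lt c -> x \in c -> y \in c ->
  [\/ x = y, lt x y | lt y x].
Proof.
elim: c => [//|z c IH] /= pc.
have /allP zc := order_path_min lt_tr pc.
rewrite !inE => /predU1P[->|xc] /predU1P[->|yc].
- exact: Or31.
- by apply: Or32; exact: zc.
- by apply: Or33; exact: zc.
- by apply: IH => //; exact: path_sorted pc.
Qed.

(** Mirsky's argument: the minimal elements [M] form an antichain, and a chain among the other
    elements can be prolonged downwards by an element of [K], so removing [M] shortens the longest
    chain. *)
Lemma antichain_cover s K :
  (forall c, sorted lt c -> {subset c <= K} -> size c != s.+1) ->
  exists ac : seq (seq T), [/\ (size ac <= s)%N,
    forall a, a \in ac -> forall x y, x \in a -> y \in a -> ~~ lt x y &
    forall x, x \in K -> exists2 a, a \in ac & x \in a].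
Proof.
elim: s K => [|s IH] K noc.
  exists [::]; split=> // x xK; exfalso.
  suff : (1 != 1)%N by rewrite eqxx.
  by apply: (noc [:: x]) => // z; rewrite inE => /eqP ->.
pose K' := [seq x <- K | has (lt^~ x) K].
pose M := [seq x <- K | ~~ has (lt^~ x) K].
have [c sc cK'|ac [sac hac cov]] := IH K'.
  apply/negP => /eqP sz; case: c sc cK' sz => [//|x c] sc cK' sz.
  have : x \in K' by apply: cK'; rewrite inE eqxx.
  rewrite mem_filter => /andP[/hasP[y yK yx] xK].
  suff : s.+2 != s.+2 by rewrite eqxx.
  rewrite -{1}sz; apply: (noc (y :: x :: c)).
  - by rewrite /= yx.
  - move=> z; rewrite inE => /predU1P[->//|/cK']; by rewrite mem_filter => /andP[].
exists (M :: ac); split => //.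
- move=> a; rewrite inE => /predU1P[->|]; last exact: hac.
  move=> x y; rewrite !mem_filter => /andP[_ xK] /andP[/hasPn/(_ x xK) + _] //.
- move=> x xK; have [h|h] := boolP (has (lt^~ x) K).
    have [|a aac xa] := cov x; first by rewrite mem_filter h.
    by exists a => //; rewrite inE aac orbT.
  by exists M; rewrite ?inE ?eqxx// mem_filter h.
Qed.

(** Chains with exactly [s.+1] elements are extracted as long as there are any, each using up at
    least that many entries of [K]; once none is left, [s] antichains suffice for the remainder. *)
Lemma chain_antichain_cover s K :
  exists cs ac : seq (seq T), [/\ (size cs * s.+1 <= size K)%N, (size ac <= s)%N,
    forall c, c \in cs -> sorted lt c,
    forall a, a \in ac -> forall x y, x \in a -> y \in a -> ~~ lt x y &
    forall x, x \in K ->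
      (exists2 c, c \in cs & x \in c) \/ (exists2 a, a \in ac & x \in a)].
Proof.
have [m] := ubnP (size K); elim: m K => // m IH K; rewrite ltnS => Km.
have [[c [sc cK sz]]|noc] := pselect (exists c, [/\ sorted lt c, {subset c <= K}
    & size c = s.+1]); last first.
  have [|ac [h1 h2 h3]] := @antichain_cover s K.
    by move=> c sc cK; apply/negP => /eqP sz; apply: noc; exists c.
  by exists [::], ac; split=> // x /h3; right.
pose K' := [seq x <- K | x \notin c].
have szK : (size K' + s.+1 <= size K)%N.
  rewrite -(count_predC (fun x => x \in c) K) addnC leq_add//; last by rewrite size_filter.
  rewrite -size_filter -sz uniq_leq_size//; first exact: sorted_uniq lt_tr lt_irr _ sc.
  by move=> x xc; rewrite mem_filter xc cK.
have [|cs [ac [h1 h2 h3 h4 h5]]] := IH K'.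
  by apply: leq_trans Km; apply: leq_trans szK; rewrite addnS ltnS leq_addr.
exists (c :: cs), ac; split=> //.
- by rewrite /= mulSn addnC (leq_trans _ szK)// leq_add2r.
- by move=> c'; rewrite inE => /predU1P[->//|]; exact: h3.
- move=> x xK; have [xc|xc] := boolP (x \in c).
    by left; exists c; rewrite ?inE ?eqxx.
  have [|[c' c'cs xc']|] := h5 x; first by rewrite mem_filter xc.
    by left; exists c' => //; rewrite inE c'cs orbT.
  by right.
Qed.

End ChainCover.

(** * From chains and antichains of squares to strips around Lipschitz graphs *)

Section GraphStrips.
Context {R : realType}.

(* McShane extension of the partial function i/n |-> j/n given by the pairs (i, j). *)
Lemma graph_strip (n : nat) (c : seq (int * int)) : (0 < n)%N ->
  (forall p q, p \in c -> q \in c -> `|p.2 - q.2| <= `|p.1 - q.1|) ->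
  exists2 g : R -> R, (forall x y, `|g x - g y| <= `|x - y|) &
    forall p x y, p \in c -> Num.floor (x * n%:R) = p.1 ->
      Num.floor (y * n%:R) = p.2 -> g x <= y <= g x + 3 / n%:R.
Proof.
move=> n0; case: c => [_|p0 c hc].
  by exists (fun=> 0) => // x y; rewrite subrr normr0.
have N0 : (0 : R) < n%:R by rewrite ltr0n.
pose phi (p : int * int) (x : R) : R := (p.2%:~R + `|x * n%:R - p.1%:~R|) / n%:R.
have phi_lip p x y : phi p x - phi p y <= `|x - y|.
  rewrite /phi -mulrBl ler_pdivrMr// opprD addrACA subrr add0r.
  rewrite (le_trans (lerB_dist _ _))// opprB addrA subrK -mulrBl normrM.
  by rewrite (ger0_norm (ltW N0)).
pose g := foldr (fun p f x => Num.min (phi p x) (f x)) (phi p0) c.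
have g_le p x : p \in p0 :: c -> g x <= phi p x.
  rewrite /g; elim: c {hc g} => [|q c IH] /=; first by rewrite inE => /eqP ->.
  rewrite !inE => /or3P[pp0|/eqP ->|pc]; rewrite ge_min; apply/orP.
  - by right; apply: IH; rewrite inE pp0.
  - by left.
  - by right; apply: IH; rewrite inE pc orbT.
have g_ex x : exists2 p, p \in p0 :: c & g x = phi p x.
  rewrite /g; elim: c {hc g g_le} => [|q c [p pc IH]] /=.
    by exists p0; rewrite ?inE.
  rewrite IH; case: leP => _; first by exists q; rewrite // !inE eqxx orbT.
  by exists p => //; move: pc; rewrite !inE => /orP[->//|->]; rewrite !orbT.
have g_lip x y : g x - g y <= `|x - y|.
  have [p pc ->] := g_ex y.
  by rewrite (le_trans _ (phi_lip p x y))// lerB// g_le.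
(* On a listed square n g lies within 1 of the row j, and n y lies between j and j + 1. Lowering the
   graph by 1/n puts it below the square, and a height of 3/n then covers the square. *)
exists (fun x => g x - n%:R^-1).
  move=> x y; rewrite opprB addrA subrK ler_norml g_lip andbT.
  by rewrite lerNl opprB distrC g_lip.
move=> p x y pc fx fy.
have x1 := floor_le (x * n%:R); have x2 := floorD1_gt (x * n%:R).
have y1 := floor_le (y * n%:R); have y2 := floorD1_gt (y * n%:R).
rewrite fx intrD mulr1z in x1 x2; rewrite fy intrD mulr1z in y1 y2.
have le1 : g x * n%:R <= p.2%:~R + 1.
  rewrite (le_trans (ler_wpM2r (ltW N0) (g_le _ _ pc)))// /phi divfK ?gt_eqF//.
  by rewrite lerD2l ger0_norm ?subr_ge0// lerBlDl ltW.
have le2 : p.2%:~R - 1 <= g x * n%:R.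
  have [q qc ->] := g_ex x; rewrite /phi divfK ?gt_eqF//.
  have := hc _ _ pc qc; rewrite -(ler_int R) !intr_norm !intrB => h.
  have t : `|p.1%:~R - q.1%:~R| <= `|x * n%:R - q.1%:~R| + 1 :> R.
    rewrite (_ : p.1%:~R - q.1%:~R =
      (x * n%:R - q.1%:~R) + (p.1%:~R - x * n%:R)); last by ring.
    rewrite (le_trans (ler_normD _ _))// lerD2l distrC ger0_norm ?subr_ge0//.
    by rewrite lerBlDl ltW.
  have := ler_norm (p.2%:~R - q.2%:~R : R); move: h t; lra.
have nn : n%:R^-1 * n%:R = 1 :> R by rewrite mulVf// gt_eqF.
apply/andP; split; rewrite -(ler_pM2r N0) !(mulrDl, mulNr) ?nn.
  by move: le1 y1; lra.
by rewrite -mulrA nn; move: le2 y2; lra.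
Qed.

(** Along a chain the row is a 1-Lipschitz function of the column. Two distinct incomparable squares
    satisfy |di| < |dj|, so along an antichain the column is a 1-Lipschitz function of the row. *)
Definition steep_lt : rel (int * int) :=
  [rel p q | (p.1 < q.1) && (`|p.2 - q.2| <= q.1 - p.1)].

Lemma steep_lt_irr : irreflexive steep_lt.
Proof. by move=> p; rewrite /steep_lt /= ltxx. Qed.

Lemma steep_lt_tr : transitive steep_lt.
Proof.
move=> q p r /andP[h1 h2] /andP[h3 h4]; rewrite /steep_lt /= (lt_trans h1 h3)/=.
rewrite (le_trans (ler_distD q.2 _ _))//.
by rewrite (le_trans (lerD h2 h4))// addrC addrA subrK.
Qed.

(** The parameter [s] trades the number of strips over one axis against the number over the other;
    both are of order sqrt K when [s] is. *)
Lemma cells_strips (s n : nat) (K : seq (int * int)) : (0 < n)%N ->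
  exists (r1 r2 : nat) (g1 g2 : nat -> R -> R),
  [/\ (r1 * s.+1 <= size K)%N, (r2 <= s)%N,
    forall i x y, `|g1 i x - g1 i y| <= `|x - y|,
    forall i x y, `|g2 i x - g2 i y| <= `|x - y| &
    forall x y, (Num.floor (x * n%:R), Num.floor (y * n%:R)) \in K ->
      (exists2 i, (i < r1)%N & g1 i x <= y <= g1 i x + 3 / n%:R) \/
      (exists2 i, (i < r2)%N & g2 i y <= x <= g2 i y + 3 / n%:R)].
Proof.
move=> n0; have [cs [ac [h1 h2 h3 h4 h5]]] :=
  chain_antichain_cover steep_lt_irr steep_lt_tr s K.
have hc c : c \in cs -> forall p q, p \in c -> q \in c -> `|p.2 - q.2| <= `|p.1 - q.1|.
  move=> /h3 sc p q pc qc; have [->|/andP[_ h]|/andP[_ h]] :=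
    sorted_comparable steep_lt_tr sc pc qc.
  - by rewrite !subrr.
  - by rewrite (le_trans h)// distrC ler_norm.
  - by rewrite distrC (le_trans h)// ler_norm.
have ha a : a \in ac -> forall p q, p \in [seq (x.2, x.1) | x <- a] ->
    q \in [seq (x.2, x.1) | x <- a] -> `|p.2 - q.2| <= `|p.1 - q.1|.
  move=> /h4 ha _ _ /mapP[p pa ->] /mapP[q qa ->] /=.
  have := ha _ _ pa qa; have := ha _ _ qa pa; rewrite /steep_lt/= !negb_and.
  rewrite (distrC q.2); case: (ltgtP p.1 q.1) => [pq|qp|->] /=; last first.
  - by rewrite subrr normr0.
  - by rewrite -ltNge => /ltW h _; rewrite ger0_norm ?subr_ge0 ?(ltW qp).
  - by move=> _; rewrite -ltNge => /ltW h; rewrite distrC ger0_norm ?subr_ge0 ?(ltW pq).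
(* Lists outside the cover receive the zero function, since the Lipschitz bound is wanted for every
   index, including those beyond the size of the cover. *)
have ex1 c : {g : R -> R | (forall x y, `|g x - g y| <= `|x - y|) /\ (c \in cs ->
    forall p x y, p \in c -> Num.floor (x * n%:R) = p.1 ->
      Num.floor (y * n%:R) = p.2 -> g x <= y <= g x + 3 / n%:R)}.
  apply: cid; have [ccs|nc] := boolP (c \in cs).
    have [g g1 g2] := graph_strip n0 (hc c ccs); exists g; split=> [//|_ p x y pc fx fy].
    by apply: (g2 p).
  by exists (fun=> 0); split=> // x y; rewrite subrr normr0.
have ex2 a : {g : R -> R | (forall x y, `|g x - g y| <= `|x - y|) /\ (a \in ac ->
    forall p x y, p \in a -> Num.floor (x * n%:R) = p.1 ->
      Num.floor (y * n%:R) = p.2 -> g y <= x <= g y + 3 / n%:R)}.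
  apply: cid; have [aac|na] := boolP (a \in ac).
    have [g g1 g2] := graph_strip n0 (ha a aac); exists g; split=> // _ p x y pa fx fy.
    by apply: (g2 (p.2, p.1)) => //; apply/mapP; exists p.
  by exists (fun=> 0); split=> // x y; rewrite subrr normr0.
exists (size cs), (size ac), (fun i => sval (ex1 (nth [::] cs i))),
  (fun i => sval (ex2 (nth [::] ac i))); split=> //.
- by move=> i; have [] := svalP (ex1 (nth [::] cs i)).
- by move=> i; have [] := svalP (ex2 (nth [::] ac i)).
move=> x y /h5[[c ccs pc]|[a aac pa]]; [left|right].
- exists (index c cs); first by rewrite index_mem.
  rewrite nth_index//; have [_ h] := svalP (ex1 c); exact: h pc _ _.
- exists (index a ac); first by rewrite index_mem.
  rewrite nth_index//; have [_ h] := svalP (ex2 a); exact: h pa _ _.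
Qed.

End GraphStrips.

(** * Almost everywhere differentiability of Lipschitz functions on the line *)

Section Rademacher.
Context {R : realType}.
Local Notation leb := (@lebesgue_measure R).

Lemma lebesgue_stieltjes_ocitv (f : cumulative R R) (a b : R) : a <= b ->
  lebesgue_stieltjes_measure f `]a, b]%classic = (f b - f a)%:E.
Proof.
move=> ab; rewrite /lebesgue_stieltjes_measure /measure_extension.
rewrite measurable_mu_extE/=; last exact: is_ocitv.
by rewrite wlength_itv_bnd.
Qed.

Section OneLipschitz.
Variable f : R -> R.
Hypothesis lf : forall x y, `|f x - f y| <= `|x - y|.

Let f_continuous : continuous f.
Proof.
move=> x; apply/cvgrPdist_le => e e0; exists e => //= y /= xy.
by rewrite (le_trans (lf _ _))// ltW.
Qed.

(** The bound |f x - f y| <= |x - y| is what makes both [phi] and [psi] nondecreasing, and f = 2 phi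
    - id reduces the claim to [phi]. *)
Let phi x := (x + f x) / 2.
Let psi x := (x - f x) / 2.

Let phi_nd : nondecreasing phi.
Proof.
move=> x y xy; rewrite /phi ler_pM2r ?invr_gt0//.
have := lf x y; rewrite (distrC x) (ger0_norm (_ : 0 <= y - x)) ?subr_ge0//.
have := ler_norm (f x - f y); lra.
Qed.

Let psi_nd : nondecreasing psi.
Proof.
move=> x y xy; rewrite /psi ler_pM2r ?invr_gt0//.
have := lf y x; rewrite (ger0_norm (_ : 0 <= y - x)) ?subr_ge0//.
have := ler_norm (f y - f x); lra.
Qed.

Let phi_continuous : continuous phi.
Proof.
move=> x; apply: cvgM; last exact: cvg_cst.
by apply: cvgD; [exact: cvg_id|exact: f_continuous].
Qed.

Let psi_continuous : continuous psi.
Proof.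
move=> x; apply: cvgM; last exact: cvg_cst.
by apply: cvgB; [exact: cvg_id|exact: f_continuous].
Qed.

HB.instance Definition _ := isCumulative.Build R _ R phi phi_nd
  (right_continuousW phi_continuous).
HB.instance Definition _ := isCumulative.Build R _ R psi psi_nd
  (right_continuousW psi_continuous).

Let nu := lebesgue_stieltjes_measure phi.
Let nu' := lebesgue_stieltjes_measure psi.

(* phi + psi = id, so the Stieltjes measures of phi and psi add up to Lebesgue measure. *)
Let nu_add A : measurable A -> leb A = (nu A + nu' A)%E.
Proof.
move=> mA.
rewrite (@lebesgue_measure_unique R (measure_add nu nu') _ A mA).
  exact: (@measure_addE _ _ _ nu nu' A).
move=> _ [[a b] _ <-]; change (a, b).1 with a; change (a, b).2 with b.
apply: etrans; last exact/esym/(@measure_addE _ _ _ nu nu').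
have [ab|ba] := leP a b; last first.
  by rewrite set_itv_ge ?measure0 ?adde0// bnd_simp -leNgt ltW.
apply: (etrans (lebesgue_stieltjes_ocitv idfun ab)); apply/esym.
transitivity ((phi b - phi a)%:E + (psi b - psi a)%:E)%E.
  by congr (_ + _)%E; exact: lebesgue_stieltjes_ocitv.
by rewrite -EFinD; congr EFin; rewrite /phi /psi /=; lra.
Qed.

Let nu_dominated : nu `<< leb.
Proof.
apply/null_content_dominatesP => A mA A0.
apply/eqP; rewrite -measure_le0 -A0; apply: le_trans (_ : _ <= nu A + nu' A)%E _.
  exact: leeDl.
by rewrite -(nu_add mA).
Qed.

(** The Stieltjes measure of [phi] is dominated by Lebesgue measure. On a bounded interval it is
    finite, so it has an integrable density, and Lebesgue differentiation makes the primitive of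
    this density, which is [phi] up to a constant, derivable almost everywhere. *)
Lemma derivable_ae_1lip : {ae leb, forall x, derivable f x 1}.
Proof.
suff : forall m : nat, {ae leb, forall x, `]- m%:R, m%:R[%classic x -> derivable f x 1}.
  move/ae_foralln; apply: filterS => x h.
  apply: (h (Num.truncn `|x|).+1); rewrite /= in_itv/= -ltr_norml.
  exact: truncnS_gt.
move=> m; pose D : set (measurableTypeR R) := `]- m%:R, m%:R]%classic.
have mD : measurable D by exact: measurable_itv.
have m0 : - m%:R <= m%:R :> R by rewrite (@le_trans _ _ 0)// oppr_le0.
have nuD : (nu D < +oo)%E.
  apply: le_lt_trans (ltry (phi m%:R - phi (- m%:R))).
  by rewrite le_eqVlt; apply/orP; left; apply/eqP; exact: lebesgue_stieltjes_ocitv.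
pose rho := mfrestr (f := lebesgue_stieltjes_measure phi) mD nuD.
have rhoE A : rho A = nu (A `&` D) by [].
have rho_dom : rho `<< leb.
  apply/null_content_dominatesP => A mA A0; rewrite rhoE.
  apply/eqP; rewrite -measure_le0 -((null_content_dominatesP _ _).1 nu_dominated A mA A0).
  by apply: le_measure; rewrite ?inE//; exact: measurableI.
have [h [h0 hfin hint hE]] :=
  @radon_nikodym_sigma_finite _ _ R leb
    (mfrestr (f := lebesgue_stieltjes_measure phi) mD nuD) rho_dom.
pose g := fine \o h.
have gE : EFin \o g = h by apply/funext => x; rewrite /g /= fineK.
have gint A : measurable A -> leb.-integrable A (EFin \o g).
  by move=> mA; rewrite gE; apply: integrableS hint.
have gloc : locally_integrable [set: R] g.
  have := integrable_locally measurableT (gint _ measurableT).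
  by rewrite patch_setT.
have := FTC1Ny (fun y => gint _ (measurable_itv `]-oo, y])) gloc.
apply: filterS; first exact: (ae_filter_ringOfSetsType leb).
move=> x [dF _]; rewrite /= in_itv/= => /andP[mx xm].
have FE y : - m%:R <= y <= m%:R ->
    \int[leb]_(t in `]-oo, y]) g t = phi y - phi (- m%:R).
  move=> /andP[my ym]; rewrite /Rintegral -[LHS]/(fine _).
  have -> : (\int[leb]_(t in `]-oo, y]) (g t)%:E)%E = rho `]-oo, y]%classic.
    rewrite -[RHS]/(mfrestr (f := lebesgue_stieltjes_measure phi) mD nuD _).
    apply: etrans (esym (hE _ (measurable_itv `]-oo, y]))).
    by apply: eq_integral => t _; rewrite -gE.
  transitivity (fine (phi y - phi (- m%:R))%:E); last by [].
  congr fine; rewrite rhoE (_ : _ `&` D = `]- m%:R, y]%classic).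
    exact: lebesgue_stieltjes_ocitv.
  rewrite /D; apply/seteqP; split=> t /=; rewrite !in_itv/=.
    by move=> [ty /andP[mt _]]; rewrite mt.
  by move=> /andP[mt ty]; rewrite mt ty (le_trans ty).
have nearE : \forall y \near x, f y = 2 * (\int[leb]_(t in `]-oo, y]) g t) +
    (2 * phi (- m%:R) - y).
  have : \forall y \near x, y \in `]- m%:R, m%:R[.
    by apply: near_in_itvoo; rewrite in_itv/= mx.
  apply: filterS => y; rewrite in_itv/= => /andP[my ym].
  by rewrite FE ?(ltW my) ?(ltW ym)// /phi; lra.
pose F (y : R) : R := \int[leb]_(t in `]-oo, y]) g t.
apply: (@near_eq_derivable _ _ _ ((2 : R) \*: F + (cst (2 * phi (- m%:R)) - id))).
  by apply: filterS nearE => y ->.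
apply: derivableD; first exact: derivableZ.
by apply: derivableB; [exact: derivable_cst|exact: derivable_id].
Qed.

End OneLipschitz.

Lemma lipschitz_derivable_ae (f : R -> R) (C : R) :
  (forall x y, `|f x - f y| <= C * `|x - y|) ->
  {ae leb, forall x, derivable f x 1}.
Proof.
move=> lf; pose K := `|C| + 1; have K0 : 0 < K by rewrite ltr_wpDl.
have lg x y : `|f x / K - f y / K| <= `|x - y|.
  rewrite -mulrBl normrM (ger0_norm (_ : 0 <= K^-1)) ?invr_ge0 ?(ltW K0)// ler_pdivrMr//.
  rewrite (le_trans (lf x y))// mulrC ler_wpM2l// /K.
  by rewrite (le_trans (ler_norm _))// lerDl.
have := derivable_ae_1lip lg; apply: filterS => [|x dg].
  exact: (ae_filter_ringOfSetsType leb).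
have -> : f = K \*: (fun x => f x / K).
  by apply/funext => y /=; rewrite /GRing.scale/= mulrC divfK// gt_eqF.
exact: derivableZ.
Qed.
End Rademacher.

(** * Counting disjoint cells, and a criterion for null sets *)

Section NullCover.
Context {R : realType} {d : measure_display} {X : measurableType d}.
Variable mu : {measure set X -> \bar R}.
Implicit Types (N S E : set X).

Lemma measure_packing (I : eqType) (cell : I -> set X) (K : seq I) (B : set X) (v : R) :
  uniq K -> (forall i, measurable (cell i)) -> measurable B -> 0 <= v ->
  (forall i j, i != j -> cell i `&` cell j = set0) ->
  (forall i, i \in K -> cell i `<=` B /\ (v%:E <= mu (cell i))%E) ->
  ((v * (size K)%:R)%:E <= mu B)%E.
Proof.
move=> + mcell + v0 dis; elim: K B => [|k K IH] B /=.
  by move=> _ _ _; rewrite mulr0 measure_ge0.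
move=> /andP[kK uK] mB hK.
have [kB vk] := hK k (mem_head _ _).
have -> : mu B = (mu (cell k) + mu (B `\` cell k))%E.
  rewrite -measureU ?setDUK//; first exact: measurableD.
  by apply/seteqP; split=> // x [? []].
rewrite -natr1 mulrDr mulr1 addrC EFinD leeD//; apply: IH => //.
  exact: measurableD.
move=> i iK; have [iB vi] := hK i (@mem_behead _ (k :: K) i iK); split=> // x ix.
split; first exact: iB.
move=> kx; have ik : i != k by apply: contraNneq kK => <-.
by have : (cell i `&` cell k) x by []; rewrite dis.
Qed.

(** The integral of [r] over [N] is at most eps on each of [S1] and [S2], and at most |K| eps off
    [E], where K is an essential bound of [r]. Hence it is not positive, although [r] is positive on
    [N]. Two families are allowed for because the strips in the plane run over two axes. *)
Lemma measure0_of_covers N (r : X -> R) : measurable N -> (mu N < +oo)%E ->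
  Linf mu r -> (forall x, N x -> 0 < r x) ->
  (forall eps, 0 < eps -> exists S1 S2 E : set X,
    [/\ [/\ measurable S1, measurable S2 & measurable E],
        N `&` E `<=` S1 `|` S2, (mu (N `\` E) <= eps%:E)%E,
        \int[mu]_(x in N) (r x * \1_S1 x) <= eps &
        \int[mu]_(x in N) (r x * \1_S2 x) <= eps]) ->
  mu N = 0%E.
Proof.
move=> mN muN Lr r0 cov; have [mr [K rK]] := Lr.
have ir : mu.-integrable N (EFin \o r) by exact: Linf_integrable.
apply: (Rintegral_gt0_null mN ir r0).
suff small (eps : R) : 0 < eps -> \int[mu]_(x in N) r x <= (2 + `|K|) * eps.
  rewrite leNgt; apply/negP => i0.
  have c0 : 0 < 2 + `|K| by rewrite ltr_wpDr.
  have := small ((\int[mu]_(x in N) r x) / 2 / (2 + `|K|)).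
  rewrite !divr_gt0// => /(_ isT); rewrite mulrC divfK ?gt_eqF//; lra.
move=> eps0; have [S1 [S2 [E [[mS1 mS2 mE] sub muE h1 h2]]]] := cov eps eps0.
have L1 : Linf mu (fun x => r x * \1_S1 x) by apply: LinfM => //; exact: Linf_indic.
have L2 : Linf mu (fun x => r x * \1_S2 x) by apply: LinfM => //; exact: Linf_indic.
have L3 : Linf mu (fun x => `|K| * \1_(~` E) x).
  by apply: LinfM; [exact: Linf_cst|apply: Linf_indic; exact: measurableC].
have h3 : \int[mu]_(x in N) (`|K| * \1_(~` E) x) <= `|K| * eps.
  rewrite RintegralZl//; last first.
    by apply: Linf_integrable => //; apply: Linf_indic; exact: measurableC.
  rewrite ler_wpM2l// /Rintegral integral_indic//; last exact: measurableC.
  have fin : mu (~` E `&` N) \is a fin_num.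
    rewrite ge0_fin_numE//; apply: le_lt_trans muN; apply: le_measure;
      rewrite ?inE//; apply: measurableI => //; exact: measurableC.
  by rewrite -lee_fin fineK// setIC -setDE.
apply: (@le_trans _ _ (\int[mu]_(x in N) (r x * \1_S1 x) +
  \int[mu]_(x in N) (r x * \1_S2 x) + \int[mu]_(x in N) (`|K| * \1_(~` E) x))); last first.
  by rewrite mulrDl mulr_natl mulr2n !lerD.
have i1 := Linf_integrable mN muN L1; have i2 := Linf_integrable mN muN L2.
have i3 := Linf_integrable mN muN L3.
have i12 := Linf_integrable mN muN (LinfD L1 L2).
rewrite -RintegralD// -RintegralD//.
apply: ae_le_Rintegral => //.
  exact: (Linf_integrable mN muN (LinfD (LinfD L1 L2) L3)).
apply: filterS rK => x rxK Nx; have rx := r0 _ Nx.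
have pos (A : set X) : 0 <= r x * \1_A x by rewrite mulr_ge0// ltW.
have pos3 : 0 <= `|K| * \1_(~` E) x by rewrite mulr_ge0.
have [Ex|nEx] := pselect (E x).
  have [S1x|S2x] := sub _ (conj Nx Ex).
    by rewrite [X in X + _ + _](_ : _ = r x) ?(lerDl, ler_wpDr)// indicE mem_set// mulr1.
  rewrite [X in _ + X + _](_ : _ = r x); last by rewrite indicE mem_set// mulr1.
  by have := pos S1; move: pos3; set a := r x * _; set b := `|K| * _; lra.
rewrite [X in _ + _ + X](_ : _ = `|K|); last by rewrite indicE mem_set// mulr1.
rewrite ler_wpDl ?addr_ge0// (le_trans _ (ler_norm K))//.
by rewrite (le_trans _ rxK)// ler_norm.
Qed.

End NullCover.

Section IntegerRange.

(** With M = m (n+1) these indices enumerate the cells of mesh 1/(n+1) that tile the half-open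
    interval [-m, m[. *)
Definition zrange (M : nat) : seq int := [seq (Posz i - Posz M)%R | i <- iota 0 (M + M)].

Lemma zrange_uniq M : uniq (zrange M).
Proof. by rewrite map_inj_uniq ?iota_uniq// => i j /addIr []. Qed.

Lemma mem_zrange M (k : int) : (k \in zrange M) = (- M%:Z <= k < M%:Z).
Proof.
apply/mapP/andP => [[i]|[h1 h2]].
  by rewrite mem_iota add0n => /andP[_ iM] ->; split; lia.
exists (absz (k + M%:Z)); last by lia.
by rewrite mem_iota; lia.
Qed.

End IntegerRange.

(** * Sigma-finiteness, rates of combinations, transfer of null sets *)

Section Common.
Context {R : realType} {d : measure_display} {X : measurableType d}.
Variables (dist : X -> X -> R) (mu : {measure set X -> \bar R}).

Lemma radon_sigma_finite (x : X) : radon dist mu ->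
  (forall r, measurable [set y | dist x y < r]) -> sigma_finite setT mu.
Proof.
move=> hr mb; exists (fun n => [set y | dist x y < n%:R]).
  apply/esym; rewrite -subTset => y _; exists (Num.truncn (dist x y)).+1 => //=.
  exact: truncnS_gt.
by move=> n; split; [exact: mb|exact: hr].
Qed.

Lemma rate_comb (D1 D2 : (X -> R) -> X -> R) (a b : X -> R) (pi : X -> R) p :
  rate (fun f x => a x * D1 f x + b x * D2 f x) pi p =
  a p * rate D1 pi p + b p * rate D2 pi p.
Proof. by rewrite /rate; ring. Qed.

Lemma dominated_ae (nu : {measure set X -> \bar R}) (P : X -> Prop) :
  mu `<< nu -> {ae nu, forall x, P x} -> {ae mu, forall x, P x}.
Proof.
move=> /null_content_dominatesP dom [N [mN N0 sub]].
by exists N; split=> //; exact: dom.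
Qed.

Lemma measurable_zeros (f : X -> R) : measurable_fun setT f ->
  measurable [set x | f x = 0].
Proof.
by move=> mf; rewrite -[X in measurable X]setTI; exact: (mf measurableT [set 0]).
Qed.

End Common.

(* [lebesgue_measure] is a measure on [measurableTypeR R], whose display differs from
   that of the canonical measurable structure on [R]; the two have the same sets. *)
Section BorelLebesgue.
Context {R : realType}.

Definition lebesgue_borel : set R -> \bar R := @lebesgue_measure R.

Let lebesgue_borel0 : lebesgue_borel set0 = 0%E.
Proof. exact: (measure0 (@lebesgue_measure R)). Qed.

Let lebesgue_borel_ge0 A : (0 <= lebesgue_borel A)%E.
Proof. exact: (measure_ge0 (@lebesgue_measure R)). Qed.

Let lebesgue_borel_sigma : semi_sigma_additive lebesgue_borel.
Proof.
by move=> F mF tF mU;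
  exact: (@measure_semi_sigma_additive _ _ _ (@lebesgue_measure R) F mF tF mU).
Qed.

HB.instance Definition _ := isMeasure.Build _ R R lebesgue_borel
  lebesgue_borel0 lebesgue_borel_ge0 lebesgue_borel_sigma.

End BorelLebesgue.

(** * The case of the line *)

Section Line.
Context {R : realType}.
Local Notation leb := (@lebesgue_borel R).

Lemma dist1_ge0 (x y : R) : 0 <= dist1 x y. Proof. exact: normr_ge0. Qed.

Lemma lipschitz_measurable (f : R -> R) (C : R) :
  (forall x y, `|f x - f y| <= C * `|x - y|) -> measurable_fun setT f.
Proof.
move=> lf; apply: continuous_measurable_fun => x.
apply/cvgrPdist_le => e e0; have K0 : 0 < `|C| + 1 by rewrite ltr_wpDl.
exists (e / (`|C| + 1)); first by rewrite /= divr_gt0.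
move=> y /= xy; rewrite (le_trans (lf _ _))//.
apply: (@le_trans _ _ ((`|C| + 1) * `|x - y|)).
  by rewrite ler_wpM2r// (le_trans (ler_norm C))// lerDl.
by rewrite mulrC -ler_pdivlMr// ltW.
Qed.

Lemma coordinate_line : coordinate (@dist1 R) id (fun _ c => c).
Proof. by split=> // *; rewrite /dist1 ?subrr ?normr0 ?mul1r. Qed.

Lemma measurable_grid_cell (n : nat) (k : int) :
  measurable [set x : R | Num.floor (x * n.+1%:R) = k].
Proof.
have := @measurable_cell _ _ _ _ lipschitz_measurable _ _ coordinate_line n k.
exact.
Qed.

Lemma grid_cellE (n : nat) (k : int) : [set x : R | Num.floor (x * n.+1%:R) = k] =
  `[k%:~R / n.+1%:R, (k + 1)%:~R / n.+1%:R[%classic.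
Proof.
apply/seteqP; split=> x /=; rewrite in_itv/= ler_pdivrMr// ltr_pdivlMr//.
  by move=> <-; rewrite floor_le/= floorD1_gt.
by move=> h; exact: floor_def.
Qed.

Lemma lebesgue_grid_cell (n : nat) (k : int) :
  leb [set x : R | Num.floor (x * n.+1%:R) = k] = (n.+1%:R^-1)%:E.
Proof.
rewrite grid_cellE /lebesgue_borel lebesgue_measure_itv/= lte_fin ltr_pM2r ?invr_gt0// ltr_int.
by rewrite ltrDl ltr01 -EFinB -mulrBl intrD addrAC subrr add0r mul1r.
Qed.

Lemma floor_grid_point (n : nat) (k : int) :
  Num.floor (k%:~R / n.+1%:R * n.+1%:R : R) = k.
Proof. by rewrite divfK ?pnatr_eq0// intrKfloor. Qed.

Let intr_muln (m n : nat) : ((m * n)%N%:Z)%:~R = m%:R * n%:R :> R.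
Proof. by rewrite -natrM. Qed.

Lemma floor_zrange (m n : nat) (x : R) : - m%:R <= x < m%:R ->
  Num.floor (x * n.+1%:R) \in zrange (m * n.+1).
Proof.
move=> /andP[h1 h2]; rewrite mem_zrange floor_ge_int -(ltr_int R) mulrNz.
rewrite intr_muln.
rewrite -mulNr ler_wpM2r//= (le_lt_trans (floor_le _))//.
by rewrite ltr_pM2r.
Qed.

Lemma zrange_floor (m n : nat) (x : R) :
  Num.floor (x * n.+1%:R) \in zrange (m * n.+1) -> - m%:R <= x < m%:R.
Proof.
rewrite mem_zrange => /andP[h1 h2]; move: h1; rewrite floor_ge_int mulrNz.
rewrite intr_muln.
rewrite -mulNr ler_pM2r// => ->/=.
have : (Num.floor (x * n.+1%:R) + 1 <= (m * n.+1)%N%:Z) by rewrite lezD1.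
rewrite -(ler_int R) => /(lt_le_trans (floorD1_gt _)).
by rewrite intr_muln ltr_pM2r.
Qed.

Section LineMeasure.
Variable mu : {measure set R -> \bar R}.
Hypothesis mu_radon : radon dist1 mu.

Lemma sigma_finite_line : sigma_finite setT mu.
Proof.
have mb (r : R) : measurable [set y | dist1 0 y < r] by exact: (measurable_ball (0 : R) r).
exact: radon_sigma_finite mu_radon mb.
Qed.

Let sf := sigma_finite_line.

Lemma kills_transverse_line D f : derivation dist1 mu D ->
  kills_transverse mu D (fun _ c => c) f.
Proof. by move=> hD c; have := derivation_cst dist1_ge0 (f c) hD. Qed.

(** The indicator of the zero set of the rate, times [D], is a derivation with zero rate, hence
    zero; independence then forces this indicator to vanish almost everywhere. *)
Lemma rate_neq0_line (delta : 'I_1 -> (R -> R) -> R -> R) :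
  (forall i, derivation dist1 mu (delta i)) -> lin_indep dist1 mu delta ->
  {ae mu, forall x, rate (delta ord0) id x != 0}.
Proof.
move=> hd ind; set D := delta ord0; have hD : derivation dist1 mu D := hd ord0.
have [mr _] := Linf_rate lipschitz_measurable coordinate_line hD.
pose Z := [set x | rate D id x = 0].
have LZ : Linf mu (\1_Z : R -> R) by apply: Linf_indic; exact: measurable_zeros.
(* The second summand, with coefficient 0, only pads a single product to the two-term form of
   [derivation_comb]. *)
have hZ := derivation_comb hD hD LZ (Linf_cst mu 0).
have rZ : {ae mu, forall x, rate (fun f x => \1_Z x * D f x + 0 * D f x) id x = 0}.
  apply: aeW => x; rewrite (rate_comb D D \1_Z (fun=> 0)) mul0r addr0 indicE.
  by have [/set_mem ->|] := boolP (x \in Z); rewrite ?mulr0// mul0r.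
have := ind (fun=> \1_Z) (fun=> LZ) _ ord0.
have kill f : lipb dist1 f ->
    {ae mu, forall x, \sum_(i < 1) \1_Z x * delta i f x = 0}.
  move=> lf; have := derivation_rate0 dist1_ge0 lipschitz_measurable sf
    coordinate_line hZ rZ lf (kills_transverse_line f hZ).
  by apply: filterS => x; rewrite big_ord1 mul0r addr0.
move=> /(_ kill); apply: filterS => x + ; apply: contra_eq_neq => rx.
by rewrite indicE mem_set//= oner_neq0.
Qed.

(** The cells themselves are the strips, the graphs being constants. Their total width is at most
    the Lebesgue measure of [E] inside [Q], which is at most [eta]. *)
Lemma null_of_rate_line D (m : nat) (N : set R) : derivation dist1 mu D ->
  {ae mu, forall x, 0 <= rate D id x} -> (forall x, N x -> 0 < rate D id x) ->
  measurable N -> N `<=` `[- m%:R, m%:R[%classic -> leb N = 0%E -> mu N = 0%E.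
Proof.
move=> hD r0 Npos mN NQ N0; set Q := `[- m%:R, m%:R[%classic in NQ.
have mQ : measurable Q by exact: measurable_itv.
have muQ : (mu Q < +oo)%E.
  apply: le_lt_trans (mu_radon 0 (m%:R + 1)); apply: le_measure; rewrite ?inE//.
    exact: (measurable_ball (0 : R) (m%:R + 1)).
  move=> x; rewrite /Q /= in_itv/= /dist1 sub0r normrN => /andP[h1 h2].
  by rewrite ltr_norml; apply/andP; split; lra.
have muN : (mu N < +oo)%E by apply: le_lt_trans muQ; apply: le_measure; rewrite ?inE.
have lebQ : (leb Q < +oo)%E.
  by rewrite /lebesgue_borel lebesgue_measure_itv/=; case: ifP => _; rewrite -?EFinB ltry.
have LR := Linf_rate lipschitz_measurable coordinate_line hD.
apply: (measure0_of_covers mN muN LR Npos) => eps eps0.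
have NM x : N x -> `|id x| <= m%:R.
  by move=> /NQ; rewrite /Q /= in_itv/= => /andP[h1 /ltW h2]; rewrite ler_norml h1.
have [eta eta0 hstrip] := rate_strips_small dist1_ge0 lipschitz_measurable sf
  coordinate_line hD (fun f _ => kills_transverse_line f hD) r0 mN muN NM (lexx 1) eps0.
have e0 : 0 < Num.min eps eta by rewrite lt_min eps0.
have [E [mE [[//|n] _ Esat]] [h1 h2]] := @grid_approximation _ _ _ _
  (fun n x y => @esym _ _ _) (@same_cell_mul R) (@measurable_saturated1 R) mu leb
  Q N _ mQ muQ lebQ mN N0 e0.
(* By saturation the left endpoint of a cell decides whether the whole cell lies in [E]. *)
pose K := [seq k <- zrange (m * n.+1) | `[< E (k%:~R / n.+1%:R : R) >]].
pose g (i : nat) (_ : R) : R := (nth 0 K i)%:~R / n.+1%:R.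
have gL i : transverse_lip dist1 (fun _ c => c) 1 (g i).
  by split=> // p q; rewrite subrr normr0 mul1r dist1_ge0.
have szK : n.+1%:R^-1 * (size K)%:R <= eta.
  rewrite -lee_fin; apply: (@le_trans _ _ (leb (E `&` Q))); last first.
    by apply: le_trans h2 _; rewrite lee_fin ge_min lexx orbT.
  apply: (@measure_packing _ _ _ leb _
    (fun k : int => [set x : R | Num.floor (x * n.+1%:R) = k])) => //.
  - by rewrite filter_uniq// zrange_uniq.
  - by move=> k; exact: measurable_grid_cell.
  - exact: measurableI.
  - by move=> i j ij; apply/seteqP; split=> // x [/= -> /eqP]; rewrite (negbTE ij).
  - move=> k; rewrite mem_filter => /andP[/asboolP Ek kr]; split; last first.
      by rewrite le_eqVlt; apply/orP; left; apply/eqP/esym; exact: lebesgue_grid_cell.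
    move=> x /= xk; split.
      by apply: Esat Ek; rewrite /same_cell floor_grid_point xk.
    by rewrite /Q /= in_itv/=; apply: (@zrange_floor _ n); rewrite xk.
have mS : measurable (strips id n.+1%:R^-1 g (size K)).
  exact: (measurable_strips lipschitz_measurable coordinate_line _ gL).
exists (strips id n.+1%:R^-1 g (size K)), set0, E; split=> //.
- move=> x [Nx Ex]; left; have := NQ _ Nx; rewrite /Q /= in_itv/= => xm.
  pose k := Num.floor (x * n.+1%:R).
  have kK : k \in K.
    rewrite mem_filter floor_zrange// andbT; apply/asboolP; apply: Esat Ex.
    by rewrite /same_cell floor_grid_point.
  exists (index k K); first by rewrite index_mem.
  rewrite /g nth_index//.
  have : [set y : R | Num.floor (y * n.+1%:R) = k] x by [].
  rewrite grid_cellE /= in_itv/= => /andP[-> /ltW] /=.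
  by rewrite intrD mulrDl mul1r.
- rewrite (_ : N `\` E = (N `\` E) `&` Q).
    by apply: le_trans h1 _; rewrite lee_fin ge_min lexx.
  by apply/seteqP; split=> [x [Nx Ex]|x []//]; split=> //; exact: NQ.
- by apply: hstrip => //; rewrite invr_ge0.
- rewrite (_ : (fun x => _) = fun=> 0).
    by rewrite /Rintegral integral0 /= ltW.
  by apply/funext => x; rewrite indicE in_set0 mulr0.
Qed.

Lemma absolute_continuity_line (delta : 'I_1 -> (R -> R) -> R -> R) :
  (forall i, derivation dist1 mu (delta i)) -> lin_indep dist1 mu delta ->
  mu `<< leb.
Proof.
move=> hd ind; have nz := rate_neq0_line hd ind.
set D := delta ord0 in nz; have hD : derivation dist1 mu D := hd ord0.
have LR := Linf_rate lipschitz_measurable coordinate_line hD.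
(* Multiplying [D] by its own rate squares the rate: it becomes nonnegative everywhere and positive
   off its zero set. *)
have hD2 := derivation_comb hD hD LR (Linf_cst mu 0).
set D2 := (fun f x => _) in hD2.
have rE x : rate D2 id x = rate D id x * rate D id x.
  by rewrite (rate_comb D D (rate D id) (fun=> 0)) mul0r addr0.
apply/null_content_dominatesP => A mA A0.
pose N (m : nat) := A `&` `[- m%:R, m%:R[%classic `&` ~` [set x | rate D id x = 0].
have mZ : measurable (~` [set x | rate D id x = 0]).
  by apply: measurableC; apply: measurable_zeros; case: LR.
have mN m : measurable (N m).
  by apply: measurableI => //; apply: measurableI => //; exact: measurable_itv.
have N0 m : mu (N m) = 0%E.
  apply: (@null_of_rate_line D2 m) => //.
  - by apply: aeW => x; rewrite rE -expr2 sqr_ge0.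
  - by move=> x [_ /= rx]; rewrite rE -expr2 lt0r sqr_ge0 andbT sqrf_eq0; apply/eqP.
  - by move=> x [[]].
  - apply/eqP; rewrite -measure_le0 -A0; apply: le_measure; rewrite ?inE//.
    by move=> x [[]].
have negN : mu.-negligible (\bigcup_m N m).
  by apply: negligible_bigcup => m; exists (N m); split.
have negA : mu.-negligible A.
  apply: negligibleS (negligibleU negN nz) => x Ax.
  have [rx|rx] := pselect (rate D id x = 0); first by right; rewrite /= rx eqxx.
  left; exists (Num.truncn `|x|).+1 => //; split=> //; split=> //=.
  have := truncnS_gt `|x|; rewrite in_itv/= ltr_norml => /andP[/ltW -> ->] //.
by have [B [mB B0 AB]] := negA; apply/eqP; rewrite -measure_le0 -B0 le_measure ?inE.
Qed.

Lemma derivation_formula_line D : mu `<< leb -> derivation dist1 mu D ->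
  forall f, lipb dist1 f ->
  {ae mu, forall x, D f x = rate D id x * derive1 f x}.
Proof.
move=> ac hD f lf; have [C [_ lf2]] := lf.
have df := dominated_ae ac (lipschitz_derivable_ae lf2).
exact: (derivation_chain dist1_ge0 lipschitz_measurable sf coordinate_line hD lf
  (kills_transverse_line f hD) df).
Qed.

End LineMeasure.
End Line.

(** * Derivability through countably many difference quotients *)

Section DifferenceQuotients.
Context {R : realType}.
Implicit Types (phi : R -> R) (x h : R).

Definition quotient phi x h := h^-1 * (phi (x + h) - phi x).

Lemma quotient_lip_near phi x h (e : R) : continuous phi -> h != 0 -> 0 < e ->
  \forall h' \near h, `|quotient phi x h - quotient phi x h'| < e.
Proof.
move=> cphi h0 e0.
have : quotient phi x h' @[h' --> h] --> quotient phi x h.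
  apply: cvgM; first by apply: cvgV => //; exact: cvg_id.
  apply: cvgB; last exact: cvg_cst.
  apply: continuous_cvg; first exact: cphi.
  by apply: cvgD; [exact: cvg_cst|exact: cvg_id].
by move/cvgrPdist_lt; apply.
Qed.

Lemma rat_near h (r : R) : 0 < `|h| < r -> forall P : set R,
  (\forall h' \near h, P h') -> exists q : rat, 0 < `|ratr q : R| < r /\ P (ratr q).
Proof.
move=> /andP[h0 hr] P nP.
have : \forall h' \near h, P h' /\ 0 < `|h'| < r.
  have cn : `|h'| @[h' --> h] --> `|h| by apply: cvg_norm; exact: cvg_id.
  near=> h'; split; first by near: h'.
  apply/andP; split; near: h'; first exact: (cvgr_gt _ cn).
  exact: (cvgr_lt _ cn).
move=> [e /= e0 ne].
have [q] : exists q : rat, ratr q \in `](h - e), (h + e)[.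
  by apply/rat_in_itvoo; lra.
rewrite in_itv/= => /andP[q1 q2]; have [|Pq hq] := ne (ratr q).
  by rewrite /= ltr_norml; apply/andP; split; lra.
by exists q.
Unshelve. all: by end_near. Qed.

(* Only countably many increments are quantified over, so that the condition is
   measurable in a parameter. *)
Definition rational_cauchy phi x := forall k : nat, exists m : nat,
  forall q q' : rat, 0 < `|ratr q : R| < m.+1%:R^-1 ->
    0 < `|ratr q' : R| < m.+1%:R^-1 ->
  `|quotient phi x (ratr q) - quotient phi x (ratr q')| <= k.+1%:R^-1.

Lemma derivable_quotient phi x :
  derivable phi x 1 <-> cvg (quotient phi x h @[h --> 0^']).
Proof.
have E : (fun h : R => h^-1 *: ((phi \o shift x) (h *: (1 : R)) - phi x)) =
    quotient phi x.
  by apply/funext => h; rewrite /quotient /= /GRing.scale /= mulr1 (addrC h).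
by rewrite /derivable E.
Qed.

(** For continuous [phi] the quotient is continuous in the non-zero increment, so any two small
    increments can be replaced by rational ones at a cost of e/4 each; the Cauchy condition for
    rationals uses up the other e/2. *)
Lemma derivable_rational_cauchy phi x : continuous phi ->
  derivable phi x 1 <-> rational_cauchy phi x.
Proof.
move=> cphi; rewrite derivable_quotient; split.
  move=> /cvg_ex[l cl] k.
  have e0 : 0 < k.+1%:R^-1 / 2 :> R by rewrite divr_gt0// invr_gt0.
  move/cvgrPdist_le : cl => /(_ _ e0)[r /= r0 hr].
  have [m _ mr] : \forall m \near \oo, `|@harmonic R m| < r.
    have : harmonic n @[n --> \oo] --> (0 : R) by exact: cvg_harmonic.
    by move/cvgr0Pnorm_lt; apply.
  have {}mr : m.+1%:R^-1 < r.
    by have := mr m (leqnn m); rewrite /harmonic/= ger0_norm.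
  exists m => q q' /andP[q0 qm] /andP[q'0 q'm].
  have hq (u : rat) : 0 < `|ratr u : R| -> `|ratr u : R| < m.+1%:R^-1 ->
      `|l - quotient phi x (ratr u)| <= k.+1%:R^-1 / 2.
    move=> u0 um; apply: hr; last by rewrite -normr_gt0.
    by rewrite /= sub0r normrN (lt_trans um).
  have -> : quotient phi x (ratr q) - quotient phi x (ratr q') =
    (l - quotient phi x (ratr q')) - (l - quotient phi x (ratr q)) by ring.
  rewrite (le_trans (ler_normB _ _))// [leRHS]splitr lerD//; exact: hq.
move=> rc; apply/cauchy_cvgP; apply: cauchy_exP => e e0.
have [k _ ke] : \forall k \near \oo, `|@harmonic R k| < e / 2.
  have : harmonic n @[n --> \oo] --> (0 : R) by exact: cvg_harmonic.
  by move/cvgr0Pnorm_lt; apply; rewrite divr_gt0.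
have {}ke : k.+1%:R^-1 < e / 2.
  by have := ke k (leqnn k); rewrite /harmonic/= ger0_norm.
have [m hm] := rc k.
have close h h' : 0 < `|h| < m.+1%:R^-1 -> 0 < `|h'| < m.+1%:R^-1 ->
    `|quotient phi x h - quotient phi x h'| < e.
  move=> hh hh'.
  have h0 : h != 0 by rewrite -normr_gt0; case/andP: hh.
  have h'0 : h' != 0 by rewrite -normr_gt0; case/andP: hh'.
  have e4 : 0 < e / 4 by rewrite divr_gt0.
  have [q [qm nq]] := rat_near hh (quotient_lip_near x cphi h0 e4).
  have [q' [q'm nq']] := rat_near hh' (quotient_lip_near x cphi h'0 e4).
  have := hm q q' qm q'm.
  move: nq nq'; rewrite [X in _ -> X < _ -> _]distrC.
  set a := quotient phi x h; set b := quotient phi x h'.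
  set c := quotient phi x (ratr q); set c' := quotient phi x (ratr q').
  move=> h1 h2 h3; have -> : a - b = (a - c) + (c - c') + (c' - b) by ring.
  have := ler_normD ((a - c) + (c - c')) (c' - b).
  have := ler_normD (a - c) (c - c'); move: ke; set u := _^-1 in h3 *; lra.
pose h0 : R := m.+1%:R^-1 / 2.
have h00 : 0 < `|h0| < m.+1%:R^-1.
  have m0 : 0 < m.+1%:R^-1 :> R by rewrite invr_gt0.
  by rewrite /h0 ger0_norm ?divr_ge0 ?(ltW m0)//; move: m0; set u := _^-1; lra.
exists (quotient phi x h0); exists m.+1%:R^-1; first by rewrite /= invr_gt0.
move=> h /=; rewrite sub0r normrN => hlt h_neq0; apply: close => //.
by rewrite hlt normr_gt0 h_neq0.
Qed.

End DifferenceQuotients.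

(** * Measurability of the set where a partial derivative exists *)

Section DerivabilitySet.
Context {R : realType} {d : measure_display} {X : measurableType d}.
Variable dist : X -> X -> R.
Hypothesis dist_ge0 : forall x y, 0 <= dist x y.
Hypothesis lip_measurable : forall (f : X -> R) (C : R),
  (forall x y, `|f x - f y| <= C * dist x y) -> measurable_fun setT f.
Variables (pi : X -> R) (mv : X -> R -> X).
Hypothesis hpi : coordinate dist pi mv.

Lemma measurable_forall_countable (I : countType) (P : I -> set X) :
  (forall i, measurable (P i)) -> measurable [set x | forall i, P i x].
Proof.
move=> mP; rewrite (_ : [set x | _] = ~` (\bigcup_i ~` P i)).
  apply: measurableC; apply: countable_bigcupT_measurable => // i.
  exact: measurableC.
apply/seteqP; split=> [x h [i _ nP]|x /= nP i]; first exact/nP/h.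
by apply: contrapT => nPi; apply: nP; exists i.
Qed.

Lemma measurable_exists_countable (I : countType) (P : I -> set X) :
  (forall i, measurable (P i)) -> measurable [set x | exists i, P i x].
Proof.
move=> mP; rewrite (_ : [set x | _] = \bigcup_i P i).
  exact: countable_bigcupT_measurable.
by apply/seteqP; split=> [x [i Pi]|x [i _ Pi]]; exists i.
Qed.

Lemma measurable_imply (A : Prop) (S : set X) :
  measurable S -> measurable [set x | A -> S x].
Proof.
move=> mS; have [a|na] := pselect A.
  rewrite (_ : [set x | _] = S)//; apply/seteqP; split=> x //=; exact.
by rewrite (_ : [set x | _] = setT)//; apply/seteqP; split=> // x _ /na.
Qed.

(** The exceptional set of a partial derivative is known to be null on each line; its measurability
    is what lets these null sections make a null set in the plane. *)
Lemma measurable_derivability_set (f : X -> R) (C : R) :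
  (forall x y, `|f x - f y| <= C * dist x y) ->
  measurable [set p | derivable (fun t => f (mv p t)) (pi p) 1].
Proof.
move=> lf.
have lmv p a b : `|f (mv p a) - f (mv p b)| <= `|C| * `|a - b|.
  rewrite (le_trans (lf _ _))// (@le_trans _ _ (`|C| * dist (mv p a) (mv p b)))//.
    by rewrite ler_wpM2r// ler_norm.
  by rewrite ler_wpM2l// (coord_lipr hpi).
have cf p : continuous (fun t => f (mv p t)).
  move=> x; apply/cvgrPdist_le => e e0; have K0 : 0 < `|C| + 1 by rewrite ltr_wpDl.
  exists (e / (`|C| + 1)); first by rewrite /= divr_gt0.
  move=> y /= xy; rewrite (le_trans (lmv _ _ _))//.
  apply: (@le_trans _ _ ((`|C| + 1) * `|x - y|)); first by rewrite ler_wpM2r// lerDl.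
  by rewrite mulrC -ler_pdivlMr// ltW.
have mq (h : R) : measurable_fun setT (fun p => quotient (fun t => f (mv p t)) (pi p) h).
  apply: measurable_funM => //; apply: measurable_funB; last first.
    by under eq_fun do rewrite (coord_id hpi); exact: lip_measurable lf.
  (* Shifting a point by the fixed amount [h] along its fibre keeps [f] Lipschitz in the point: one
     constant for the transverse move, one for the move along [pi]. *)
  apply: (@lip_measurable _ (`|C| + `|C|)) => p q.
  have -> : f (mv p (pi p + h)) - f (mv q (pi q + h)) =
    (f (mv p (pi p + h)) - f (mv q (pi p + h))) +
    (f (mv q (pi p + h)) - f (mv q (pi q + h))) by ring.
  rewrite (le_trans (ler_normD _ _))// mulrDl lerD//.
    rewrite (le_trans (lf _ _))// (le_trans (ler_wpM2r _ (ler_norm C)))//.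
    by rewrite ler_wpM2l// (coord_lipl hpi).
  rewrite (le_trans (lmv _ _ _))// ler_wpM2l// -[leRHS]mul1r.
  rewrite (_ : pi p + h - (pi q + h) = pi p - pi q); first exact: (coord_lip hpi).
  by ring.
rewrite (_ : [set p | _] =
    [set p | rational_cauchy (fun t => f (mv p t)) (pi p)]); last first.
  by apply/seteqP; split=> p /=; rewrite derivable_rational_cauchy.
apply: measurable_forall_countable => k; apply: measurable_exists_countable => m.
apply: measurable_forall_countable => q; apply: measurable_forall_countable => q'.
do 2 apply: measurable_imply.
rewrite [X in measurable X](_ : _ = (fun p => quotient (fun t => f (mv p t)) (pi p) (ratr q) -
   quotient (fun t => f (mv p t)) (pi p) (ratr q')) @^-1`
   [set` `[- k.+1%:R^-1, k.+1%:R^-1] ]).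
  rewrite -[X in measurable X]setTI; apply: measurable_funB => //.
by apply/seteqP; split=> p /=; rewrite in_itv/= -ler_norml.
Qed.

End DerivabilitySet.

(** * Geometry and Lebesgue measure of the plane; partial derivatives almost everywhere *)

Section Plane.
Context {R : realType}.
Local Notation leb := (@lebesgue_measure R).
Local Notation plane := (R * R)%type.
Local Notation leb2 := (@lebesgue2 R).

Lemma dist2_ge0 (p q : plane) : 0 <= dist2 p q.
Proof. exact: sqrtr_ge0. Qed.

Lemma dist2_fst (p q : plane) : `|p.1 - q.1| <= 1 * dist2 p q.
Proof. by rewrite mul1r -sqrtr_sqr ler_wsqrtr// lerDl sqr_ge0. Qed.

Lemma dist2_snd (p q : plane) : `|p.2 - q.2| <= 1 * dist2 p q.
Proof. by rewrite mul1r -sqrtr_sqr ler_wsqrtr// lerDr sqr_ge0. Qed.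

Lemma dist2_hor (a b y : R) : dist2 (a, y) (b, y) = `|a - b|.
Proof. by rewrite /dist2 /= subrr expr0n addr0 sqrtr_sqr. Qed.

Lemma dist2_ver (x a b : R) : dist2 (x, a) (x, b) = `|a - b|.
Proof. by rewrite /dist2 /= subrr expr0n add0r sqrtr_sqr. Qed.

(** For the product sigma-algebra, [f] is the pointwise limit of functions that see the first
    coordinate only through its grid cell; these are glued from countably many measurable functions
    of the second coordinate. *)
Lemma lipschitz_measurable2 (f : plane -> R) (C : R) :
  (forall p q, `|f p - f q| <= C * dist2 p q) -> measurable_fun setT f.
Proof.
move=> lf; pose k n (p : plane) := Num.floor (p.1 * n.+1%:R).
pose h n p := f ((k n p)%:~R / n.+1%:R, p.2).
apply: (measurable_fun_cvg (h := h)) => [n|p _].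
  apply: (@measurable_fun_glue _ _ _ (k n) (fun i p => f (i%:~R / n.+1%:R, p.2))).
    move=> i; rewrite (_ : [set p | _] =
        fst @^-1` [set x : R | Num.floor (x * n.+1%:R) = i])//.
    rewrite -[X in measurable X]setTI; apply: measurable_fst => //.
    exact: measurable_grid_cell.
  move=> i; apply: (measurableT_comp (f := fun y => f (i%:~R / n.+1%:R, y))).
    by apply: (@lipschitz_measurable _ _ C) => x y; rewrite (le_trans (lf _ _))// dist2_ver.
  exact: measurable_snd.
have C0 : 0 <= C.
  have := lf (1, 0) (0, 0); rewrite dist2_hor subr0 normr1 mulr1; exact: le_trans.
apply/cvgrPdist_le => e e0.
have : C * harmonic n @[n --> \oo] --> C * (0 : R).
  by apply: cvgMr; exact: cvg_harmonic.
rewrite mulr0 => /cvgr0Pnorm_le/(_ e e0); apply: filterS => n; apply: le_trans.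
rewrite (le_trans _ (ler_norm _))// /h {1}(surjective_pairing p).
rewrite (le_trans (lf _ _))// dist2_hor ler_wpM2l//.
have l1 := grid_lo_le n p.1; have l2 := grid_hi_gt n p.1.
rewrite -/(grid_lo n p.1) ger0_norm ?subr_ge0// lerBlDl -grid_hiE; exact: ltW.
Qed.

Lemma coordinate_fst : coordinate (@dist2 R) fst (fun p c => (c, p.2)).
Proof.
split=> //=; first exact: dist2_fst.
- by case.
- by move=> p q c; rewrite dist2_ver (le_trans (dist2_snd p q))// mul1r.
- by move=> p a b; rewrite dist2_hor.
Qed.

Lemma coordinate_snd : coordinate (@dist2 R) snd (fun p c => (p.1, c)).
Proof.
split=> //=; first exact: dist2_snd.
- by case.
- by move=> p q c; rewrite dist2_hor (le_trans (dist2_fst p q))// mul1r.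
- by move=> p a b; rewrite dist2_ver.
Qed.

Lemma measurable_disc (r : R) : measurable [set p : plane | dist2 (0, 0) p < r].
Proof.
have [r0|r0] := ltP 0 r; last first.
  rewrite (_ : [set p | _] = set0)//; apply/seteqP; split=> // p /= h.
  by move: (le_lt_trans (dist2_ge0 _ _) h); rewrite ltNge r0.
rewrite (_ : [set p | _] =
    (fun p : plane => p.1 ^+ 2 + p.2 ^+ 2) @^-1` `]-oo, r ^+ 2[%classic).
  rewrite -[X in measurable X]setTI.
  apply: (measurable_funD (f := fun p : plane => p.1 ^+ 2) (g := fun p => p.2 ^+ 2)) => //.
    by apply: measurable_funX; exact: measurable_fst.
  by apply: measurable_funX; exact: measurable_snd.
have key (s : R) : (Num.sqrt s < r) = (s < r ^+ 2).
  rewrite -[X in Num.sqrt _ < X](ger0_norm (ltW r0)) -sqrtr_sqr.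
  by rewrite ltr_sqrt// exprn_gt0.
by apply/seteqP; split=> p /=; rewrite in_itv/= /dist2 /= !sub0r !sqrrN key.
Qed.

Lemma lebesgue2_rectangle (A B : set R) : measurable A -> measurable B ->
  leb2 (A `*` B) = (leb A * leb B)%E.
Proof. by move=> mA mB; exact: product_measure1E. Qed.

Let lebesgue2_0 : leb2 set0 = 0%E.
Proof. exact: (measure0 (leb \x leb)%E). Qed.

Let lebesgue2_ge0 A : (0 <= leb2 A)%E.
Proof. exact: (measure_ge0 (leb \x leb)%E). Qed.

Let lebesgue2_sigma : semi_sigma_additive leb2.
Proof.
by move=> F mF tF mU;
  exact: (@measure_semi_sigma_additive _ _ _ (leb \x leb)%E F mF tF mU).
Qed.

HB.instance Definition _ := isMeasure.Build _ plane R leb2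
  lebesgue2_0 lebesgue2_ge0 lebesgue2_sigma.

Definition lebesgue2_borel : {measure set plane -> \bar R} := leb2.

Lemma lebesgue2_null_xsection (A : set plane) : measurable A ->
  (forall x, leb (xsection A x) = 0%E) -> leb2 A = 0%E.
Proof.
move=> mA A0; rewrite /lebesgue2 /product_measure1 (eq_integral (cst 0%E)).
  by rewrite integral_cst// mul0e.
by move=> x _; exact: A0.
Qed.

Lemma lebesgue2_null_ysection (A : set plane) : measurable A ->
  (forall y, leb (ysection A y) = 0%E) -> leb2 A = 0%E.
Proof.
move=> mA A0; have -> : leb2 A = (\int[leb]_y leb (ysection A y))%E.
  (* Integrating in the other order gives a measure with the same values on rectangles, hence the
     same measure. *)
  apply: (@product_measure_unique _ _ _ _ R leb leb (leb \x^ leb)%E) => // B C mB mC.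
  exact: (@product_measure2E _ _ _ _ R leb leb B C mB mC).
rewrite (eq_integral (cst 0%E)); first by rewrite integral_cst// mul0e.
by move=> x _; exact: A0.
Qed.

(** One-dimensional differentiability on every horizontal line, respectively every vertical line,
    makes the exceptional sets null section by section. *)
Lemma lipschitz_partial_derivable (f : plane -> R) (C : R) :
  (forall p q, `|f p - f q| <= C * dist2 p q) ->
  {ae lebesgue2_borel, forall p, derivable (fun t => f (t, p.2)) p.1 1 /\
                      derivable (fun t => f (p.1, t)) p.2 1}.
Proof.
move=> lf.
have m1 := measurable_derivability_set dist2_ge0 lipschitz_measurable2 coordinate_fst lf.
have m2 := measurable_derivability_set dist2_ge0 lipschitz_measurable2 coordinate_snd lf.
have mC1 := measurableC m1; have mC2 := measurableC m2.
have null (A : set R) : leb.-negligible (~` A) -> measurable A -> leb (~` A) = 0%E.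
  move=> [N [mN N0 AN]] mA; apply/eqP; rewrite -measure_le0 -N0.
  by apply: le_measure; rewrite ?inE//; exact: measurableC.
have a1 : {ae lebesgue2_borel, forall p, derivable (fun t => f (t, p.2)) p.1 1}.
  exists (~` [set p : plane | derivable (fun t => f (t, p.2)) p.1 1]);
    split; [exact: mC1| |exact: subset_refl].
  apply: lebesgue2_null_ysection; first exact: mC1.
  move=> y; rewrite (_ : ysection _ y = ~` [set x | derivable (fun t => f (t, y)) x 1]).
    apply: null; first apply: (@lipschitz_derivable_ae _ _ C) => a b.
      by rewrite (le_trans (lf _ _))// dist2_hor.
    have := measurable_ysection y m1.
    by rewrite (_ : ysection _ y = [set x | derivable (fun t => f (t, y)) x 1])//;
      apply/seteqP; split=> x; [move/set_mem|move=> h; apply/mem_set].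
  by apply/seteqP; split=> x; [move/set_mem|move=> h; apply/mem_set].
have a2 : {ae lebesgue2_borel, forall p, derivable (fun t => f (p.1, t)) p.2 1}.
  exists (~` [set p : plane | derivable (fun t => f (p.1, t)) p.2 1]);
    split; [exact: mC2| |exact: subset_refl].
  apply: lebesgue2_null_xsection; first exact: mC2.
  move=> x; rewrite (_ : xsection _ x = ~` [set y | derivable (fun t => f (x, t)) y 1]).
    apply: null; first apply: (@lipschitz_derivable_ae _ _ C) => a b.
      by rewrite (le_trans (lf _ _))// dist2_ver.
    have := measurable_xsection x m2.
    by rewrite (_ : xsection _ x = [set y | derivable (fun t => f (x, t)) y 1])//;
      apply/seteqP; split=> y; [move/set_mem|move=> h; apply/mem_set].
  by apply/seteqP; split=> y; [move/set_mem|move=> h; apply/mem_set].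
by apply: filterS2 a1 a2.
Qed.

End Plane.

(** * The case of the plane *)

Section PlaneMeasure.
Context {R : realType}.
Local Notation plane := (R * R)%type.
Local Notation leb2 := (@lebesgue2_borel R).
Local Notation hor := (fun (p : plane) (c : R) => (c, p.2)).
Local Notation ver := (fun (p : plane) (c : R) => (p.1, c)).
Variable mu : {measure set plane -> \bar R}.
Hypothesis mu_radon : radon dist2 mu.

Lemma sigma_finite_plane : sigma_finite setT mu.
Proof. exact: radon_sigma_finite mu_radon (@measurable_disc R). Qed.

Let sf := sigma_finite_plane.
Let dge := @dist2_ge0 R.
Let lm := @lipschitz_measurable2 R.

(** Freezing the first coordinate leaves a function of the second one, and freezing that as well
    leaves a constant; so [derivation_rate0] along the second axis applies. *)
Lemma kills_transverse_hor D f : derivation dist2 mu D ->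
  {ae mu, forall p, rate D snd p = 0} -> lipb dist2 f ->
  kills_transverse mu D hor f.
Proof.
move=> hD r0 [C lf] c.
apply: (derivation_rate0 dge lm sf coordinate_snd hD r0).
  by exists C; exact: (lip_bounded_by_mv coordinate_fst c lf).
by move=> c'; have := derivation_cst dge (f (c, c')) hD.
Qed.

Lemma kills_transverse_ver D f : derivation dist2 mu D ->
  {ae mu, forall p, rate D fst p = 0} -> lipb dist2 f ->
  kills_transverse mu D ver f.
Proof.
move=> hD r0 [C lf] c.
apply: (derivation_rate0 dge lm sf coordinate_fst hD r0).
  by exists C; exact: (lip_bounded_by_mv coordinate_snd c lf).
by move=> c'; have := derivation_cst dge (f (c', c)) hD.
Qed.

(** A derivation of the plane is thus determined by its two rates; both the use of independence and
    the final formula rest on this. *)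
Lemma derivation_eq0_plane D f : derivation dist2 mu D ->
  {ae mu, forall p, rate D fst p = 0} -> {ae mu, forall p, rate D snd p = 0} ->
  lipb dist2 f -> {ae mu, forall p, D f p = 0}.
Proof.
move=> hD r1 r2 lf.
exact: (derivation_rate0 dge lm sf coordinate_fst hD r1 lf (kills_transverse_hor hD r2 lf)).
Qed.

Let side (m : nat) : set R := `[- m%:R, m%:R[%classic.
Let square (m : nat) : set plane := side m `*` side m.

Let measurable_square m : measurable (square m).
Proof. by apply: measurableX; exact: measurable_itv. Qed.

Let mu_square m : (mu (square m) < +oo)%E.
Proof.
apply: le_lt_trans (mu_radon (0, 0) (m%:R + m%:R + 1)).
apply: le_measure; rewrite ?inE//; first exact: measurable_disc.
move=> p []; rewrite /side /= !in_itv/= => /andP[a1 a2] /andP[b1 b2].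
have m0 : 0 <= m%:R :> R by [].
rewrite /dist2 /= !sub0r !sqrrN -[ltRHS]ger0_norm ?addr_ge0//.
rewrite -sqrtr_sqr ltr_sqrt; last by rewrite exprn_gt0// ltr_wpDl// addr_ge0.
have h (x : R) : - m%:R <= x -> x < m%:R -> x ^+ 2 <= m%:R ^+ 2.
  move=> h1 /ltW h2; rewrite -[x ^+ 2]real_normK ?num_real//.
  by rewrite lerXn2r ?nnegrE// ler_norml h1.
have := h _ a1 a2; have := h _ b1 b2; move: m0; set u := m%:R; nra.
Qed.

Let leb2_square m : (leb2 (square m) < +oo)%E.
Proof.
have fin : (@lebesgue_measure R (side m) < +oo)%E.
  by rewrite lebesgue_measure_itv/=; case: ifP => _; rewrite -?EFinB ltry.
apply: (@le_lt_trans _ _ (@lebesgue_measure R (side m) * @lebesgue_measure R (side m))%E).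
  rewrite le_eqVlt; apply/orP; left; apply/eqP; apply: lebesgue2_rectangle;
    exact: measurable_itv.
by apply: lte_mul_pinfty => //; rewrite ge0_fin_numE.
Qed.

Let cell (n : nat) (k : int * int) : set plane :=
  [set x : R | Num.floor (x * n.+1%:R) = k.1] `*`
  [set x : R | Num.floor (x * n.+1%:R) = k.2].

Let measurable_cell2 n k : measurable (cell n k).
Proof. by apply: measurableX; exact: measurable_grid_cell. Qed.

Let leb2_cell n k : leb2 (cell n k) = (n.+1%:R^-1 * n.+1%:R^-1)%:E.
Proof.
apply: etrans (lebesgue2_rectangle (measurable_grid_cell n k.1) (measurable_grid_cell n k.2)) _.
by rewrite EFinM; congr (_ * _)%E; exact: lebesgue_grid_cell.
Qed.

(** [D1] moves along the first axis only and [D2] along the second only, with the same rate [r].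
    Strips around graphs over the first axis are collapsed vertically and handled by [D2], those
    over the second axis horizontally and by [D1]. *)
Lemma null_of_rates_plane D1 D2 r (m : nat) (N : set plane) :
  derivation dist2 mu D1 -> derivation dist2 mu D2 ->
  rate D1 fst = r -> (forall p, rate D1 snd p = 0) ->
  rate D2 snd = r -> (forall p, rate D2 fst p = 0) ->
  (forall p, 0 <= r p) -> (forall p, N p -> 0 < r p) ->
  measurable N -> N `<=` square m -> leb2 N = 0%E -> mu N = 0%E.
Proof.
move=> hD1 hD2 r1 k1 r2 k2 r0 Npos mN NQ N0.
have muN : (mu N < +oo)%E.
  by apply: le_lt_trans (mu_square m); apply: le_measure; rewrite ?inE.
have LR : Linf mu r by rewrite -r1; exact: (Linf_rate lm coordinate_fst hD1).
apply: (measure0_of_covers mN muN LR Npos) => eps eps0.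
have NM1 p : N p -> `|p.1| <= m%:R.
  by move=> /NQ[]; rewrite /side /= !in_itv/= => /andP[h1 /ltW h2] _; rewrite ler_norml h1.
have NM2 p : N p -> `|p.2| <= m%:R.
  by move=> /NQ[_]; rewrite /side /= in_itv/= => /andP[h1 /ltW h2]; rewrite ler_norml h1.
have pos1 : {ae mu, forall p, 0 <= rate D1 fst p} by apply: aeW => p; rewrite r1.
have pos2 : {ae mu, forall p, 0 <= rate D2 snd p} by apply: aeW => p; rewrite r2.
have [eta1 eta10 strip1] := rate_strips_small dge lm sf coordinate_fst hD1
  (fun f lf => kills_transverse_hor hD1 (aeW mu k1) lf) pos1 mN muN NM1 (lexx 1) eps0.
have [eta2 eta20 strip2] := rate_strips_small dge lm sf coordinate_snd hD2
  (fun f lf => kills_transverse_ver hD2 (aeW mu k2) lf) pos2 mN muN NM2 (lexx 1) eps0.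
rewrite r1 in strip1; rewrite r2 in strip2.
pose eta := Num.min eta1 eta2.
have eta0 : 0 < eta by rewrite lt_min eta10.
(* With n for the number of cells per unit length, K cells of total area at most eta^2 / 9 give sqrt
   K <= n eta / 3, so sqrt K strips of width 3/n have total width at most eta. *)
have e0 : 0 < Num.min eps (eta ^+ 2 / 9) by rewrite lt_min eps0 divr_gt0// exprn_gt0.
have sym n (x y : plane) : same_cell2 n x y -> same_cell2 n y x.
  by move=> [h1 h2]; split; exact: esym.
have mul n k (x y : plane) : (0 < k)%N -> same_cell2 (n * k) x y -> same_cell2 n x y.
  by move=> k0 [h1 h2]; split; exact: same_cell_mul k0 _.
have [E [mE [[//|n] _ Esat]] [h1 h2]] := @grid_approximation _ _ _ _
  sym mul (@measurable_saturated2 R) mu leb2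
  (square m) N _ (measurable_square m) (mu_square m) (leb2_square m) mN N0 e0.
pose pt (k : int * int) : plane := (k.1%:~R / n.+1%:R, k.2%:~R / n.+1%:R).
pose K := [seq k <- [seq (i, j) | i <- zrange (m * n.+1), j <- zrange (m * n.+1)] |
  `[< E (pt k) >]].
have cell_pt k p : cell n k p -> same_cell2 n.+1 (pt k) p.
  by move=> [h3 h4]; split; rewrite /same_cell /pt /= floor_grid_point; exact: esym.
have szK : (n.+1%:R^-1 * n.+1%:R^-1) * (size K)%:R <= eta ^+ 2 / 9.
  rewrite -lee_fin; apply: (@le_trans _ _ (leb2 (E `&` square m))); last first.
    by apply: le_trans h2 _; rewrite lee_fin ge_min lexx orbT.
  apply: (@measure_packing _ _ _ leb2 _ (cell n)) => //.
  - rewrite filter_uniq// allpairs_uniq ?zrange_uniq//.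
    by move=> [a b] [a' b'].
  - exact: measurableI.
  - move=> [i i'] [j j'] ij; apply/seteqP; split=> // p [[a1 a2] [b1 b2]].
    case/eqP: ij; congr (_, _); first exact: (etrans (esym a1) b1).
    exact: (etrans (esym a2) b2).
  - move=> k; rewrite mem_filter => /andP[/asboolP Ek /allpairsP[[i j] /= [ir jr kE]]].
    split; last by rewrite leb2_cell.
    move=> p pk; split; first by apply: Esat Ek; exact: cell_pt.
    move: pk; rewrite kE => -[/= pi pj].
    by split; rewrite /side /= in_itv/=; apply: (@zrange_floor _ _ n); rewrite ?pi ?pj.
(* The balancing value n eta / 3, rounded down: at most [s] strips over the second axis have total
   width at most eta, and at most K / (s+1) over the first axis likewise, because s + 1 exceeds n
   eta / 3. *)
pose s := Num.truncn (n.+1%:R * eta / 3).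
have [s1 [s2 [g1 [g2 [c1 c2 lg1 lg2 cov]]]]] := @cells_strips R s n.+1 K isT.
pose G1 i (p : plane) := g1 i p.1; pose G2 i (p : plane) := g2 i p.2.
have tG1 i : transverse_lip dist2 ver 1 (G1 i).
  by split=> // p q; rewrite (le_trans (lg1 _ _ _))// dist2_fst.
have tG2 i : transverse_lip dist2 hor 1 (G2 i).
  by split=> // p q; rewrite (le_trans (lg2 _ _ _))// dist2_snd.
have n0 : (0 : R) < n.+1%:R by [].
have w0 : 0 <= 3 / n.+1%:R :> R by rewrite divr_ge0.
have ns0 : 0 <= n.+1%:R * eta / 3 by rewrite divr_ge0// mulr_ge0// ltW.
have w2 : 3 / n.+1%:R * s2%:R <= eta.
  rewrite mulrAC ler_pdivrMr// mulrC -ler_pdivlMr//.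
  apply: (@le_trans _ _ s%:R); first by rewrite ler_nat.
  by rewrite [eta * _]mulrC /s truncn_le.
have w1 : 3 / n.+1%:R * s1%:R <= eta.
  rewrite mulrAC ler_pdivrMr// mulrC -ler_pdivlMr//.
  have sn : n.+1%:R * eta / 3 < s.+1%:R by exact: truncnS_gt.
  have k1' : s1%:R * s.+1%:R <= (size K)%:R :> R by rewrite -natrM ler_nat.
  have k2' : (size K)%:R <= eta ^+ 2 / 9 * (n.+1%:R * n.+1%:R).
    rewrite -ler_pdivrMr ?mulr_gt0// invfM mulrC; exact: szK.
  have k3 : s1%:R * (n.+1%:R * eta / 3) <= s1%:R * s.+1%:R :> R.
    by rewrite ler_wpM2l// ltW.
  have ne0 : 0 < n.+1%:R * eta / 3 by rewrite divr_gt0// mulr_gt0.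
  rewrite -(ler_pM2r ne0) (le_trans k3)// (le_trans k1')// (le_trans k2')//.
  by rewrite le_eqVlt; apply/orP; left; apply/eqP; field.
exists (strips snd (3 / n.+1%:R) G1 s1), (strips fst (3 / n.+1%:R) G2 s2), E; split=> //.
- split=> //.
    exact: (measurable_strips lm coordinate_snd _ tG1).
  exact: (measurable_strips lm coordinate_fst _ tG2).
- move=> p [Np Ep]; have [] := NQ _ Np; rewrite /side /= !in_itv/= => pm1 pm2.
  have /cov [[i is1 h]|[i is2 h]] : (Num.floor (p.1 * n.+1%:R), Num.floor (p.2 * n.+1%:R)) \in K.
    rewrite mem_filter; apply/andP; split; last first.
      apply/allpairsP; eexists (_, _).
      by split; [exact: (floor_zrange n pm1)|exact: (floor_zrange n pm2)|].
    apply/asboolP; apply: Esat Ep; apply: sym; exact: cell_pt.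
  + by left; exists i.
  + by right; exists i.
- rewrite (_ : N `\` E = (N `\` E) `&` square m).
    by apply: le_trans h1 _; rewrite lee_fin ge_min lexx.
  by apply/seteqP; split=> [p [Np Ep]|p []//]; split=> //; exact: NQ.
- by apply: strip2 => //; apply: (le_trans w1); rewrite ge_min lexx orbT.
- by apply: strip1 => //; apply: (le_trans w2); rewrite ge_min lexx.
Qed.

Section TwoDerivations.
Variable delta : 'I_2 -> (plane -> R) -> plane -> R.
Hypothesis hd : forall i, derivation dist2 mu (delta i).
Hypothesis ind : lin_indep dist2 mu delta.

Let D0 := delta ord0.
Let D1 := delta ord_max.
Let x0 := rate D0 fst.
Let x1 := rate D1 fst.
Let y0 := rate D0 snd.
Let y1 := rate D1 snd.
Let om p := x0 p * y1 p - x1 p * y0 p.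

Let hD0 : derivation dist2 mu D0. Proof. exact: hd. Qed.
Let hD1 : derivation dist2 mu D1. Proof. exact: hd. Qed.
Let Lx0 : Linf mu x0. Proof. exact: (Linf_rate lm coordinate_fst hD0). Qed.
Let Lx1 : Linf mu x1. Proof. exact: (Linf_rate lm coordinate_fst hD1). Qed.
Let Ly0 : Linf mu y0. Proof. exact: (Linf_rate lm coordinate_snd hD0). Qed.
Let Ly1 : Linf mu y1. Proof. exact: (Linf_rate lm coordinate_snd hD1). Qed.
Let Lom : Linf mu om. Proof. exact: (LinfB (LinfM Lx0 Ly1) (LinfM Lx1 Ly0)). Qed.

(** A combination whose rates vanish is the zero derivation, so independence of the derivations
    becomes independence of the rate vectors over L^oo. *)
Lemma comb_independent (a b : plane -> R) : Linf mu a -> Linf mu b ->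
  {ae mu, forall p, a p * x0 p + b p * x1 p = 0} ->
  {ae mu, forall p, a p * y0 p + b p * y1 p = 0} ->
  {ae mu, forall p, a p = 0} /\ {ae mu, forall p, b p = 0}.
Proof.
move=> La Lb ex ey.
pose lam (i : 'I_2) := if i == ord0 then a else b.
have Llam i : Linf mu (lam i) by rewrite /lam; case: ifP.
have hab := derivation_comb hD0 hD1 La Lb.
have rx : {ae mu, forall p, rate (fun f p => a p * D0 f p + b p * D1 f p) fst p = 0}.
  by apply: filterS ex => p; rewrite rate_comb.
have ry : {ae mu, forall p, rate (fun f p => a p * D0 f p + b p * D1 f p) snd p = 0}.
  by apply: filterS ey => p; rewrite rate_comb.
have h : forall i, {ae mu, forall p, lam i p = 0}.
  apply: ind => // f lf; have := derivation_eq0_plane hab rx ry lf.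
  apply: filterS => p e; rewrite big_ord_recl big_ord1 /lam /= -[RHS]e.
  by congr (_ + b p * delta _ f p); exact: val_inj.
by split; [exact: (h ord0)|exact: (h ord_max)].
Qed.

Lemma determinant_neq0 : {ae mu, forall p, om p != 0}.
Proof.
pose Z := [set p | om p = 0]; pose z : plane -> R := \1_Z.
have Lz : Linf mu z by apply: Linf_indic; apply: measurable_zeros; case: Lom.
have zom p : z p * om p = 0.
  rewrite /z indicE; have [/set_mem ->|_] := boolP (p \in Z); first by rewrite mulr0.
  by rewrite mul0r.
(* Where the determinant vanishes, (x1, -x0) and (y1, -y0) are coefficients of relations between the
   two rate vectors. So all four rates vanish there, and then (1, 0) is a relation too, which forces
   the indicator [z] to be 0. *)
have [zx1 zx0] : {ae mu, forall p, z p * x1 p = 0} /\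
    {ae mu, forall p, - (z p * x0 p) = 0}.
  apply: comb_independent; [exact: LinfM|exact/LinfN/LinfM|apply: aeW..] => p.
    by ring.
  by apply: etrans (_ : - (z p * om p) = 0); [rewrite /om; ring|rewrite zom oppr0].
have [zy1 zy0] : {ae mu, forall p, z p * y1 p = 0} /\
    {ae mu, forall p, - (z p * y0 p) = 0}.
  apply: comb_independent; [exact: LinfM|exact/LinfN/LinfM|apply: aeW..] => p.
    by apply: etrans (zom p); rewrite /om; ring.
  by ring.
have [z0 _] : {ae mu, forall p, z p = 0} /\ {ae mu, forall p, (fun=> 0 : R) p = 0}.
  apply: comb_independent => //; first exact: Linf_cst.
  - by apply: filterS zx0 => p /eqP; rewrite oppr_eq0 => /eqP ->; rewrite mul0r addr0.
  - by apply: filterS zy0 => p /eqP; rewrite oppr_eq0 => /eqP ->; rewrite mul0r addr0.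
apply: filterS z0 => p; apply: contra_eq_neq => omp.
by rewrite /z indicE mem_set//= oner_neq0.
Qed.

(** Cramer's rule without division: the coefficients are those of the adjugate matrix of the rates,
    so they stay in L^oo, and the rates become (om, 0) and (0, om). *)
Let E1 f p := y1 p * D0 f p + - y0 p * D1 f p.
Let E2 f p := - x1 p * D0 f p + x0 p * D1 f p.

Let hE1 : derivation dist2 mu E1.
Proof. exact: (derivation_comb hD0 hD1 Ly1 (LinfN Ly0)). Qed.
Let hE2 : derivation dist2 mu E2.
Proof. exact: (derivation_comb hD0 hD1 (LinfN Lx1) Lx0). Qed.

Let E1x p : rate E1 fst p = om p.
Proof. by rewrite rate_comb /om -/x0 -/x1; ring. Qed.
Let E1y p : rate E1 snd p = 0.
Proof. by rewrite rate_comb -/y0 -/y1; ring. Qed.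
Let E2x p : rate E2 fst p = 0.
Proof. by rewrite rate_comb -/x0 -/x1; ring. Qed.
Let E2y p : rate E2 snd p = om p.
Proof. by rewrite rate_comb /om -/y0 -/y1; ring. Qed.

Lemma absolute_continuity_plane : mu `<< leb2.
Proof.
have nz := determinant_neq0.
(* One more factor [om] turns the common rate into om^2, which is nonnegative and is positive off
   the zeros of the determinant. *)
have hF1 := derivation_comb hE1 hE1 Lom (Linf_cst mu 0).
have hF2 := derivation_comb hE2 hE2 Lom (Linf_cst mu 0).
apply/null_content_dominatesP => A mA A0.
pose N (m : nat) := A `&` square m `&` ~` [set p | om p = 0].
have mZ : measurable (~` [set p | om p = 0]).
  by apply: measurableC; apply: measurable_zeros; case: Lom.
have mN m : measurable (N m) by apply: measurableI => //; exact: measurableI.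
have N0 m : mu (N m) = 0%E.
  apply: (@null_of_rates_plane _ _ (fun p => om p * om p) m _ hF1 hF2) => //.
  - by apply/funext => p; rewrite rate_comb E1x; ring.
  - by move=> p; rewrite rate_comb E1y; ring.
  - by apply/funext => p; rewrite rate_comb E2y; ring.
  - by move=> p; rewrite rate_comb E2x; ring.
  - by move=> p; rewrite -expr2 sqr_ge0.
  - by move=> p [_ /= omp]; rewrite -expr2 lt0r sqr_ge0 andbT sqrf_eq0; apply/eqP.
  - by move=> p [[]].
  - apply/eqP; rewrite -measure_le0 -A0; apply: le_measure; rewrite ?inE//.
    by move=> p [[]].
have negN : mu.-negligible (\bigcup_m N m).
  by apply: negligible_bigcup => m; exists (N m); split.
have negA : mu.-negligible A.
  apply: negligibleS (negligibleU negN nz) => p Ap.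
  have [omp|omp] := pselect (om p = 0); first by right; rewrite /= omp eqxx.
  left; exists (Num.truncn (Num.max `|p.1| `|p.2|)).+1 => //; split=> //; split=> //.
  have := truncnS_gt (Num.max `|p.1| `|p.2|); rewrite gt_max !ltr_norml.
  by move=> /andP[/andP[/ltW a1 a2] /andP[/ltW b1 b2]]; split; rewrite /side /= in_itv/= ?a1 ?b1.
by have [B [mB B0 AB]] := negA; apply/eqP; rewrite -measure_le0 -B0 le_measure ?inE.
Qed.

(** The chain rule applies to [E1] and [E2], which kill transverse functions, but not directly to
    [D]. The derivation om D - D(x) E1 - D(y) E2, with D(x) and D(y) the rates of [D], has zero
    rates and so vanishes; dividing by [om] gives the formula. *)
Lemma derivation_formula_plane D f : derivation dist2 mu D -> lipb dist2 f ->
  {ae mu, forall p, D f p = rate D fst p * derive1 (fun t => f (t, p.2)) p.1 +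
                            rate D snd p * derive1 (fun t => f (p.1, t)) p.2}.
Proof.
move=> hD lf; have [C [_ lf2]] := lf.
have df := dominated_ae absolute_continuity_plane (lipschitz_partial_derivable lf2).
have df1 : {ae mu, forall p, derivable (fun t => f (t, p.2)) p.1 1}.
  by apply: filterS df => p dp; exact: (proj1 dp).
have df2 : {ae mu, forall p, derivable (fun t => f (p.1, t)) p.2 1}.
  by apply: filterS df => p dp; exact: (proj2 dp).
have c1 := derivation_chain dge lm sf coordinate_fst hE1 lf
  (kills_transverse_hor hE1 (aeW mu E1y) lf) df1.
have c2 := derivation_chain dge lm sf coordinate_snd hE2 lf
  (kills_transverse_ver hE2 (aeW mu E2x) lf) df2.
have Ldx := Linf_rate lm coordinate_fst hD; have Ldy := Linf_rate lm coordinate_snd hD.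
have hA := derivation_comb hD hE1 Lom (LinfN Ldx).
have hB := derivation_comb hA hE2 (Linf_cst mu 1) (LinfN Ldy).
have zero := derivation_eq0_plane hB _ _ lf.
have {}zero : {ae mu, forall p, 1 * (om p * D f p + - rate D fst p * E1 f p) +
    - rate D snd p * E2 f p = 0}.
  have rB pi p : rate (fun f p => 1 * (om p * D f p + - rate D fst p * E1 f p) +
      - rate D snd p * E2 f p) pi p = 1 * (om p * rate D pi p +
      - rate D fst p * rate E1 pi p) + - rate D snd p * rate E2 pi p.
    rewrite -(rate_comb D E1 om (fun p => - rate D fst p)).
    exact: (rate_comb _ E2 (fun=> 1) (fun p => - rate D snd p)).
  apply: zero; apply: aeW => p; rewrite rB; first by rewrite E1x E2x; ring.
  by rewrite E1y E2y; ring.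
apply: filterS2 (filterI c1 c2) (filterI zero determinant_neq0) => p [e1 e2] [e0 omp].
apply: (mulfI omp); move: e0; rewrite e1 e2 E1x E2y => /eqP.
rewrite mul1r addr_eq0 => /eqP e.
rewrite -[LHS](subrK (rate D fst p * (om p * derive1 (fun t => f (t, p.2)) p.1))).
rewrite -[_ * D f p - _]/(_ + _) -mulNr e; ring.
Qed.

End TwoDerivations.
End PlaneMeasure.

Theorem theorem1p2 (R : realType) :
  (* k = 1 *)
  (forall mu : {measure set R -> \bar R},
    radon dist1 mu -> derivation_rank_eq dist1 mu 1 ->
    (mu `<< (@lebesgue_measure R)) /\
    (forall delta, derivation dist1 mu delta ->
       exists lam : 'I_1 -> R -> R, (forall i, Linf mu (lam i)) /\
         (forall f, lipb dist1 f ->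
            {ae mu, forall x, delta f x = \sum_(i < 1) lam i x * partial1 i f x})))
  /\
  (* k = 2 *)
  (forall mu : {measure set (R * R) -> \bar R},
    radon dist2 mu -> derivation_rank_eq dist2 mu 2 ->
    (mu `<< (@lebesgue2 R)) /\
    (forall delta, derivation dist2 mu delta ->
       exists lam : 'I_2 -> R * R -> R, (forall i, Linf mu (lam i)) /\
         (forall f, lipb dist2 f ->
            {ae mu, forall x, delta f x = \sum_(i < 2) lam i x * partial2 i f x}))).
Proof.
split=> [mu hr [[delta [hd ind]] _]|mu hr [[delta [hd ind]] _]]; split.
- exact: (absolute_continuity_line hr hd ind).
- move=> D hD; exists (fun=> rate D id); split=> [i|f lf].
    exact: (Linf_rate lipschitz_measurable coordinate_line hD).
  have := derivation_formula_line hr (absolute_continuity_line hr hd ind) hD lf.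
  by apply: filterS => x ->; rewrite big_ord1.
- exact: (absolute_continuity_plane hr hd ind).
- move=> D hD.
  exists (fun i : 'I_2 => if i == ord0 then rate D fst else rate D snd); split.
    move=> i; case: ifP => _.
      exact: (Linf_rate lipschitz_measurable2 coordinate_fst hD).
    exact: (Linf_rate lipschitz_measurable2 coordinate_snd hD).
  move=> f lf; apply: filterS (derivation_formula_plane hr hd ind hD lf) => p ->.
  by rewrite big_ord_recl big_ord1.
Qed.
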